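(* For every $\varepsilon>0$ there is a measurable function $Q:\mathbb{R}^2\to\mathbb{R}$ with $$1-\varepsilon\le Q(x_1,x_2)\le1+\varepsilon\quad\text{for every }(x_1,x_2)\in\mathbb{R}^2,$$ and a function $u:\mathbb{R}^2\to\mathbb{R}$ which is a minimizer of $J_Q$ in $B_1$ satisfying $$(x_2-\varepsilon)_+\le u(x_1,x_2)\le(x_2+\varepsilon)_+\quad\text{for }(x_1,x_2)\in B_1,$$ such that $0\in\partial\{u>0\}$ is a singular free boundary point.
   Context: $B_1$ is the unit ball of $\mathbb{R}^2$ centered at the origin; $t_+=\max\{t,0\}$. For $u\in H^1(B_1)$, $J_Q(u)=\int_{B_1}|\nabla u|^2+Q(x)1_{\{u>0\}}\,dx$. A nonnegative $u\in H^1(B_1)$ is a minimizer of $J_Q$ in $B_1$ if $J_Q(u)\le J_Q(v)$ for every $v\in H^1(B_1)$ with $u-v\in H^1_0(B_1)$. A free boundary point $x_0\in\partial\{u>0\}\cap B_1$ is singular if there is no neighborhood of $x_0$ in which $\partial\{u>0\}$ is a $C^{1,\beta}$ regular manifold (curve) for some $\beta>0$. *)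

(* Defs.v *)
From HB Require Import structures.
From mathcomp Require Import all_boot all_order all_algebra.
From mathcomp Require Import all_classical all_reals all_analysis.

Set Implicit Arguments.
Unset Strict Implicit.
Unset Printing Implicit Defensive.

Import Order.TTheory GRing.Theory Num.Theory.
Import numFieldNormedType.Exports.

Local Open Scope classical_set_scope.
Local Open Scope ring_scope.

Section OnePhase.
Variable R : realType.

(* The library norm on R * R is the sup norm, hence the explicit Euclidean
   expression. *)
Definition B1 : set (R * R) := [set x | x.1 ^+ 2 + x.2 ^+ 2 < 1].

(* Measurability on R * R is Borel measurability.  Every Lebesgue class has a
   Borel representative, so the spaces below are the usual ones. *)
Definition leb2 :
  {measure set (measurableTypeR R * measurableTypeR R) -> \bar R} :=
  (@lebesgue_measure R \x @lebesgue_measure R)%E.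

Definition pderiv1 (f : R * R -> R) (x : R * R) : R := 'D_(1, 0) f x.
Definition pderiv2 (f : R * R -> R) (x : R * R) : R := 'D_(0, 1) f x.

(* [pderivs s f] is the iterated partial derivative of [f], in the second
   variable for each [true] in [s] and in the first one for each [false]. *)
Definition pderivs (s : seq bool) (f : R * R -> R) : R * R -> R :=
  foldr (fun i g => if i then pderiv2 g else pderiv1 g) f s.

Definition smooth (f : R * R -> R) : Prop :=
  forall s : seq bool,
    [/\ continuous (pderivs s f),
        forall x, derivable (pderivs s f) x (1, 0) &
        forall x, derivable (pderivs s f) x (0, 1)].

(* C_c^oo(B_1), extended by zero *)
Definition test_fun (phi : R * R -> R) : Prop :=
  [/\ smooth phi,
      compact (closure [set x | phi x != 0]) &
      closure [set x | phi x != 0] `<=` B1].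

Definition L2B1 (f : R * R -> R) : Prop :=
  measurable_fun B1 f /\ leb2.-integrable B1 (fun x => (f x ^+ 2)%:E).

Definition is_weak_grad (u : R * R -> R) (g : R * R -> R * R) : Prop :=
  [/\ L2B1 (fun x => (g x).1), L2B1 (fun x => (g x).2) &
      forall phi, test_fun phi ->
        (\int[leb2]_(x in B1) (u x * pderiv1 phi x)
           = - \int[leb2]_(x in B1) ((g x).1 * phi x)) /\
        (\int[leb2]_(x in B1) (u x * pderiv2 phi x)
           = - \int[leb2]_(x in B1) ((g x).2 * phi x))].

Definition H1 (u : R * R -> R) : Prop :=
  L2B1 u /\ exists g, is_weak_grad u g.

(* A choice of the weak gradient, which is unique up to null sets; it is only
   used under an integral, and only meaningful for u in H^1(B_1). *)
Definition weak_grad (u : R * R -> R) : R * R -> R * R :=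
  xget (fun=> (0, 0)) [set g | is_weak_grad u g].

Definition grad_sq (u : R * R -> R) (x : R * R) : R :=
  (weak_grad u x).1 ^+ 2 + (weak_grad u x).2 ^+ 2.

Definition H1_sqnorm (u : R * R -> R) : \bar R :=
  (\int[leb2]_(x in B1) (u x ^+ 2 + grad_sq u x)%:E)%E.

(* the closure of C_c^oo(B_1) in H^1(B_1) *)
Definition H10 (w : R * R -> R) : Prop :=
  H1 w /\ forall e : R, 0 < e ->
    exists2 phi, test_fun phi & (H1_sqnorm (w \- phi)%R < e%:E)%E.

Definition JQ (Q u : R * R -> R) : \bar R :=
  (\int[leb2]_(x in B1) (grad_sq u x + Q x * \1_[set y | 0 < u y] x)%:E)%E.

Definition minimizer (Q u : R * R -> R) : Prop :=
  [/\ H1 u, forall x, B1 x -> 0 <= u x &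
      forall v, H1 v -> H10 (u \- v) -> (JQ Q u <= JQ Q v)%E].

Definition bdry (A : set (R * R)) : set (R * R) := closure A `\` interior A.

Definition free_boundary (u : R * R -> R) : set (R * R) :=
  bdry [set x | 0 < u x].

(* [S] is an embedded C^{1,beta} curve: near each of its points it is the
   homeomorphic image of an open interval under a regular parametrization with
   beta-Hoelder derivative.  [inv] is the inverse of the parametrization. *)
Definition C1beta_curve (beta : R) (S : set (R * R)) : Prop :=
  forall p, S p ->
    exists (V : set (R * R)) (gamma : R -> R * R) (inv : R * R -> R) (C : R),
      [/\ open_nbhs p V,
          gamma @` `]-1, 1[ = S `&` V,
          (forall t : R, t \in `]-1, 1[ -> inv (gamma t) = t) /\
          {within S `&` V, continuous inv},
          forall t : R, t \in `]-1, 1[ ->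
            derivable gamma t 1 /\ derive1 gamma t != 0 &
          forall s t : R, s \in `]-1, 1[ -> t \in `]-1, 1[ ->
            `|derive1 gamma s - derive1 gamma t| <= C * `|s - t| `^ beta].

Definition singular_point (u : R * R -> R) (x0 : R * R) : Prop :=
  [/\ free_boundary u x0, B1 x0 &
      ~ exists (U : set (R * R)) (beta : R),
          [/\ open_nbhs x0 U, 0 < beta &
              C1beta_curve beta (free_boundary u `&` U)]].

End OnePhase.

(* Main.v *)
(** Cut the plane along two logarithmic spirals into the domain
    [0 < arg z - del ln |z| < pi (1 + del^2)] and its complement.  The power
    [z^(a - i b)], with [a = 1 / (1 + del^2)] and [b = del a], maps the domain
    conformally onto the upper half plane, and it is the identity for
    [del = 0].  Let [u] be its imaginary part, extended by 0, and
    [Q = |grad u|^2] in the domain, [Q = 1 + 30 del] outside.  For small [del],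
    [u] is close to [(x_2)_+] and [Q] is close to 1.

    Minimality is a calibration argument.  The real part [psi], reflected into
    the complement, is Lipschitz with [|grad psi|^2 <= Q] everywhere, and the
    divergence-free field [q = (- d_2 psi, d_1 psi)] equals [grad u] in the
    domain.  For a competitor [v],
    [2 q . grad (v_+) <= |grad v|^2 + Q 1_{v > 0}], with equality for [u], and
    the integral of the left-hand side depends only on the boundary values.

    The spirals cross each ray from 0 at points accumulating at 0, so the free
    boundary has no tangent line there and is not a [C^1] curve near 0. *)

Require Import Defs.
From HB Require Import structures.
From mathcomp Require Import all_boot all_order all_algebra.
From mathcomp Require Import all_classical all_reals all_analysis.
From mathcomp Require Import measurable_realfun ring lra.
Import Order.TTheory GRing.Theory Num.Theory.
Import numFieldNormedType.Exports.
Local Open Scope classical_set_scope.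
Local Open Scope ring_scope.
Set Implicit Arguments.
Unset Strict Implicit.

(** * Lebesgue measure on the plane *)

(** The exponent is forced. With [s = arg z - del ln r], the power [z^(a - i b)] has modulus
    [r^(a + b del) exp (b s)] and phase [a s + (a del - b) ln r]. Degree 1 in [r] and a phase
    depending on [s] alone require [a + b del = 1] and [b = a del]. All functions of the
    construction are then of the form [r P(s)], and the polar components of their gradients depend
    on [s] only: they are Lipschitz although the spirals wind infinitely often around 0. The field
    [q] is divergence-free across the spirals because [psi] is Lipschitz there, so the reflection
    may be a piecewise linear change of [s]. It distorts the gradient by O([del]), which the margin
    [30 del] absorbs. A competitor [v] is merely in H^1. The definition of [H10] allows it to be
    replaced by the Lipschitz function [u - phi] with [phi] a test function, and the positive part
    is replaced by a C^1 function with Lipschitz derivative at scale [tau]. The error contains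
    [tau^-2], so [phi] must approach [u - v] before [tau] tends to 0. *)

Section PlaneMeasure.
Context {R : realType}.
Local Notation plane := (measurableTypeR R * measurableTypeR R)%type.
Local Notation mu := (@leb2 R).

(** Measurability refers to the product sigma-algebra, openness to the sup norm. Balls of that norm
    are squares, hence measurable rectangles, and countably many of them, with rational centre and
    radius [1/(n+1)], exhaust [A]. *)
Lemma open_measurable_plane (A : set (R * R)) :
  open A -> measurable (A : set plane).
Proof.
move=> oA.
pose F (i : rat * rat * nat) : set (R * R) :=
  let c := (ratr i.1.1, ratr i.1.2) : R * R in
  if `[< ball c (i.2.+1%:R^-1 : R) `<=` A >] then ball c (i.2.+1%:R^-1 : R) else set0.
have -> : A = \bigcup_i F i.
  apply/seteqP; split => x.
    move=> Ax.
    have := open_nbhsE x A; rewrite propeqE => -[/(_ (conj oA Ax))[_ +] _].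
    move=> /nbhs_ballP[e /= e0 xeA].
    have [n /ltW ne] : exists n, n.+1%:R^-1 < e / 2.
      have e20 : 0 < e / 2 by rewrite divr_gt0.
      have [n _ /(_ n (leqnn n))] := near_infty_natSinv_lt (PosNum e20).
      by exists n.
    have D (t : R) : exists q : rat, ball t (n.+1%:R^-1 : R) (ratr q).
      have := @dense_rat R (ball t (n.+1%:R^-1 : R)).
      case.
      - by exists t; apply: ballxx; rewrite invr_gt0.
      - exact: ball_open.
      - by move=> _ [/[swap] [[q _ <-]]] ?; exists q.
    have [p Hp] := D x.1; have [q Hq] := D x.2.
    exists (p, q, n) => //; rewrite /F /=.
    case: asboolP => [_|H].
      by split; apply: ball_sym.
    exfalso; apply: H => y [] /= y1 y2; apply: xeA.
    rewrite [e]splitr; split => /=.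
      exact: ball_triangle (le_ball ne Hp) (le_ball ne y1).
    exact: ball_triangle (le_ball ne Hq) (le_ball ne y2).
  move=> [i _]; rewrite /F; case: asboolP => [H|_ //]; exact: H.
apply: countable_bigcupT_measurable; first exact: countableP.
move=> i; rewrite /F; case: asboolP => _; last exact: measurable0.
rewrite [X in measurable X](_ : _ =
  ball (ratr i.1.1 : R) (i.2.+1%:R^-1 : R) `*` ball (ratr i.1.2 : R) (i.2.+1%:R^-1 : R)) //.
by apply: measurableX; apply: open_measurable; exact: ball_open.
Qed.

Lemma continuous_measurable_plane (f : R * R -> R) :
  continuous f -> measurable_fun setT (f : plane -> R).
Proof.
move=> cf; apply: (measurability _ (RGenOpens.measurableE R)).
move=> _ [_ [a [b ->] <-]]; rewrite setTI; apply: open_measurable_plane.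
by move/continuousP : cf; apply; apply: interval_open.
Qed.

Definition pshift (v x : R * R) : R * R := (x.1 + v.1, x.2 + v.2).

Lemma measurable_shift v : measurable_fun setT (pshift v : plane -> plane).
Proof.
apply/measurable_fun_pairP; split.
  by apply: measurable_funD; [exact: measurable_fst|exact: measurable_cst].
by apply: measurable_funD; [exact: measurable_snd|exact: measurable_cst].
Qed.

Lemma measurable_translate (c : R) : measurable_fun setT (fun x : measurableTypeR R => (x + c : measurableTypeR R)).
Proof. by apply: measurable_funD; [exact: measurable_id|exact: measurable_cst]. Qed.

Lemma lebesgue_measure_translate (c : R) (A : set (measurableTypeR R)) : measurable A ->
  lebesgue_measure ((fun x : R => x + c) @^-1` A) = lebesgue_measure A.
Proof.
move=> mA; apply/esym.
pose m := measure_function_pushforward__canonical__measure_function_Measure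
   (@lebesgue_measure R) (measurable_translate c).
apply: (@lebesgue_measure_unique R m) => //= _ [[a b] _ <-].
rewrite /m /= /pushforward.
rewrite (_ : _ @^-1` _ = `]a - c, b - c]%classic); last first.
  by apply/seteqP; split => x /=; rewrite !in_itv /= ltrBlDr lerBrDr.
rewrite !lebesgue_measure_itv /= !lte_fin ltrD2r; case: ifP => // _.
by rewrite -!EFinB; congr _%:E; ring.
Qed.

Lemma leb2_setX (A B : set (measurableTypeR R)) : measurable A -> measurable B ->
  mu (A `*` B) = (lebesgue_measure A * lebesgue_measure B)%E.
Proof. by move=> mA mB; rewrite /leb2 /= product_measure1E. Qed.

(** By uniqueness of the product measure only rectangles have to be compared, and there the
    one-dimensional invariance applies in each factor. *)
Lemma leb2_shift (v : R * R) (A : set plane) : measurable A ->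
  mu (pshift v @^-1` A) = mu A.
Proof.
move=> mA; apply/esym.
pose m := measure_function_pushforward__canonical__measure_function_Measure
   mu (measurable_shift v).
apply: (@product_measure_unique _ _ _ _ _ _ _ m) => // B C mB mC.
rewrite /m /= /pushforward.
rewrite (_ : _ @^-1` _ = ((fun x : R => x + v.1) @^-1` B) `*` ((fun x : R => x + v.2) @^-1` C)) //.
have mB' : measurable ((fun x : measurableTypeR R => (x + v.1 : measurableTypeR R)) @^-1` B).
  by rewrite -[X in measurable X]setTI; exact: measurable_translate.
have mC' : measurable ((fun x : measurableTypeR R => (x + v.2 : measurableTypeR R)) @^-1` C).
  by rewrite -[X in measurable X]setTI; exact: measurable_translate.
rewrite /leb2 product_measure1E //.
by rewrite -(lebesgue_measure_translate v.1 mB) -(lebesgue_measure_translate v.2 mC).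
Qed.

Lemma eq_pushforward_shift v :
  forall A, measurable A -> pushforward mu (pshift v : plane -> plane) A = mu A.
Proof. by move=> A mA; rewrite /pushforward leb2_shift. Qed.

Lemma ge0_integral_shift (v : R * R) (f : plane -> \bar R) :
  measurable_fun setT f -> (forall x, 0 <= f x)%E ->
  (\int[mu]_x f (pshift v x) = \int[mu]_x f x)%E.
Proof.
move=> mf f0.
have := ge0_integral_pushforward (measurable_shift v) mu measurableT mf (fun x _ => f0 x).
rewrite preimage_setT => <-.
pose m := measure_function_pushforward__canonical__measure_function_Measure mu (measurable_shift v).
have H : forall A, measurable A -> A `<=` setT -> m A = mu A.
  by move=> A mA _; exact: eq_pushforward_shift.
exact: (@eq_measure_integral _ plane R setT mu m f H).
Qed.

Lemma integrable_shift (v : R * R) (f : plane -> \bar R) :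
  mu.-integrable setT f -> mu.-integrable setT (f \o pshift v).
Proof.
move=> /integrableP[mf foo]; apply/integrableP; split.
  by apply: measurableT_comp => //; exact: measurable_shift.
rewrite (ge0_integral_shift v (f := fun x => `|f x|%E)) //.
exact: measurableT_comp.
Qed.

Lemma integral_shift (v : R * R) (f : plane -> \bar R) :
  mu.-integrable setT f ->
  (\int[mu]_x f (pshift v x) = \int[mu]_x f x)%E.
Proof.
move=> fi; have mf := measurable_int _ fi.
rewrite [RHS]integralE [LHS]integralE; congr (_ - _)%E.
  rewrite -(@ge0_integral_shift v (f^\+)%E); [by apply: eq_integral => x _; rewrite -[RHS]/((f^\+ \o pshift v)%E x) -funepos_comp|exact: measurable_funepos|by []].
rewrite -(@ge0_integral_shift v (f^\-)%E); [by apply: eq_integral => x _; rewrite -[RHS]/((f^\- \o pshift v)%E x) -funeneg_comp|exact: measurable_funeneg|by []].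
Qed.

Lemma Rintegral_shift (v : R * R) (f : plane -> R) :
  mu.-integrable setT (EFin \o f) ->
  \int[mu]_x f (pshift v x) = \int[mu]_x f x.
Proof. by move=> fi; rewrite /Rintegral (integral_shift v fi). Qed.

End PlaneMeasure.

(** * Integration by parts for Lipschitz functions *)

Section IntegrationByParts.
Context {R : realType}.
Local Notation plane := (measurableTypeR R * measurableTypeR R)%type.
Local Notation mu := (@leb2 R).

Definition box (M : R) : set (R * R) := [set x | `|x.1| <= M /\ `|x.2| <= M].

Lemma measurable_box M : measurable (box M : set plane).
Proof.
rewrite (_ : box M = `[- M, M]%classic `*` `[- M, M]%classic).
  by apply: measurableX; exact: measurable_itv.
by apply/seteqP; split => x; rewrite /box /= !in_itv /= !ler_norml.
Qed.

Lemma leb2_box_lty M : (mu (box M) < +oo)%E.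
Proof.
rewrite (_ : box M = `[- M, M]%classic `*` `[- M, M]%classic).
  rewrite leb2_setX; [|exact: measurable_itv..].
  by rewrite /= lebesgue_measure_itv /=; case: ifP => _; rewrite ?mule0 // -EFinB -EFinM ltry.
by apply/seteqP; split => x; rewrite /box /= !in_itv /= !ler_norml.
Qed.

Lemma integrable_box (f : plane -> R) M C :
  measurable_fun setT f -> (forall x, `|f x| <= C) ->
  (forall x, ~ box M x -> f x = 0) -> mu.-integrable setT (EFin \o f).
Proof.
move=> mf fC f0.
have -> : EFin \o f = (EFin \o f) \_ (box M).
  apply/funext => x; rewrite patchE /=; case: ifPn => // /negP H.
  by rewrite f0 // => H1; apply: H; rewrite inE.
apply/(integrable_mkcond _ (measurable_box M)).
apply: measurable_bounded_integrable.
- exact: measurable_box.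
- exact: leb2_box_lty.
- exact: measurable_funTS.
- exists C; split; first exact: num_real.
  by move=> D CD x _; apply: le_trans (fC x) (ltW CD).
Qed.

(** Dominated convergence with majorant [C] times the indicator of the box; the limits of difference
    quotients below are all taken through it. *)
Lemma cvg_Rintegral_box (f_ : nat -> plane -> R) (f : plane -> R) M C :
  (forall n, measurable_fun setT (f_ n)) -> measurable_fun setT f ->
  (forall n x, `|f_ n x| <= C) ->
  (forall n x, ~ box M x -> f_ n x = 0) ->
  {ae mu, forall x, (fun n => f_ n x) @ \oo --> f x} ->
  (fun n => \int[mu]_x f_ n x) @ \oo --> \int[mu]_x f x.
Proof.
move=> mf_ mf fC f0 ff.
pose g : plane -> R := fun x => C * \1_(box M) x.
have C0 : 0 <= C by apply: le_trans (fC 0%N (0,0)); exact: normr_ge0.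
have mg : measurable_fun setT g.
  apply: measurable_funM => //; apply: measurable_indic; exact: measurable_box.
have gi : mu.-integrable setT (EFin \o g).
  apply: (@integrable_box _ M C) => // x.
    rewrite /g normrM (ger0_norm C0) ler_piMr // ger0_norm // indicE; by case: (_ \in _).
  by move=> H; rewrite /g indicE memNset ?mulr0.
have [] := @dominated_convergence _ plane R mu setT measurableT
  (fun n => EFin \o f_ n) (EFin \o f) (EFin \o g).
- by move=> n; apply/measurable_EFinP.
- exact/measurable_EFinP.
- by apply: filterS ff => x Hx _; apply: cvg_EFin => //; exact: nearW.
- exact: gi.
- apply: nearW => x n _; rewrite /= lee_fin /g indicE.
  case: (pselect (box M x)) => H; first by rewrite mem_set // mulr1.
  by rewrite f0 // normr0 mulr_ge0.
move=> fi _ H; rewrite /Rintegral; apply: fine_cvg; rewrite fineK //.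
by apply: integrable_fin_num.
Qed.

(** The distance is the l^1 one: bounds on the two partial derivatives then yield a Lipschitz
    constant along an axis-parallel path. *)
Definition lip (L : R) (f : R * R -> R) : Prop :=
  forall x y, `|f x - f y| <= L * (`|x.1 - y.1| + `|x.2 - y.2|).

Lemma lip_ge0 L f : lip L f -> 0 <= L.
Proof.
move=> /(_ (1, 0) (0, 0)) /=; rewrite !subr0 normr1 normr0 addr0 mulr1.
exact: le_trans.
Qed.

Lemma lip_continuous L f : lip L f -> continuous f.
Proof.
move=> lf x; have L0 := lip_ge0 lf; apply/cvgrPdist_le => e e0.
have L1 : 0 < L + 1 by rewrite ltr_wpDl.
have e1 : 0 < e / (2 * (L + 1)) by rewrite divr_gt0 // mulr_gt0.
near=> y; apply: le_trans (lf x y) _.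
have H1 : `|x.1 - y.1| <= e / (2 * (L + 1)).
  near: y. have : (fst (y : R * R)) @[y --> x] --> x.1 by apply: cvg_fst.
  by move/cvgrPdist_le; apply.
have H2 : `|x.2 - y.2| <= e / (2 * (L + 1)).
  near: y. have : (snd (y : R * R)) @[y --> x] --> x.2 by apply: cvg_snd.
  by move/cvgrPdist_le; apply.
rewrite [leRHS](_ : _ = (L + 1) * (e / (2 * (L + 1)) + e / (2 * (L + 1)))); last first.
  by field; rewrite gt_eqF.
apply: ler_pM; rewrite ?addr_ge0 //; first by rewrite lerDl.
exact: lerD.
Unshelve. all: by end_near.
Qed.

Lemma lip_measurable L f : lip L f -> measurable_fun setT (f : plane -> R).
Proof. by move=> lf; apply: continuous_measurable_plane; exact: lip_continuous lf. Qed.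

Lemma lip_le_box L M f : lip L f ->
  forall x, box M x -> `|f x| <= `|f (0, 0)| + L * (M + M).
Proof.
move=> lf x [x1 x2]; have L0 := lip_ge0 lf.
rewrite -[f x](subrK (f (0, 0))) (le_trans (ler_normD _ _)) // addrC lerD2l.
apply: le_trans (lf _ _) _; by rewrite /= !subr0 ler_wpM2l // lerD.
Qed.

Definition dq (h : R) (v : R * R) (f : R * R -> R) (x : R * R) : R :=
  h^-1 * (f (x.1 + h * v.1, x.2 + h * v.2) - f x).

Lemma dqE h v f : dq h v f = fun x => h^-1 * (f (pshift (h * v.1, h * v.2) x) - f x).
Proof. by []. Qed.

Lemma measurable_dq h v L f : lip L f -> measurable_fun setT (dq h v f : plane -> R).
Proof.
move=> lf; rewrite dqE; apply: measurable_funM => //.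
apply: measurable_funB; last exact: lip_measurable lf.
apply: measurableT_comp; [exact: lip_measurable lf|exact: measurable_shift].
Qed.

Lemma dq_le h v L f x : lip L f -> `|dq h v f x| <= L * (`|v.1| + `|v.2|).
Proof.
move=> lf; have L0 := lip_ge0 lf; rewrite /dq.
have [->|h0] := eqVneq h 0; first by rewrite invr0 mul0r normr0 mulr_ge0 ?addr_ge0.
rewrite normrM normfV ler_pdivrMl ?normr_gt0 //.
apply: le_trans (lf _ _) _; rewrite /= !(addrAC _ _ (- _)) !subrr !add0r !normrM.
by rewrite -mulrDr mulrCA.
Qed.

Lemma dq_box h v f M : `|h| <= 1 -> `|v.1| <= 1 -> `|v.2| <= 1 ->
  (forall x, ~ box M x -> f x = 0) ->
  forall x, ~ box (M + 1) x -> dq h v f x = 0.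
Proof.
move=> h1 v1 v2 f0 x xM; rewrite /dq (f0 x) ?(f0 (_, _)) ?subrr ?mulr0 //.
  move=> [/= H1 H2]; apply: xM; split.
    rewrite -[x.1](addrK (h * v.1)) (le_trans (ler_normB _ _)) // lerD //.
    by rewrite normrM mulr_ile1.
  rewrite -[x.2](addrK (h * v.2)) (le_trans (ler_normB _ _)) // lerD //.
  by rewrite normrM mulr_ile1.
move=> [H1 H2]; apply: xM; split.
  by rewrite (le_trans H1) // lerDl.
by rewrite (le_trans H2) // lerDl.
Qed.

Lemma dq_cvg (h_ : nat -> R) v (f : R * R -> R) x d :
  (forall n, h_ n != 0) -> h_ @ \oo --> 0 ->
  is_derive x v f d -> (fun n => dq (h_ n) v f x) @ \oo --> d.
Proof.
move=> hn0 h0 fd.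
have : (fun h => h^-1 *: ((f \o shift x) (h *: v) - f x)) @ 0^' --> d.
  by rewrite -(@derive_val _ _ _ _ _ _ _ fd); apply: ex_derive.
move=> H.
have H2 : h_ @ \oo --> 0^'.
  move=> A /= [e e0 eA].
  move/cvgrPdist_lt : h0 => /(_ e e0).
  apply: filterS => n Hn; apply: eA => //.
have := cvg_comp _ _ H2 H; apply: cvg_trans.
apply: near_eq_cvg; apply: nearW => n /=.
by rewrite /dq ![x.1 + _]addrC ![x.2 + _]addrC; case: (x).
Qed.

Lemma lipM_le L f (G : R * R -> R) M C : 0 <= M -> lip L f ->
  (forall x, `|G x| <= C) -> (forall x, ~ box M x -> G x = 0) ->
  forall x, `|f x * G x| <= (`|f (0, 0)| + L * (M + M)) * C.
Proof.
move=> M0 lf GC G0 x; case: (pselect (box M x)) => xM.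
  rewrite normrM ler_pM //; exact: lip_le_box.
have C0 : 0 <= C by apply: le_trans (GC x).
by rewrite G0 // mulr0 normr0 mulr_ge0 // addr_ge0 // mulr_ge0 ?addr_ge0 ?(lip_ge0 lf).
Qed.

Lemma integrable_lipM L f (G : plane -> R) M C : 0 <= M -> lip L f ->
  measurable_fun setT G ->
  (forall x, `|G x| <= C) -> (forall x, ~ box M x -> G x = 0) ->
  mu.-integrable setT (fun x => (f x * G x)%:E).
Proof.
move=> M0 lf mG GC G0.
apply: (@integrable_box _ M ((`|f (0, 0)| + L * (M + M)) * C)).
- by apply: measurable_funM => //; exact: lip_measurable lf.
- exact: lipM_le.
- by move=> x xM; rewrite G0 // mulr0.
Qed.

End IntegrationByParts.

Section IBP.
Context {R : realType}.
Local Notation plane := (measurableTypeR R * measurableTypeR R)%type.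
Local Notation mu := (@leb2 R).

Section EFinIntegrable.
Context d (T : measurableType d) (nu : {measure set T -> \bar R}) (D : set T).
Hypothesis mD : measurable D.
Implicit Types f g : T -> R.

Lemma integrableD_EFin f g : nu.-integrable D (EFin \o f) ->
  nu.-integrable D (EFin \o g) -> nu.-integrable D (fun x => (f x + g x)%:E).
Proof. by move=> fi gi; have := integrableD mD fi gi; apply: eq_integrable. Qed.

Lemma integrableB_EFin f g : nu.-integrable D (EFin \o f) ->
  nu.-integrable D (EFin \o g) -> nu.-integrable D (fun x => (f x - g x)%:E).
Proof. by move=> fi gi; have := integrableB mD fi gi; apply: eq_integrable. Qed.

Lemma integrableZ_EFin k f : nu.-integrable D (EFin \o f) ->
  nu.-integrable D (fun x => (k * f x)%:E).
Proof. by move=> fi; have := integrableZl mD k fi; apply: eq_integrable. Qed.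
End EFinIntegrable.

Lemma lip_pshift L f (a : R * R) : lip L f -> lip L (f \o pshift a).
Proof.
move=> lf x y; apply: le_trans (lf _ _) _; rewrite /pshift /=.
rewrite (_ : x.1 + a.1 - (y.1 + a.1) = x.1 - y.1); last by ring.
by rewrite (_ : x.2 + a.2 - (y.2 + a.2) = x.2 - y.2); last by ring.
Qed.

Lemma pshiftA a b (x : R * R) : pshift a (pshift b x) = pshift (a.1 + b.1, a.2 + b.2) x.
Proof. by rewrite /pshift /=; congr (_, _); ring. Qed.

Lemma pshift0 (x : R * R) : pshift (0, 0) x = x.
Proof. by case: x => x y; rewrite /pshift /= !addr0. Qed.

(** Translation invariance moves the shift from [g] to [f], and this turns [h] into [- h]. *)
Lemma dq_ibp h v L L' (f g : R * R -> R) M : lip L f -> lip L' g -> 0 <= M ->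
  (forall x, ~ box M x -> g x = 0) ->
  \int[mu]_x (f x * dq h v g x) = - \int[mu]_x (dq (- h) v f x * g x).
Proof.
move=> lf lg M0 g0.
have gC x : `|g x| <= `|g (0, 0)| + L' * (M + M).
  case: (pselect (box M x)) => xM; first exact: (lip_le_box lg).
  by rewrite g0 // normr0 addr_ge0 // mulr_ge0 ?addr_ge0 ?(lip_ge0 lg).
have mf := lip_measurable lf; have mg := lip_measurable lg.
pose w := (h * v.1, h * v.2); pose w' := (- h * v.1, - h * v.2).
have ww x : pshift w' (pshift w x) = x.
  rewrite pshiftA -[RHS]pshift0; congr (pshift (_, _) _); rewrite /w /w' /=; ring.
have i1 : mu.-integrable setT (fun x => (f x * g x)%:E).
  exact: (integrable_lipM M0 lf mg gC g0).
have i2 : mu.-integrable setT (fun x => ((f \o pshift w') x * g x)%:E).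
  exact: (integrable_lipM M0 (lip_pshift _ lf) mg gC g0).
have i3 : mu.-integrable setT (fun x => (f x * g (pshift w x))%:E).
  have := integrable_shift w i2; apply: eq_integrable => // x _ /=.
  by rewrite ww.
have e1 : \int[mu]_x (f x * dq h v g x) =
    h^-1 * (\int[mu]_x (f x * g (pshift w x)) - \int[mu]_x (f x * g x)).
  rewrite -RintegralB // -RintegralZl //; last exact: integrableB_EFin.
  by apply: eq_Rintegral => x _; rewrite dqE /w; ring.
have e2 : \int[mu]_x (dq (- h) v f x * g x) =
    - h^-1 * (\int[mu]_x ((f \o pshift w') x * g x) - \int[mu]_x (f x * g x)).
  rewrite -RintegralB // -RintegralZl //; last exact: integrableB_EFin.
  by apply: eq_Rintegral => x _; rewrite dqE /w' /= invrN; ring.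
rewrite e1 e2 mulNr opprK; congr (_ * (_ - _)).
rewrite -(Rintegral_shift w i2).
by apply: eq_Rintegral => x _ /=; rewrite ww.
Qed.

End IBP.

(** * Passage to the limit in difference quotients *)

Section IBPLimit.
Context {R : realType}.
Local Notation plane := (measurableTypeR R * measurableTypeR R)%type.
Local Notation mu := (@leb2 R).

Definition ae_derive (v : R * R) (f f' : R * R -> R) : Prop :=
  {ae mu, forall x : plane, is_derive (x : R * R) v f (f' x)}.

Let h_ (n : nat) : R := n.+1%:R^-1.

Let h_neq0 n : h_ n != 0. Proof. by rewrite invr_neq0. Qed.
Let h_le1 n : `|h_ n| <= 1.
Proof. by rewrite ger0_norm ?invr_ge0 // invf_le1 ?ltr0n // ler1n. Qed.
Let h_cvg0 : h_ @ \oo --> 0. Proof. exact: cvg_harmonic. Qed.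
Let hN_cvg0 : (fun n => - h_ n) @ \oo --> 0.
Proof. by rewrite -oppr0; apply: cvgN. Qed.

(** The difference quotients are bounded by the Lipschitz constants and [g] has bounded support, so
    convergence almost everywhere suffices to pass to the limit in [dq_ibp]. *)
Lemma ibp v L L' (f g f' g' : plane -> R) M :
  `|v.1| <= 1 -> `|v.2| <= 1 -> 0 <= M ->
  lip L f -> lip L' g -> (forall x, ~ box M x -> g x = 0) ->
  measurable_fun setT f' -> measurable_fun setT g' ->
  ae_derive v f f' -> ae_derive v g g' ->
  \int[mu]_x (f x * g' x) = - \int[mu]_x (f' x * g x).
Proof.
move=> v1 v2 M0 lf lg g0 mf' mg' fd gd.
have M1 : 0 <= M + 1 by rewrite addr_ge0.
have gC x : `|g x| <= `|g (0, 0)| + L' * (M + M).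
  case: (pselect (box M x)) => xM; first exact: (lip_le_box lg).
  by rewrite g0 // normr0 addr_ge0 // mulr_ge0 ?addr_ge0 ?(lip_ge0 lg).
have mf := lip_measurable lf; have mg := lip_measurable lg.
have A : (fun n => \int[mu]_x (f x * dq (h_ n) v g x)) @ \oo --> \int[mu]_x (f x * g' x).
  apply: (@cvg_Rintegral_box _ _ _ (M + 1)).
  - move=> n; apply: measurable_funM => //; exact: measurable_dq lg.
  - exact: measurable_funM.
  - move=> n x; apply: (lipM_le M1 lf (fun y => dq_le (h_ n) v y lg)).
    exact: dq_box.
  - by move=> n x xM; rewrite (dq_box _ _ _ g0) // mulr0.
  - apply: filterS gd => x gx; apply: cvgM; first exact: cvg_cst.
    exact: dq_cvg.
have B : (fun n => \int[mu]_x (dq (- h_ n) v f x * g x)) @ \oo --> \int[mu]_x (f' x * g x).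
  apply: (@cvg_Rintegral_box _ _ _ M (L * (`|v.1| + `|v.2|) * (`|g (0, 0)| + L' * (M + M)))).
  - move=> n; apply: measurable_funM => //; exact: measurable_dq lf.
  - exact: measurable_funM.
  - by move=> n x; rewrite normrM ler_pM //; exact: dq_le.
  - by move=> n x xM; rewrite g0 // mulr0.
  - apply: filterS fd => x fx; apply: cvgM; last exact: cvg_cst.
    by apply: dq_cvg => // n; rewrite oppr_eq0.
have := cvgN B; rewrite (_ : - _ = (fun n => \int[mu]_x (f x * dq (h_ n) v g x))).
  by move=> C; apply: (cvg_unique (@Rhausdorff R) A); exact: C.
by apply/funext => n; rewrite (dq_ibp _ _ lf lg M0).
Qed.

(** The constant degenerates as [h] tends to 0; it serves at fixed [h], to apply [dq_ibp] to a
    function that is itself a difference quotient. *)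
Lemma lip_dq h v L (f : R * R -> R) : lip L f -> lip (`|h^-1| * (L + L)) (dq h v f).
Proof.
move=> lf x y; rewrite dqE -mulrBr normrM -mulrA ler_wpM2l //.
rewrite (_ : _ - _ - _ = (f (pshift (h * v.1, h * v.2) x) - f (pshift (h * v.1, h * v.2) y)) - (f x - f y)); last by ring.
rewrite mulrDl (le_trans (ler_normB _ _)) // lerD //.
exact: (lip_pshift _ lf).
Qed.

Lemma dqC h v k w (f : R * R -> R) : dq h v (dq k w f) = dq k w (dq h v f).
Proof.
apply/funext => x; rewrite /dq /=.
by rewrite !(addrAC _ (k * _) (h * _)); ring.
Qed.

(** Two discrete integrations by parts, with the commutation [dqC] in between, exchange the
    directions and reverse the sign of [h]. *)
Lemma dq_curl h v w L L' (f g : R * R -> R) M : `|h| <= 1 ->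
  `|w.1| <= 1 -> `|w.2| <= 1 -> lip L f -> lip L' g -> 0 <= M ->
  (forall x, ~ box M x -> g x = 0) ->
  \int[mu]_x (dq h v f x * dq h w g x) = \int[mu]_x (dq (- h) w f x * dq (- h) v g x).
Proof.
move=> h1 w1 w2 lf lg M0 g0.
rewrite (dq_ibp _ _ (lip_dq h v lf) lg M0 g0) dqC.
by rewrite (dq_ibp _ _ (lip_dq (- h) w lf) lg M0 g0) opprK.
Qed.

(* Lipschitz functions have no second derivatives to integrate by parts with:
   the identity is proved for difference quotients, which commute, and passes
   to the limit by dominated convergence. *)
Lemma null_lagrangian v w L L' (f g f1 f2 g1 g2 : plane -> R) M :
  `|v.1| <= 1 -> `|v.2| <= 1 -> `|w.1| <= 1 -> `|w.2| <= 1 -> 0 <= M ->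
  lip L f -> lip L' g -> (forall x, ~ box M x -> g x = 0) ->
  measurable_fun setT f1 -> measurable_fun setT f2 ->
  measurable_fun setT g1 -> measurable_fun setT g2 ->
  ae_derive v f f1 -> ae_derive w f f2 -> ae_derive v g g1 -> ae_derive w g g2 ->
  \int[mu]_x (f1 x * g2 x) = \int[mu]_x (f2 x * g1 x).
Proof.
move=> v1 v2 w1 w2 M0 lf lg g0 mf1 mf2 mg1 mg2 df1 df2 dg1 dg2.
pose C (u z : R * R) := L * (`|u.1| + `|u.2|) * (L' * (`|z.1| + `|z.2|)) : R.
have bnd h u z x : `|dq h u f x * dq h z g x| <= C u z.
  by rewrite normrM ler_pM //; apply: dq_le.
have A : (fun n => \int[mu]_x (dq (h_ n) v f x * dq (h_ n) w g x)) @ \oo --> \int[mu]_x (f1 x * g2 x).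
  apply: (@cvg_Rintegral_box _ _ _ (M + 1) (C v w)).
  - by move=> n; apply: measurable_funM; apply: measurable_dq; eassumption.
  - exact: measurable_funM.
  - by move=> n x.
  - by move=> n x xM; rewrite [dq _ w g x](dq_box _ _ _ g0) // mulr0.
  - by apply: filterS2 df1 dg2 => x fx gx; apply: cvgM; exact: dq_cvg.
have B : (fun n => \int[mu]_x (dq (- h_ n) w f x * dq (- h_ n) v g x)) @ \oo --> \int[mu]_x (f2 x * g1 x).
  apply: (@cvg_Rintegral_box _ _ _ (M + 1) (C w v)).
  - by move=> n; apply: measurable_funM; apply: measurable_dq; eassumption.
  - exact: measurable_funM.
  - by move=> n x.
  - by move=> n x xM; rewrite [dq _ v g x](dq_box _ _ _ g0) ?normrN // mulr0.
  - apply: filterS2 df2 dg1 => x fx gx.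
    by apply: cvgM; apply: dq_cvg => // n; rewrite oppr_eq0.
apply: (cvg_unique (@Rhausdorff R) A); apply: cvg_trans B.
apply: near_eq_cvg; apply: nearW => n; apply/esym; exact: (dq_curl v (h_le1 n) w1 w2 lf lg M0 g0).
Qed.

End IBPLimit.

(** * Derivatives and test functions *)

Section Partial.
Context {R : realType}.

Lemma is_derive_fst (f : R * R -> R) (x : R * R) d :
  is_derive x.1 1 (fun t => f (t, x.2)) d <-> is_derive x (1, 0) f d.
Proof.
have E : (fun h : R => h^-1 *: ((f \o shift x) (h *: (1, 0)) - f x)) =
   (fun h : R => h^-1 *: (((fun t => f (t, x.2)) \o shift x.1) (h *: 1) - f (x.1, x.2))).
  apply/funext => h /=; congr (_ *: (f _ - f _)); last by case: x.
  by case: x => a b; rewrite /shift /=; congr (_, _); rewrite /= scaler0 add0r.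
split=> [[h1 h2]|[h1 h2]]; split.
- by rewrite /derivable E.
- by rewrite /derive E.
- by move: h1; rewrite /derivable E.
- by move: h2; rewrite /derive E.
Qed.

Lemma is_derive_snd (f : R * R -> R) (x : R * R) d :
  is_derive x.2 1 (fun t => f (x.1, t)) d <-> is_derive x (0, 1) f d.
Proof.
have E : (fun h : R => h^-1 *: ((f \o shift x) (h *: (0, 1)) - f x)) =
   (fun h : R => h^-1 *: (((fun t => f (x.1, t)) \o shift x.2) (h *: 1) - f (x.1, x.2))).
  apply/funext => h /=; congr (_ *: (f _ - f _)); last by case: x.
  by case: x => a b; rewrite /shift /=; congr (_, _); rewrite /= scaler0 add0r.
split=> [[h1 h2]|[h1 h2]]; split.
- by rewrite /derivable E.
- by rewrite /derive E.
- by move: h1; rewrite /derivable E.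
- by move: h2; rewrite /derive E.
Qed.

End Partial.

Section DeriveRules.
Context {R : realType}.
Implicit Types (f g : R -> R) (x a b : R).

Lemma is_derive_add f g x a b : is_derive x 1 f a -> is_derive x 1 g b ->
  is_derive x 1 (fun t => f t + g t) (a + b).
Proof. by move=> fa gb; exact: is_deriveD. Qed.

Lemma is_derive_sub f g x a b : is_derive x 1 f a -> is_derive x 1 g b ->
  is_derive x 1 (fun t => f t - g t) (a - b).
Proof. by move=> fa gb; exact: is_deriveB. Qed.

Lemma is_derive_opp f x a : is_derive x 1 f a -> is_derive x 1 (fun t => - f t) (- a).
Proof. by move=> fa; exact: is_deriveN. Qed.

Lemma is_derive_mul f g x a b : is_derive x 1 f a -> is_derive x 1 g b ->
  is_derive x 1 (fun t => f t * g t) (a * g x + f x * b).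
Proof.
move=> fa gb; apply: (is_derive_eq (is_deriveM fa gb)).
by rewrite addrC /GRing.scale /=; ring.
Qed.

Lemma is_derive_scale k f x a : is_derive x 1 f a -> is_derive x 1 (fun t => k * f t) (k * a).
Proof. by move=> fa; apply: (is_derive_eq (is_derive_mul (is_derive_cst k x 1) fa)); rewrite mul0r add0r. Qed.

Lemma is_derive_comp f g x a b : is_derive (g x) 1 f a -> is_derive x 1 g b ->
  is_derive x 1 (fun t => f (g t)) (a * b).
Proof. by move=> fa ga; exact: is_derive1_comp. Qed.

Lemma is_derive_inv g x b : g x != 0 -> is_derive x 1 g b ->
  is_derive x 1 (fun t => (g t)^-1) (- (g x) ^- 2 * b).
Proof. by move=> g0 gb; exact: is_deriveV. Qed.
End DeriveRules.

(** * Functions of the type exp(-c/t), flat at 0 *)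

Section FlatExp.
Context {R : realType}.
Implicit Types (p : {poly R}) (c t : R).

(** In the induction step one half of the exponent absorbs [p] and the other half the new factor
    [s]. *)
Lemma poly_expR_bounded p c : 0 < c -> exists2 B, 0 <= B &
  forall s, 0 <= s -> `|p.[s]| * expR (- (c * s)) <= B.
Proof.
elim/poly_ind : p c => [|p a IH] c c0.
  by exists 0 => // s _; rewrite horner0 normr0 mul0r.
have c20 : 0 < c / 2 by rewrite divr_gt0.
have [B B0 HB] := IH _ c20.
exists (B * (c / 2)^-1 + `|a|).
  by rewrite addr_ge0 // mulr_ge0 // invr_ge0 ltW.
move=> s s0; rewrite hornerMXaddC.
apply: le_trans (_ : (`|p.[s]| * s + `|a|) * expR (- (c * s)) <= _).
  rewrite ler_wpM2r ?expR_ge0 // (le_trans (ler_normD _ _)) // normrM (ger0_norm s0) //.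
rewrite mulrDl lerD //; last first.
  by rewrite ler_piMr // -expR0 ler_expR oppr_le0 mulr_ge0 // ltW.
rewrite (_ : - (c * s) = - (c / 2 * s) + - (c / 2 * s)); last by field.
rewrite expRD mulrACA ler_pM ?mulr_ge0 ?expR_ge0 //; first exact: HB.
rewrite expRN ler_pdivrMr ?expR_gt0 // ler_pdivlMl // .
by apply: le_trans (expR_ge1Dx _); rewrite lerDr.
Qed.

(** The polynomial in [1/t] makes the family stable under differentiation, with [flat_deriv] as the
    new polynomial. The rate [c] stays a parameter because [flat c 1] tends to the indicator of
    [t > 0] as [c] tends to 0. *)
Definition flat c p t : R :=
  if 0 < t then p.[t^-1] * expR (- (c * t^-1)) else 0.

Definition flat_deriv c p : {poly R} := 'X^2 * (c *: p - p^`()).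

Lemma is_derive_flat c p t : 0 < c ->
  is_derive t 1 (flat c p) (flat c (flat_deriv c p) t).
Proof.
move=> c0; have [t0|t0|t0] := ltgtP t 0.
- rewrite [flat c (flat_deriv _ _) t]/flat ltNge (ltW t0) /=.
  apply: (@near_eq_is_derive _ _ _ (cst 0)).
  near=> x; rewrite /flat ltNge (_ : x <= 0) //=; apply: ltW.
  near: x; exact: lt_nbhsl.
- rewrite [flat c (flat_deriv _ _) t]/flat t0.
  apply: (@near_eq_is_derive _ _ _ (fun t => p.[t^-1] * expR (- (c * t^-1)))).
  + near=> x; rewrite /flat (_ : 0 < x) //; near: x; exact: lt_nbhsr.
  + have tn0 : t != 0 by rewrite gt_eqF.
    have di : is_derive t 1 (fun t : R => t^-1) (- t ^- 2).
      by apply: (is_derive_eq (is_derive_inv tn0 (is_derive_id t 1))); rewrite mulr1.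
    have dp : is_derive t 1 (fun t => p.[t^-1]) (- t ^- 2 * p^`().[t^-1]).
      by apply: (is_derive_eq (is_derive_comp (is_derive_poly p _) di)); ring.
    have de : is_derive t 1 (fun t => expR (- (c * t^-1))) (expR (- (c * t^-1)) * - (c * (- t ^- 2))).
      exact: is_derive_comp (is_derive_expR _) (is_derive_opp (is_derive_scale c di)).
    apply: (is_derive_eq (is_derive_mul dp de)).
    rewrite /flat_deriv hornerM hornerXn hornerD hornerN hornerZ exprVn; ring.
- rewrite t0 [flat c (flat_deriv _ _) _]/flat ltxx.
  have [B B0 HB] := poly_expR_bounded ('X^2 * p) c0.
  have cv : (fun h => h^-1 *: ((flat c p \o shift 0) (h *: 1) - flat c p 0)) @ 0^' --> (0 : R).
    apply/cvgrPdist_le => e e0; near=> h.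
    have h0 : h != 0 by near: h; exact: nbhs_dnbhs_neq.
    have he : `|h| <= e / (B + 1).
      near: h; apply: cvg_within; apply/nbhs_ballP; exists (e / (B + 1)).
        by rewrite /= divr_gt0 // ltr_wpDl.
      by move=> x /=; rewrite /ball /= sub0r normrN => /ltW.
    rewrite sub0r normrN /= /flat ltxx subr0 addr0 [h *: 1]mulr1.
    case: ltP => [hp|_]; last by rewrite scaler0 normr0 ltW.
    rewrite [_ *: _]/(_ * _) !normrM normfV (ger0_norm (expR_ge0 _)).
    have hV : 0 <= h^-1 by rewrite invr_ge0 ltW.
    have := HB h^-1 hV; rewrite hornerM hornerXn normrM normrX normfV => H.
    (* The bound is taken for ['X^2 * p]: of the two extra powers of [1/h], one pays for the
       quotient and the other leaves a factor [|h|]. *)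
    rewrite (_ : _ * _ = `|h| * (`|h|^-1 ^+ 2 * `|p.[h^-1]| * expR (- (c * h^-1)))); last first.
      by field; rewrite normr_eq0.
    rewrite [leRHS](_ : e = e / (B + 1) * (B + 1)); last by field; rewrite gt_eqF // ltr_wpDl.
    by apply: ler_pM; rewrite ?mulr_ge0 ?exprn_ge0 ?expR_ge0 ?invr_ge0 // (le_trans H) // lerDl.
  by split; [exact: cvgP cv|exact: cvg_lim cv].
Unshelve. all: by end_near.
Qed.

Lemma flat_continuous c p : 0 < c -> continuous (flat c p).
Proof.
move=> c0 x; apply: differentiable_continuous; apply/derivable1_diffP.
by have [] := is_derive_flat p x c0.
Qed.

End FlatExp.

(** * Smooth bumps with compact support *)

Section SmoothClass.
Context {R : realType}.
Implicit Types (f g : R * R -> R) (a b c t : R).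

(** An inductive counterpart of [smooth]: it applies the innermost derivative first and fixes the
    order, so that stability under sums and products follows by induction on [n]. *)
Fixpoint Cn (n : nat) f : Prop :=
  continuous f /\ if n is m.+1 then
    [/\ forall x, derivable f x (1, 0), forall x, derivable f x (0, 1),
      Cn m (pderiv1 f) & Cn m (pderiv2 f)] else True.

Lemma CnS n f : Cn n.+1 f -> Cn n f.
Proof.
elim: n f => [|n IH] f; first by case.
by case=> cf [d1 d2 c1 c2]; split; [exact: cf|split; [exact: d1|exact: d2|exact: (IH _ c1)|exact: (IH _ c2)]].
Qed.

Lemma Cn_pderivs n s f : Cn (size s + n) f -> Cn n (pderivs s f).
Proof.
elim: s n f => [|i s IH] n f; first by [].
rewrite [size _]/= addSnnS => /IH [_ [_ _ c1 c2]]; case: i; [exact: c2|exact: c1].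
Qed.

Lemma Cn_smooth f : (forall n, Cn n f) -> smooth f.
Proof.
move=> cf s; have /Cn_pderivs [c0 [d1 d2 _ _]] := cf (size s + 1)%N.
by split; [exact: c0|exact: d1|exact: d2].
Qed.

Lemma CnD n f g : Cn n f -> Cn n g -> Cn n (fun x => f x + g x).
Proof.
elim: n f g => [|n IH] f g.
  by case=> cf _ [cg _]; split => // x; apply: cvgD; [exact: cf|exact: cg].
move=> [cf [f1 f2 cf1 cf2]] [cg [g1 g2 cg1 cg2]]; split.
  by move=> x; apply: cvgD; [exact: cf|exact: cg].
split=> [x|x||]; [exact: (derivableD (f1 x) (g1 x))|exact: (derivableD (f2 x) (g2 x))| |].
- rewrite (_ : pderiv1 _ = (fun x => pderiv1 f x + pderiv1 g x)); first exact: (IH _ _ cf1 cg1).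
  by apply/funext => x; rewrite /pderiv1 -[fun x => _]/(f + g) deriveD; [by []|exact: f1|exact: g1].
- rewrite (_ : pderiv2 _ = (fun x => pderiv2 f x + pderiv2 g x)); first exact: (IH _ _ cf2 cg2).
  by apply/funext => x; rewrite /pderiv2 -[fun x => _]/(f + g) deriveD; [by []|exact: f2|exact: g2].
Qed.

Lemma CnM n f g : Cn n f -> Cn n g -> Cn n (fun x => f x * g x).
Proof.
elim: n f g => [|n IH] f g.
  by case=> cf _ [cg _]; split => // x; apply: cvgM; [exact: cf|exact: cg].
move=> /[dup] /CnS Cf [cf [f1 f2 cf1 cf2]] /[dup] /CnS Cg [cg [g1 g2 cg1 cg2]]; split.
  by move=> x; apply: cvgM; [exact: cf|exact: cg].
split=> [x|x||]; [exact: (derivableM (f1 x) (g1 x))|exact: (derivableM (f2 x) (g2 x))| |].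
- rewrite (_ : pderiv1 _ = (fun x => f x * pderiv1 g x + g x * pderiv1 f x)).
    apply: CnD; [exact: (IH _ _ Cf cg1)|exact: (IH _ _ Cg cf1)].
  by apply/funext => x; rewrite /pderiv1 -[fun x => _]/(f * g) deriveM; [by []|exact: f1|exact: g1].
- rewrite (_ : pderiv2 _ = (fun x => f x * pderiv2 g x + g x * pderiv2 f x)).
    apply: CnD; [exact: (IH _ _ Cf cg2)|exact: (IH _ _ Cg cf2)].
  by apply/funext => x; rewrite /pderiv2 -[fun x => _]/(f * g) deriveM; [by []|exact: f2|exact: g2].
Qed.

Let is_derive_affine c p a b (t : R) : 0 < c ->
  is_derive t 1 (fun t => flat c p (a * t + b)) (a * flat c (flat_deriv c p) (a * t + b)).
Proof.
move=> c0.
have d : is_derive t 1 (fun t => a * t + b) (a * 1 + 0).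
  exact: is_derive_add (is_derive_scale a (is_derive_id t 1)) (is_derive_cst b t 1).
have := is_derive_comp (g := fun t => a * t + b) (is_derive_flat p (a * t + b) c0) d.
by move=> H; apply: (is_derive_eq H); rewrite mulr1 addr0 mulrC.
Qed.

Lemma Cn_flat1 n k c p a b : 0 < c -> Cn n (fun x : R * R => k * flat c p (a * x.1 + b)).
Proof.
move=> c0; have cont q l : continuous (fun x : R * R => l * flat c q (a * x.1 + b)).
  move=> x; apply: cvgM; first exact: cvg_cst.
  apply: (@continuous_comp _ _ _ (fun x : R * R => a * x.1 + b) (flat c q)); last exact: flat_continuous.
  by apply: cvgD; [apply: cvgM; [exact: cvg_cst|exact: cvg_fst]|exact: cvg_cst].
elim: n k p => [|n IH] k p; first by split; [exact: cont|].
have D1 (x : R * R) : is_derive x (1, 0) (fun x : R * R => k * flat c p (a * x.1 + b))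
    (k * a * flat c (flat_deriv c p) (a * x.1 + b)).
  by apply/is_derive_fst; rewrite /= -mulrA; apply: is_derive_scale; exact: is_derive_affine.
have D2 (x : R * R) : is_derive x (0, 1) (fun x : R * R => k * flat c p (a * x.1 + b)) 0.
  apply/is_derive_snd => /=; exact: (is_derive_cst (k * flat c p (a * x.1 + b)) x.2 1).
split; first exact: cont.
split.
- by move=> x; have [] := D1 x.
- by move=> x; have [] := D2 x.
- rewrite (_ : pderiv1 _ = (fun x : R * R => k * a * flat c (flat_deriv c p) (a * x.1 + b))); first exact: IH.
  by apply/funext => x; have [_] := D1 x.
- rewrite (_ : pderiv2 _ = (fun x : R * R => 0 * flat c p (a * x.1 + b))); first exact: IH.
  by apply/funext => x; rewrite mul0r; have [_] := D2 x.
Qed.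

Lemma Cn_flat2 n k c p a b : 0 < c -> Cn n (fun x : R * R => k * flat c p (a * x.2 + b)).
Proof.
move=> c0; have cont q l : continuous (fun x : R * R => l * flat c q (a * x.2 + b)).
  move=> x; apply: cvgM; first exact: cvg_cst.
  apply: (@continuous_comp _ _ _ (fun x : R * R => a * x.2 + b) (flat c q)); last exact: flat_continuous.
  by apply: cvgD; [apply: cvgM; [exact: cvg_cst|exact: cvg_snd]|exact: cvg_cst].
elim: n k p => [|n IH] k p; first by split; [exact: cont|].
have D1 (x : R * R) : is_derive x (0, 1) (fun x : R * R => k * flat c p (a * x.2 + b))
    (k * a * flat c (flat_deriv c p) (a * x.2 + b)).
  by apply/is_derive_snd; rewrite /= -mulrA; apply: is_derive_scale; exact: is_derive_affine.
have D2 (x : R * R) : is_derive x (1, 0) (fun x : R * R => k * flat c p (a * x.2 + b)) 0.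
  apply/is_derive_fst => /=; exact: (is_derive_cst (k * flat c p (a * x.2 + b)) x.1 1).
split; first exact: cont.
split.
- by move=> x; have [] := D2 x.
- by move=> x; have [] := D1 x.
- rewrite (_ : pderiv1 _ = (fun x : R * R => 0 * flat c p (a * x.2 + b))); first exact: IH.
  by apply/funext => x; rewrite mul0r; have [_] := D2 x.
- rewrite (_ : pderiv2 _ = (fun x : R * R => k * a * flat c (flat_deriv c p) (a * x.2 + b))); first exact: IH.
  by apply/funext => x; have [_] := D1 x.
Qed.

Definition bump1 (c a b t : R) : R := flat c 1 (t - a) * flat c 1 (b - t).

Definition bump2 (c a b a' b' : R) (x : R * R) : R :=
  bump1 c a b x.1 * bump1 c a' b' x.2.

Lemma smooth_bump2 c a b a' b' : 0 < c -> smooth (bump2 c a b a' b').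
Proof.
move=> c0; apply: Cn_smooth => n; rewrite /bump2 /bump1.
rewrite (_ : (fun x => _) = fun x : R * R =>
  ((1 * flat c 1 (1 * x.1 + - a)) * (1 * flat c 1 (- 1 * x.1 + b))) *
  ((1 * flat c 1 (1 * x.2 + - a')) * (1 * flat c 1 (- 1 * x.2 + b')))).
  by apply: CnM; apply: CnM; first [exact: Cn_flat1|exact: Cn_flat2].
by apply/funext => x; rewrite !mul1r !mulN1r ![_ + b]addrC ![_ + b']addrC.
Qed.

Lemma flat1_ge0 c t : 0 <= flat c 1 t.
Proof. by rewrite /flat; case: ifP => // _; rewrite hornerC mul1r expR_ge0. Qed.

Lemma flat1_le1 c t : 0 < c -> flat c 1 t <= 1.
Proof.
move=> c0; rewrite /flat; case: ifP => // t0; rewrite hornerC mul1r -expR0 ler_expR.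
by rewrite oppr_le0 mulr_ge0 // ltW // invr_gt0.
Qed.

Lemma flat1_neq0 c t : flat c 1 t != 0 -> 0 < t.
Proof. by rewrite /flat; case: ifP => //; rewrite eqxx. Qed.

Lemma bump1_ge0 c a b t : 0 <= bump1 c a b t.
Proof. by rewrite mulr_ge0 ?flat1_ge0. Qed.

Lemma bump1_le1 c a b t : 0 < c -> bump1 c a b t <= 1.
Proof. by move=> c0; rewrite mulr_ile1 ?flat1_ge0 ?flat1_le1. Qed.

Lemma bump1_neq0 c a b t : bump1 c a b t != 0 -> a < t < b.
Proof.
by rewrite /bump1 mulf_eq0 negb_or => /andP[/flat1_neq0 + /flat1_neq0]; rewrite !subr_gt0 => -> ->.
Qed.

Lemma test_fun_bump2 c a b a' b' : 0 < c ->
  `[a, b]%classic `*` `[a', b']%classic `<=` @B1 R -> test_fun (bump2 c a b a' b').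
Proof.
move=> c0 B.
have cl : closure [set x | bump2 c a b a' b' x != 0] `<=` `[a, b]%classic `*` `[a', b']%classic.
  have clB : closed (`[a, b]%classic `*` `[a', b']%classic : set (R * R)).
    rewrite (_ : _ `*` _ = fst @^-1` `[a, b]%classic `&` snd @^-1` `[a', b']%classic) //.
    by apply: closedI; apply: closed_comp => [x _|]; try exact: interval_closed; [exact: cvg_fst|exact: cvg_snd].
  rewrite [X in _ `<=` X]((closure_id _).1 clB).
  apply: closure_subset => x /=; rewrite /bump2 mulf_eq0 negb_or => /andP[] /bump1_neq0 + /bump1_neq0.
  by rewrite !in_itv /= => /andP[/ltW -> /ltW ->] /andP[/ltW -> /ltW ->].
split; first exact: smooth_bump2.
  apply: (subclosed_compact _ _ cl); first exact: closed_closure.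
  by apply: compact_setX; exact: segment_compact.
exact: subset_trans cl B.
Qed.

Lemma flat1_cvg t : (fun n => flat (n.+1%:R^-1) 1 t) @ \oo --> ((0 < t)%R%:R : R).
Proof.
rewrite /flat; case: ltP => t0 /=; last exact: cvg_cst.
rewrite -[X in _ --> X](expR0) -oppr0 -(mul0r t^-1) /=.
under eq_cvg do rewrite hornerC mul1r.
apply: continuous_cvg; first exact: continuous_expR.
apply: cvgN; apply: cvgMl; exact: cvg_harmonic.
Qed.

End SmoothClass.

(** * Weak gradients *)

Section Uniqueness.
Context {R : realType}.
Local Notation plane := (measurableTypeR R * measurableTypeR R)%type.
Local Notation mu := (@leb2 R).
Local Notation B1 := (@B1 R).

Lemma open_B1 : open B1.
Proof.
rewrite (_ : B1 = (fun x : R * R => x.1 ^+ 2 + x.2 ^+ 2) @^-1` [set t | t < 1]) //.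
apply: (@open_comp _ _ (fun x : R * R => x.1 ^+ 2 + x.2 ^+ 2)); last exact: open_lt.
move=> x _; apply: cvgD; rewrite /=; under eq_cvg do rewrite expr2; rewrite expr2.
  by apply: cvgM; exact: cvg_fst.
by apply: cvgM; exact: cvg_snd.
Qed.

Lemma measurable_B1 : measurable (B1 : set plane).
Proof. exact: open_measurable_plane open_B1. Qed.

Lemma B1_box x : B1 x -> box 1 x.
Proof.
rewrite /B1 /box /= => H; split; rewrite -[leRHS]normr1 -ler_sqr ?nnegrE // !real_normK ?num_real // expr1n.
  by apply: ltW; apply: le_lt_trans H; rewrite lerDl sqr_ge0.
by apply: ltW; apply: le_lt_trans H; rewrite lerDr sqr_ge0.
Qed.

Lemma leb2_B1_lty : (mu B1 < +oo)%E.
Proof.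
apply: le_lt_trans (leb2_box_lty 1); apply: le_measure; rewrite ?inE.
- exact: measurable_B1.
- exact: measurable_box.
- exact: B1_box.
Qed.

(** The sets over which the integral vanishes form a Dynkin class. The map [h] lets the argument run
    first on each coordinate projection and then, with [id], on products. *)
Lemma dynkin_integral0 d (T : measurableType d) (h : plane -> T) (C : set plane)
    (G : set (set T)) (f : plane -> \bar R) :
  measurable_fun setT h -> measurable C -> mu.-integrable C f ->
  @measurable _ T = <<s G >> -> setI_closed G ->
  (\int[mu]_(x in C) f x = 0)%E ->
  (forall A, G A -> \int[mu]_(x in h @^-1` A `&` C) f x = 0)%E ->
  forall A, measurable A -> (\int[mu]_(x in h @^-1` A `&` C) f x = 0)%E.
Proof.
move=> mh mC fi GE GI fC0 fG A; rewrite GE.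
have mhA S : measurable S -> measurable (h @^-1` S).
  by move=> mS; rewrite -[X in measurable X]setTI; exact: mh.
apply: (@dynkin_induction _ T G (fun A => (\int[mu]_(x in h @^-1` A `&` C) f x = 0)%E)) => //.
- by rewrite preimage_setT setTI.
- move=> S mS S0.
  have mS' : measurable (h @^-1` S `&` C) by apply: measurableI => //; exact: mhA.
  have mSC' : measurable (h @^-1` (~` S) `&` C).
    by apply: measurableI => //; apply: mhA; exact: measurableC.
  have E : (h @^-1` S `&` C) `|` (h @^-1` (~` S) `&` C) = C.
    by rewrite -setIUl preimage_setC setUCr setTI.
  have := fC0; rewrite -{1}E integral_setU //.
  + by move=> H; rewrite -H S0 add0e.
  + by rewrite E; exact: measurable_int fi.
  + by rewrite disj_set2E preimage_setC; apply/eqP; rewrite setIACA setICr set0I.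
- move=> F mF tF F0.
  rewrite preimage_bigcup setI_bigcupl integral_bigcup.
  + by rewrite eseries0.
  + apply/trivIsetP => i j _ _ ij; rewrite setIACA -preimage_setI.
    by move/trivIsetP : tF => /(_ _ _ I I ij) ->; rewrite preimage_set0 set0I.
  + by move=> k; apply: measurableI => //; exact: mhA.
  + apply: integrableS fi => //.
      by apply: bigcupT_measurable => k; apply: measurableI => //; exact: mhA.
    by move=> x [k _ []].
Qed.

Let itvs : set (set R) := [set A | exists x y, A = `]x, y[%classic].

Lemma itvI_oo (a b c d : R) :
  `]a, b[%classic `&` `]c, d[%classic = `]Num.max a c, Num.min b d[%classic.
Proof.
apply/seteqP; split => x /=; rewrite !in_itv /= gt_max lt_min.
  by move=> [/andP[-> ->] /andP[-> ->]].
by move=> /andP[/andP[-> ->] /andP[-> ->]].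
Qed.

Lemma setI_closed_itvs : setI_closed itvs.
Proof.
move=> _ _ [a [b ->]] [c [d ->]]; exists (Num.max a c), (Num.min b d); exact: itvI_oo.
Qed.

(** The bumps on the rectangle are test functions bounded by 1, and they converge to its indicator
    as their rate [1/(n+1)] tends to 0. *)
Lemma integral_oobox0 (f : plane -> R) a b a' b' :
  mu.-integrable B1 (EFin \o f) ->
  (forall phi, test_fun phi -> \int[mu]_(x in B1) (f x * phi x) = 0) ->
  `[a, b]%classic `*` `[a', b']%classic `<=` B1 ->
  (\int[mu]_(x in `]a, b[%classic `*` `]a', b'[%classic) (f x)%:E = 0)%E.
Proof.
move=> fi ft sB.
set O := _ `*` _.
have mO : measurable (O : set plane) by apply: measurableX; exact: measurable_itv.
have OB : O `<=` B1.
  move=> x [/= + +]; rewrite /= !in_itv /= => /andP[/ltW ? /ltW ?] /andP[/ltW ? /ltW ?].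
  by apply: sB; split; rewrite /= in_itv /=; apply/andP.
have mf : measurable_fun B1 f by apply/measurable_EFinP; exact: measurable_int fi.
have h0 n : 0 < n.+1%:R^-1 :> R by rewrite invr_gt0.
have mbump n : measurable_fun setT (bump2 (n.+1%:R^-1) a b a' b' : plane -> R).
  apply: continuous_measurable_plane.
  by have [+ _ _] := smooth_bump2 a b a' b' (h0 n) [::].
have bump01 n x : 0 <= bump2 (n.+1%:R^-1) a b a' b' x <= 1.
  rewrite /bump2; apply/andP; split; first by rewrite mulr_ge0 ?bump1_ge0.
  by apply: mulr_ile1; rewrite ?bump1_ge0 ?bump1_le1.
have bcvg (x : R * R) : (fun n => bump2 (n.+1%:R^-1) a b a' b' x) @ \oo --> (\1_O x : R).
  have b1cvg (p q t : R) : (fun n => bump1 (n.+1%:R^-1) p q t) @ \oo --> ((p < t < q)%R%:R : R).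
    rewrite (_ : (p < t < q)%R%:R = ((0 < t - p)%R%:R : R) * (0 < q - t)%R%:R).
      by apply: cvgM; exact: flat1_cvg.
    by rewrite !subr_gt0 -natrM mulnb.
  rewrite indicE (_ : (x \in O) = (a < x.1 < b) && (a' < x.2 < b')).
    by rewrite -mulnb natrM; apply: cvgM; exact: b1cvg.
  apply/idP/idP; rewrite inE /O /= !in_itv /=; first by move=> [-> ->].
  by move/andP.
have [] := @dominated_convergence _ plane R mu B1 measurable_B1
  (fun n x => (f x * bump2 (n.+1%:R^-1) a b a' b' x)%:E)
  (fun x => (f x * \1_O x)%:E) (fun x => `|(f x)%:E|%E).
- move=> n; apply/measurable_EFinP; apply: measurable_funM => //; exact: measurable_funTS.
- apply/measurable_EFinP; apply: measurable_funM => //; apply: measurable_funTS.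
- apply: nearW => x _; apply: cvg_EFin; first exact: nearW.
  by apply: cvgM; [exact: cvg_cst|exact: bcvg].
- exact: integrable_abse.
- apply: nearW => x n _; rewrite /= lee_fin normrM ler_piMr //.
  by have /andP[b0 b1] := bump01 n x; rewrite ger0_norm.
move=> _ _ /=.
have -> : (fun n => \int[mu]_(x in B1) (f x * bump2 (n.+1%:R^-1) a b a' b' x)%:E)%E = cst 0%E.
  apply/funext => n.
  have := ft _ (test_fun_bump2 (h0 n) sB); rewrite /Rintegral => H.
  rewrite -[LHS]fineK ?H //.
  apply: integrable_fin_num; first exact: measurable_B1.
  apply: le_integrable fi => //; first exact: measurable_B1.
    by apply/measurable_EFinP; apply: measurable_funM => //; exact: measurable_funTS.
  move=> x _; rewrite /= lee_fin normrM ler_piMr //.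
  by have /andP[b0 b1] := bump01 n x; rewrite ger0_norm.
move=> H; have {H} := cvg_unique (@ereal_hausdorff R) H (@cvg_cst _ _ _ _ _) => E0.
rewrite -(setIidr OB) integral_mkcondr -[RHS]E0; apply: eq_integral => x _.
by rewrite patchE indicE; case: (_ \in _); rewrite ?mulr1 ?mulr0.
Qed.

(** Open subrectangles are replaced by Borel sets in the first coordinate ([step1]), then in the
    second ([step2]), then by arbitrary measurable sets ([step3]); an integrable function whose
    integrals all vanish is null. *)
Lemma ae_eq0_oobox (f : plane -> R) a b a' b' :
  mu.-integrable B1 (EFin \o f) ->
  (forall phi, test_fun phi -> \int[mu]_(x in B1) (f x * phi x) = 0) ->
  `[a, b]%classic `*` `[a', b']%classic `<=` B1 ->
  {ae mu, forall x, (`]a, b[%classic `*` `]a', b'[%classic) x -> f x = 0}.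
Proof.
move=> fi ft sB.
pose O p q p' q' : set plane := `]p, q[%classic `*` `]p', q'[%classic.
have mO p q p' q' : measurable (O p q p' q').
  by apply: measurableX; exact: measurable_itv.
have OB : O a b a' b' `<=` B1.
  move=> x [/= + +]; rewrite /= !in_itv /= => /andP[/ltW ? /ltW ?] /andP[/ltW ? /ltW ?].
  by apply: sB; split; rewrite /= in_itv /=; apply/andP.
have fO : mu.-integrable (O a b a' b') (EFin \o f).
  by apply: integrableS fi => //; exact: measurable_B1.
have sub0 p q p' q' :
    (\int[mu]_(x in O (Num.max p a) (Num.min q b) (Num.max p' a') (Num.min q' b')) (f x)%:E = 0)%E.
  apply: integral_oobox0 fi ft _; apply: subset_trans sB => x [/= + +].
  rewrite /= !in_itv /= !ge_max !le_min => /andP[/andP[_ ?] /andP[_ ?]] /andP[/andP[_ ?] /andP[_ ?]].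
  by split; rewrite /= ?in_itv /=; apply/andP.
have subE p q p' q' : fst @^-1` `]p, q[%classic `&` (snd @^-1` `]p', q'[%classic `&` O a b a' b')
    = O (Num.max p a) (Num.min q b) (Num.max p' a') (Num.min q' b').
  rewrite /O -!itvI_oo; apply/seteqP; split => x /=; rewrite /setX /=; tauto.
have C0 p' q' : (\int[mu]_(x in snd @^-1` `]p', q'[%classic `&` O a b a' b') (f x)%:E = 0)%E.
  rewrite -[RHS](sub0 a b p' q') -subE; congr (\int[mu]_(x in _) _)%E.
  by apply/seteqP; split => x /=; rewrite /O /setX /=; tauto.
have O0 : (\int[mu]_(x in O a b a' b') (f x)%:E = 0)%E.
  exact: integral_oobox0 fi ft sB.
have mitv := RGenOpens.measurableE R.
have msnd (B : set (measurableTypeR R)) : measurable B -> measurable (snd @^-1` B : set plane).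
  by move=> mB; rewrite -[X in measurable X]setTI; exact: measurable_snd.
have mfst (B : set (measurableTypeR R)) : measurable B -> measurable (fst @^-1` B : set plane).
  by move=> mB; rewrite -[X in measurable X]setTI; exact: measurable_fst.
have step1 (A : set (measurableTypeR R)) p' q' : measurable A ->
    (\int[mu]_(x in fst @^-1` A `&` (snd @^-1` `]p', q'[%classic `&` O a b a' b')) (f x)%:E = 0)%E.
  apply: (@dynkin_integral0 _ (measurableTypeR R) fst _ itvs).
  - exact: measurable_fst.
  - by apply: measurableI => //; apply: msnd; exact: measurable_itv.
  - by apply: integrableS fO => //; apply: measurableI => //; apply: msnd; exact: measurable_itv.
  - exact: mitv.
  - exact: setI_closed_itvs.
  - exact: C0.
  - by move=> _ [p [q ->]]; rewrite subE; exact: sub0.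
have step2 (A B : set (measurableTypeR R)) : measurable A -> measurable B ->
    (\int[mu]_(x in snd @^-1` B `&` (fst @^-1` A `&` O a b a' b')) (f x)%:E = 0)%E.
  move=> mA; apply: (@dynkin_integral0 _ (measurableTypeR R) snd _ itvs).
  - exact: measurable_snd.
  - by apply: measurableI => //; exact: mfst.
  - by apply: integrableS fO => //; apply: measurableI => //; exact: mfst.
  - exact: mitv.
  - exact: setI_closed_itvs.
  - rewrite -[RHS](step1 A a' b' mA); congr (\int[mu]_(x in _) _)%E.
    by apply/seteqP; split => x /=; rewrite /O /setX /=; tauto.
  - by move=> _ [p [q ->]]; rewrite setICA; exact: step1.
have step3 (E : set plane) : measurable E -> (\int[mu]_(x in E `&` O a b a' b') (f x)%:E = 0)%E.
  apply: (@dynkin_integral0 _ plane id _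
    [set A `*` B | A in @measurable _ (measurableTypeR R) & B in @measurable _ (measurableTypeR R)]) => //.
  - exact: measurable_prod_measurableType.
  - move=> _ _ [X1 mX1 [X2 mX2 <-]] [Y1 mY1 [Y2 mY2 <-]]; rewrite -setXI.
    by exists (X1 `&` Y1); [exact: measurableI|exists (X2 `&` Y2) => //; exact: measurableI].
  - move=> _ [A mA [B mB <-]]; rewrite -[RHS](step2 A B mA mB); congr (\int[mu]_(x in _) _)%E.
    by apply/seteqP; split => x /=; rewrite /O /setX /=; tauto.
have := @integral_ae_eq _ plane R mu _ (mO a b a' b') (cst 0%E) (EFin \o f) fO.
case.
- exact: measurable_cst.
- move=> E EO mE; rewrite integral0 -[RHS](step3 _ mE); congr (\int[mu]_(x in _) _)%E.
  by rewrite setIidl.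
- move=> N HN; exists N; case: HN => ? ? H; split => //; apply: subset_trans H => x /= H1 H2.
  by apply: H1 => /H2 [].
Qed.

(** The rational rectangles whose closure lies in the disc are countable in number, and their
    interiors cover it. *)
Lemma ae_eq0_weak (f : plane -> R) :
  mu.-integrable B1 (EFin \o f) ->
  (forall phi, test_fun phi -> \int[mu]_(x in B1) (f x * phi x) = 0) ->
  {ae mu, forall x, B1 x -> f x = 0}.
Proof.
move=> fi ft.
pose S (i : (rat * rat) * (rat * rat)) : set plane :=
  `](ratr i.1.1 : R), (ratr i.1.2 : R)[%classic `*` `](ratr i.2.1 : R), (ratr i.2.2 : R)[%classic.
pose K (i : (rat * rat) * (rat * rat)) : set plane :=
  `[(ratr i.1.1 : R), (ratr i.1.2 : R)]%classic `*` `[(ratr i.2.1 : R), (ratr i.2.2 : R)]%classic.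
have H n : {ae mu, forall x, if unpickle n is Some i then K i `<=` B1 -> S i x -> f x = 0 else True}.
  case: (unpickle n) => [i|]; last exact: aeW.
  case: (pselect (K i `<=` B1)) => [KB|KB]; last by apply: aeW.
  apply: (@filterS _ _ (ae_filter_ringOfSetsType mu) _ _ _ (ae_eq0_oobox fi ft KB)) => x Hx _.
  exact: Hx.
have H' : {ae mu, forall x n, if unpickle n is Some i then K i `<=` B1 -> S i x -> f x = 0 else True}.
  exact: ae_foralln.
apply: filterS H' => x Hx Bx.
have : nbhs x B1 by apply: open_nbhs_nbhs; split => //; exact: open_B1.
move=> /nbhs_ballP [e /= e0 xeB].
have D (t : R) : exists p q : rat, [/\ t - e < ratr p, ratr p < t, t < ratr q & ratr q < t + e].
  have [p] : exists p : rat, t - e < ratr p < t.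
    have /rat_in_itvoo[p] : t - e < t by rewrite ltrBlDr ltrDl.
    by rewrite inE /= => ?; exists p.
  have [q] : exists q : rat, t < ratr q < t + e.
    have /rat_in_itvoo[p'] : t < t + e by rewrite ltrDl.
    by rewrite inE /= => ?; exists p'.
  by move=> /andP[? ?] /andP[? ?]; exists p, q.
have [p [q [pq1 pq2 pq3 pq4]]] := D x.1.
have [p' [q' [pq1' pq2' pq3' pq4']]] := D x.2.
have := Hx (pickle ((p, q), (p', q'))); rewrite pickleK; apply.
  move=> y [/= + +]; rewrite /= !in_itv /= => /andP[? ?] /andP[? ?]; apply: xeB; split => /=.
    by rewrite /ball /= distrC ltr_norml; apply/andP; split; lra.
  by rewrite /ball /= distrC ltr_norml; apply/andP; split; lra.
by split; rewrite /= ?in_itv /=; apply/andP.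
Qed.

End Uniqueness.

Lemma MVT_bound (R : realType) (f df : R -> R) (a b C : R) : a <= b ->
  (forall t, a <= t <= b -> is_derive t 1 f (df t)) ->
  (forall t, a <= t <= b -> `|df t| <= C) -> `|f b - f a| <= C * (b - a).
Proof.
move=> ab fd dC.
have [c cab ->] : exists2 c, c \in `[a, b] & f b - f a = df c * (b - a).
  apply: MVT_segment => // [x xab|].
    by apply: fd; move: xab; rewrite in_itv /= => /andP[/ltW -> /ltW ->].
  apply: derivable_within_continuous => x xab.
  by have [] := fd x _; first by move: xab; rewrite in_itv.
rewrite normrM [X in _ * X]ger0_norm ?subr_ge0 // ler_wpM2r ?subr_ge0 //.
by apply: dC; move: cab; rewrite in_itv.
Qed.

(** * Lipschitz functions and test functions in H^1 *)

Section Sobolev.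
Context {R : realType}.
Local Notation plane := (measurableTypeR R * measurableTypeR R)%type.
Local Notation mu := (@leb2 R).
Local Notation B1 := (@B1 R).
Implicit Types (f g u v phi : R * R -> R).

Lemma L2M f g : L2B1 f -> L2B1 g -> mu.-integrable B1 (fun x => (f x * g x)%:E).
Proof.
move=> [mf f2] [mg g2].
apply: (le_integrable measurable_B1 _ _ (integrableD_EFin measurable_B1 f2 g2)).
  by apply/measurable_EFinP; exact: measurable_funM.
move=> x _; rewrite /= lee_fin normrM [leRHS]ger0_norm ?addr_ge0 ?sqr_ge0 //.
rewrite -[f x ^+ 2]real_normK ?num_real // -[g x ^+ 2]real_normK ?num_real //.
have := sqr_ge0 (`|f x| - `|g x|); have := normr_ge0 (f x); have := normr_ge0 (g x).
move: `|f x| `|g x| => a b a0 b0 ab. nra.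
Qed.

Lemma L2D f g : L2B1 f -> L2B1 g -> L2B1 (fun x => f x + g x).
Proof.
move=> Lf Lg; have fg := L2M Lf Lg; move: Lf Lg => [mf f2] [mg g2]; split.
  exact: measurable_funD.
have := integrableD_EFin measurable_B1 (integrableD_EFin measurable_B1 f2 g2)
  (integrableZ_EFin measurable_B1 2 fg).
by apply: eq_integrable; [exact: measurable_B1|move=> x _ /=; congr _%:E; ring].
Qed.

Lemma L2Z k f : L2B1 f -> L2B1 (fun x => k * f x).
Proof.
move=> [mf f2]; split; first exact: measurable_funM.
have := integrableZ_EFin measurable_B1 (k ^+ 2) f2.
by apply: eq_integrable; [exact: measurable_B1|move=> x _ /=; congr _%:E; ring].
Qed.

Lemma L2B f g : L2B1 f -> L2B1 g -> L2B1 (fun x => f x - g x).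
Proof.
move=> Lf Lg; have := L2D Lf (L2Z (-1) Lg).
by under eq_fun do rewrite mulN1r.
Qed.

Lemma integrable_B1_bounded (f : plane -> R) C : measurable_fun B1 f ->
  (forall x, B1 x -> `|f x| <= C) -> mu.-integrable B1 (EFin \o f).
Proof.
move=> mf fC; apply: measurable_bounded_integrable => //.
- exact: measurable_B1.
- exact: leb2_B1_lty.
- exists C; split; first exact: num_real.
  by move=> D CD x Bx; apply: le_trans (fC x Bx) (ltW CD).
Qed.

Lemma L2_bounded f C : measurable_fun (B1 : set plane) (f : plane -> R) ->
  (forall x, B1 x -> `|f x| <= C) -> L2B1 f.
Proof.
move=> mf fC; split => //; apply: (@integrable_B1_bounded _ (C ^+ 2)).
  by apply: measurable_funX.
by move=> x Bx; rewrite normrX lerXn2r ?nnegrE ?fC // (le_trans _ (fC x Bx)).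
Qed.

Lemma L2_integrable f : L2B1 f -> mu.-integrable B1 (EFin \o f).
Proof.
move=> Lf; have L1 : L2B1 (fun _ : R * R => 1 : R).
  by apply: (@L2_bounded _ 1) => [|x _]; [exact: measurable_cst|rewrite normr1].
have := L2M Lf L1; apply: eq_integrable; first exact: measurable_B1.
by move=> x _ /=; rewrite mulr1.
Qed.

Lemma box_compact (M : R) : compact (box M).
Proof.
rewrite (_ : box M = `[- M, M]%classic `*` `[- M, M]%classic).
  by apply: compact_setX; exact: segment_compact.
by apply/seteqP; split => x; rewrite /box /= !in_itv /= !ler_norml.
Qed.

Lemma continuous_box_bounded f M : continuous f -> 0 <= M ->
  exists C, forall x, box M x -> `|f x| <= C.
Proof.
move=> cf M0; have b0 : box M !=set0 by exists (0, 0); rewrite /box /= normr0.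
have cn : {within box M, continuous (fun x => `|f x|)}.
  by apply: continuous_subspaceT => x; apply: cvg_norm; exact: cf.
have [c _ Hc] := compact_EVT_max b0 (@box_compact M) cn.
by exists `|f c| => x bx; apply: Hc; rewrite inE.
Qed.

Lemma test_fun0 phi x : test_fun phi -> ~ B1 x -> phi x = 0.
Proof.
move=> [_ _ sB] Bx; apply/eqP/negPn/negP => H; apply: Bx; apply: sB.
exact: subset_closure.
Qed.

Lemma test_fun_box phi x : test_fun phi -> ~ box 1 x -> phi x = 0.
Proof. by move=> tp bx; apply: test_fun0 => // /B1_box. Qed.

Lemma test_fun_is_derive phi (x : R * R) : test_fun phi ->
  is_derive x (1, 0) phi (pderiv1 phi x) /\ is_derive x (0, 1) phi (pderiv2 phi x).
Proof.
move=> [sm _ _]; have [_ d1 d2] := sm [::].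
split; apply: derivableP; [exact: d1|exact: d2].
Qed.

(** The support is closed and contained in the open disc, so [phi] vanishes in a whole neighbourhood
    of [x], even when [x] is on the unit circle. *)
Lemma test_fun_deriv0 phi (x : R * R) : test_fun phi -> ~ B1 x ->
  pderiv1 phi x = 0 /\ pderiv2 phi x = 0.
Proof.
move=> tp Bx; have [_ _ sB] := tp.
have n0 : \near x, (cst 0 : R * R -> R) x = phi x.
  have : nbhs x (~` closure [set y | phi y != 0]).
    apply: open_nbhs_nbhs; split; first exact: closed_openC (@closed_closure _ _).
    by move=> /sB.
  apply: filterS => y Hy; apply/esym/eqP/negPn/negP => H; apply: Hy; exact: subset_closure.
split.
- have := near_eq_is_derive n0 (is_derive_cst (0 : R) x (1, 0)); by case.
- have := near_eq_is_derive n0 (is_derive_cst (0 : R) x (0, 1)); by case.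
Qed.

Lemma test_fun_measurable phi : test_fun phi ->
  [/\ measurable_fun setT (phi : plane -> R), measurable_fun setT (pderiv1 phi : plane -> R) &
      measurable_fun setT (pderiv2 phi : plane -> R)].
Proof.
move=> [sm _ _].
by split; apply: continuous_measurable_plane;
  [have [] := sm [::]|have [] := sm [:: false]|have [] := sm [:: true]].
Qed.

Lemma test_fun_bounded phi : test_fun phi ->
  exists C, forall x, [/\ `|phi x| <= C, `|pderiv1 phi x| <= C & `|pderiv2 phi x| <= C].
Proof.
move=> tp; have [sm _ _] := tp.
have [C0 H0] : exists C, forall x, box 1 x -> `|phi x| <= C.
  by apply: continuous_box_bounded => //; have [] := sm [::].
have [C1 H1] : exists C, forall x, box 1 x -> `|pderiv1 phi x| <= C.
  by apply: continuous_box_bounded => //; have [] := sm [:: false].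
have [C2 H2] : exists C, forall x, box 1 x -> `|pderiv2 phi x| <= C.
  by apply: continuous_box_bounded => //; have [] := sm [:: true].
exists (`|C0| + `|C1| + `|C2|) => x.
have n0 := normr_ge0 C0; have n1 := normr_ge0 C1; have n2 := normr_ge0 C2.
case: (pselect (B1 x)) => Bx.
  have bx := B1_box Bx; move: (H0 x bx) (H1 x bx) (H2 x bx) => h0 h1 h2.
  have l0 := ler_norm C0; have l1 := ler_norm C1; have l2 := ler_norm C2.
  split.
  - by apply: (le_trans h0); apply: (le_trans l0); rewrite -addrA lerDl addr_ge0.
  - by apply: (le_trans h1); apply: (le_trans l1); rewrite addrAC lerDr addr_ge0.
  - by apply: (le_trans h2); apply: (le_trans l2); rewrite lerDr addr_ge0.
have [-> ->] := test_fun_deriv0 tp Bx.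
by rewrite (test_fun0 tp Bx) normr0 !addr_ge0.
Qed.

(** The mean value theorem is applied on the two axis-parallel segments that join [y] to [x]. *)
Lemma test_fun_lip phi : test_fun phi -> exists L, lip L phi.
Proof.
move=> tp; have [C HC] := test_fun_bounded tp; exists C => x y.
have C0 : 0 <= C by have [/(le_trans (normr_ge0 _))] := HC (0, 0).
have l1 a b t : a <= b -> `|phi (b, t) - phi (a, t)| <= C * (b - a).
  move=> ab; apply: (@MVT_bound _ (fun s => phi (s, t)) (fun s => pderiv1 phi (s, t)) a b C ab).
    by move=> s _; apply/(is_derive_fst phi (s, t)); have [] := test_fun_is_derive (s, t) tp.
  by move=> s _; have [_ + _] := HC (s, t).
have l2 a b t : a <= b -> `|phi (t, b) - phi (t, a)| <= C * (b - a).
  move=> ab; apply: (@MVT_bound _ (fun s => phi (t, s)) (fun s => pderiv2 phi (t, s)) a b C ab).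
    by move=> s _; apply/(is_derive_snd phi (t, s)); have [] := test_fun_is_derive (t, s) tp.
  by move=> s _; have [_ _ +] := HC (t, s).
have l1' a b t : `|phi (b, t) - phi (a, t)| <= C * `|b - a|.
  case: (leP a b) => ab; first by rewrite [X in _ * X]ger0_norm ?subr_ge0 // l1.
  have ba := ltW ab.
  by rewrite distrC [X in _ * X]distrC [X in _ * X]ger0_norm ?subr_ge0 // l1.
have l2' a b t : `|phi (t, b) - phi (t, a)| <= C * `|b - a|.
  case: (leP a b) => ab; first by rewrite [X in _ * X]ger0_norm ?subr_ge0 // l2.
  have ba := ltW ab.
  by rewrite distrC [X in _ * X]distrC [X in _ * X]ger0_norm ?subr_ge0 // l2.
case: x y => x1 x2 [y1 y2] /=.
rewrite (_ : _ - _ = (phi (x1, x2) - phi (y1, x2)) + (phi (y1, x2) - phi (y1, y2))); last by ring.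
by rewrite (le_trans (ler_normD _ _)) // mulrDr lerD.
Qed.

Lemma Rintegral_B1 (h : plane -> R) : (forall x, ~ B1 x -> h x = 0) ->
  \int[mu]_(x in B1) h x = \int[mu]_x h x.
Proof.
move=> h0; rewrite Rintegral_mkcond; apply: eq_Rintegral => x _.
by rewrite patchE; case: ifPn => // /negP H; rewrite h0 // => Bx; apply: H; rewrite inE.
Qed.

Lemma lip_L2 L f : lip L f -> L2B1 f.
Proof.
move=> lf; apply: L2_bounded; first by apply: measurable_funTS; exact: lip_measurable lf.
by move=> x /B1_box; exact: lip_le_box lf x.
Qed.

(** Both integrands vanish outside the disc, so the identity can be read on the whole plane, where
    [ibp] applies with the test function as the factor of bounded support. *)
Lemma lip_weak_grad L f (f1 f2 : plane -> R) C : lip L f ->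
  measurable_fun setT f1 -> measurable_fun setT f2 ->
  (forall x, `|f1 x| <= C) -> (forall x, `|f2 x| <= C) ->
  ae_derive (1, 0) f f1 -> ae_derive (0, 1) f f2 ->
  is_weak_grad f (fun x => (f1 x, f2 x)).
Proof.
move=> lf m1 m2 b1 b2 d1 d2; split.
- by apply: (@L2_bounded f1 C); [exact: measurable_funTS|move=> x _].
- by apply: (@L2_bounded f2 C); [exact: measurable_funTS|move=> x _].
move=> phi tp /=; have [L' lp] := test_fun_lip tp.
have [_ mp1 mp2] := test_fun_measurable tp.
have n0 : `|0 : R| <= 1 by rewrite normr0.
have n1 : `|1 : R| <= 1 by rewrite normr1.
split.
- rewrite !Rintegral_B1; first last.
  + by move=> x Bx; have [-> _] := test_fun_deriv0 tp Bx; rewrite mulr0.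
  + by move=> x Bx; rewrite (test_fun0 tp Bx) mulr0.
  apply: (@ibp _ (1, 0) _ _ _ _ _ _ 1 n1 n0 ler01 lf lp) => //.
  + by move=> x bx; exact: test_fun_box.
  + by apply: aeW => x; have [] := test_fun_is_derive x tp.
- rewrite !Rintegral_B1; first last.
  + by move=> x Bx; have [_ ->] := test_fun_deriv0 tp Bx; rewrite mulr0.
  + by move=> x Bx; rewrite (test_fun0 tp Bx) mulr0.
  apply: (@ibp _ (0, 1) _ _ _ _ _ _ 1 n0 n1 ler01 lf lp) => //.
  + by move=> x bx; exact: test_fun_box.
  + by apply: aeW => x; have [] := test_fun_is_derive x tp.
Qed.

Lemma test_fun_weak_grad phi : test_fun phi ->
  is_weak_grad phi (fun x => (pderiv1 phi x, pderiv2 phi x)).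
Proof.
move=> tp; have [C HC] := test_fun_bounded tp.
have [_ mp1 mp2] := test_fun_measurable tp; have [L lp] := test_fun_lip tp.
apply: (@lip_weak_grad L _ _ _ C) => //.
- by move=> x; have [_ + _] := HC x.
- by move=> x; have [_ _ +] := HC x.
- by apply: aeW => x; have [] := test_fun_is_derive x tp.
- by apply: aeW => x; have [] := test_fun_is_derive x tp.
Qed.

Lemma test_fun_L2 phi : test_fun phi ->
  [/\ L2B1 phi, L2B1 (pderiv1 phi) & L2B1 (pderiv2 phi)].
Proof.
move=> tp; have [L lp] := test_fun_lip tp.
by have [? ? _] := test_fun_weak_grad tp; split => //; exact: lip_L2 lp.
Qed.

End Sobolev.

(** * Differences and uniqueness of weak gradients *)

Section WeakGradient.
Context {R : realType}.
Local Notation mu := (@leb2 R).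
Local Notation B1 := (@B1 R).
Implicit Types (f u v phi : R * R -> R) (g h : R * R -> R * R).

Global Instance leb2_ae_filter : Filter (nbhs (almost_everywhere mu)).
Proof. exact: ae_filter_ringOfSetsType. Qed.

Lemma weak_gradP u : H1 u -> is_weak_grad u (weak_grad u).
Proof. by move=> [_ [g ug]]; exact: (xgetPex _ (ex_intro _ g ug)). Qed.

Lemma is_weak_gradB u v g h : L2B1 u -> L2B1 v ->
  is_weak_grad u g -> is_weak_grad v h ->
  is_weak_grad (fun x => u x - v x) (fun x => ((g x).1 - (h x).1, (g x).2 - (h x).2)).
Proof.
move=> Lu Lv [g1 g2 gp] [h1 h2 hp]; split; [exact: L2B g1 h1|exact: L2B g2 h2|].
move=> phi tp; have [Lp Lp1 Lp2] := test_fun_L2 tp.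
have [gp1 gp2] := gp _ tp; have [hp1 hp2] := hp _ tp.
have mB := @measurable_B1 R.
have D a b q : L2B1 a -> L2B1 b -> L2B1 q ->
    \int[mu]_(x in B1) ((a x - b x) * q x) =
    \int[mu]_(x in B1) (a x * q x) - \int[mu]_(x in B1) (b x * q x).
  move=> La Lb Lq; rewrite -RintegralB //; [|exact: L2M La Lq|exact: L2M Lb Lq].
  by apply: eq_Rintegral => x _; rewrite mulrBl.
split; rewrite !D //=.
- by rewrite gp1 hp1 opprD.
- by rewrite gp2 hp2 opprD.
Qed.

(** This is what allows the chosen [weak_grad] in the energy to be replaced by an explicit
    gradient. *)
Lemma weak_grad_unique u g h : is_weak_grad u g -> is_weak_grad u h ->
  {ae mu, forall x, B1 x -> g x = h x}.
Proof.
move=> [g1 g2 gp] [h1 h2 hp].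
have mB := @measurable_B1 R.
have D (a b q : R * R -> R) : L2B1 a -> L2B1 b -> L2B1 q ->
    \int[mu]_(x in B1) (a x * q x) = \int[mu]_(x in B1) (b x * q x) ->
    \int[mu]_(x in B1) ((a x - b x) * q x) = 0.
  move=> La Lb Lq E; have := subrr (\int[mu]_(x in B1) (a x * q x)).
  rewrite {2}E -RintegralB //; [|exact: L2M La Lq|exact: L2M Lb Lq].
  by move=> <-; apply: eq_Rintegral => x _; rewrite mulrBl.
have A1 : {ae mu, forall x, B1 x -> (g x).1 - (h x).1 = 0}.
  apply: ae_eq0_weak; first exact: L2_integrable (L2B g1 h1).
  move=> phi tp; have [Lp _ _] := test_fun_L2 tp.
  apply: D => //; apply: oppr_inj.
  by have [<- _] := gp _ tp; have [<- _] := hp _ tp.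
have A2 : {ae mu, forall x, B1 x -> (g x).2 - (h x).2 = 0}.
  apply: ae_eq0_weak; first exact: L2_integrable (L2B g2 h2).
  move=> phi tp; have [Lp _ _] := test_fun_L2 tp.
  apply: D => //; apply: oppr_inj.
  by have [_ <-] := gp _ tp; have [_ <-] := hp _ tp.
apply: filterS2 A1 A2 => x H1 H2 Bx.
have /eqP := H1 Bx; have /eqP := H2 Bx; rewrite !subr_eq0 => /eqP E2 /eqP E1.
by rewrite [g x]surjective_pairing E1 E2 -surjective_pairing.
Qed.

End WeakGradient.

(** * Calibrations *)

Section TruncatedPrimitive.
Context {R : realType}.
Implicit Types (tau s t : R).

Lemma is_derive_pos_sq t : is_derive t 1 (fun t => Num.max t 0 ^+ 2) (2 * Num.max t 0).
Proof.
have [t0|t0|->] := ltgtP t 0.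
- rewrite mulr0; apply: (@near_eq_is_derive _ _ _ (cst 0)).
  near=> x; rewrite max_r ?expr0n //; apply: ltW; near: x; exact: lt_nbhsl.
- apply: (@near_eq_is_derive _ _ _ (fun t => t * t)).
    by near=> x; rewrite max_l ?expr2 //; apply: ltW; near: x; exact: lt_nbhsr.
  apply: (is_derive_eq (is_derive_mul (is_derive_id t 1) (is_derive_id t 1))).
  by ring.
- rewrite mulr0.
  have cv : (fun h : R => h^-1 *: (((fun t => Num.max t 0 ^+ 2) \o shift 0) (h *: 1) - Num.max 0 0 ^+ 2)) @ 0^' --> (0 : R).
    apply/cvgrPdist_le => e e0; near=> h.
    have h0 : h != 0 by near: h; exact: nbhs_dnbhs_neq.
    have he : `|h| <= e.
      near: h; apply: cvg_within; apply/nbhs_ballP; exists e => //=.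
      by move=> x /=; rewrite /ball /= sub0r normrN => /ltW.
    rewrite sub0r normrN /= maxxx expr0n subr0 addr0 [h *: 1]mulr1 [_ *: _](_ : _ = h^-1 * Num.max h 0 ^+ 2) //.
    apply: le_trans he; case: (leP h 0) => hp; first by rewrite expr0n /= mulr0 normr0.
    by rewrite expr2 mulrA mulVf // mul1r.
  by split; [exact: cvgP cv|exact: cvg_lim cv].
Unshelve. all: by end_near.
Qed.

(** A C^1 regularization of the positive part: the primitive, zero for [t <= 0], of [dsoftpos tau],
    which is [t_+ / tau] cut off at 1. The Lipschitz bound on this derivative is what permits
    comparing its values at [u - phi] and at [v]. *)
Definition softpos tau t : R := (Num.max t 0 ^+ 2 - Num.max (t - tau) 0 ^+ 2) / (2 * tau).
Definition dsoftpos tau t : R := (Num.max t 0 - Num.max (t - tau) 0) / tau.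

Lemma is_derive_softpos tau t : 0 < tau -> is_derive t 1 (softpos tau) (dsoftpos tau t).
Proof.
move=> tau0.
have d1 : is_derive t 1 (fun t : R => t - tau) (1 - 0).
  exact: is_derive_sub (is_derive_id t 1) (is_derive_cst tau t 1).
have d2 : is_derive t 1 (fun t => Num.max (t - tau) 0 ^+ 2) (2 * Num.max (t - tau) 0 * (1 - 0)).
  exact: (is_derive_comp (f := fun t => Num.max t 0 ^+ 2) (g := fun t => t - tau) (is_derive_pos_sq (t - tau)) d1).
have := is_derive_scale ((2 * tau)^-1) (is_derive_sub (is_derive_pos_sq t) d2).
rewrite /softpos; under [fun t => _ / _]eq_fun do rewrite mulrC.
move=> H; apply: (is_derive_eq H); rewrite /dsoftpos; field; exact: lt0r_neq0.
Qed.

Lemma dsoftpos_itv tau t : 0 < tau -> 0 <= dsoftpos tau t <= 1.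
Proof.
move=> tau0; rewrite /dsoftpos; apply/andP; split.
  apply: divr_ge0; last exact: ltW.
  by case: (leP t 0); case: (leP (t - tau) 0) => *; lra.
by rewrite ler_pdivrMr // mul1r; case: (leP t 0); case: (leP (t - tau) 0) => *; lra.
Qed.

Lemma dsoftpos_le0 tau t : 0 < tau -> t <= 0 -> dsoftpos tau t = 0.
Proof.
move=> tau0 t0; rewrite /dsoftpos !max_r ?subr0 ?mul0r //; lra.
Qed.

Lemma dsoftpos_ge tau t : 0 < tau -> tau <= t -> dsoftpos tau t = 1.
Proof.
move=> tau0 t0; rewrite /dsoftpos !max_l; [|lra|lra].
by field; rewrite gt_eqF.
Qed.

Lemma dsoftpos_lip tau s t : 0 < tau -> `|dsoftpos tau s - dsoftpos tau t| <= `|s - t| / tau.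
Proof.
move=> tau0; rewrite /dsoftpos -mulrBl normrM [X in _ * X]gtr0_norm ?invr_gt0 //.
rewrite ler_pM2r ?invr_gt0 // ler_norml.
have := ler_norm (s - t); have := ler_norm (- (s - t)); rewrite normrN.
case: (leP s 0); case: (leP (s - tau) 0); case: (leP t 0); case: (leP (t - tau) 0);
 intros; apply/andP; split; lra.
Qed.

Lemma softpos_lip tau s t : 0 < tau -> `|softpos tau s - softpos tau t| <= `|s - t|.
Proof.
move=> tau0; wlog ts : s t / t <= s.
  by move=> H; case: (leP t s) => [|/ltW] /H //; rewrite distrC [`|t - s|]distrC.
rewrite [leRHS]ger0_norm ?subr_ge0 // -[leRHS]mul1r.
apply: (MVT_bound ts (fun x _ => is_derive_softpos x tau0)) => x _.
by have /andP[d0 d1] := dsoftpos_itv x tau0; rewrite ger0_norm.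
Qed.

Lemma dsoftpos_continuous tau : 0 < tau -> continuous (dsoftpos tau).
Proof.
move=> tau0 x; apply/cvgrPdist_le => e e0; near=> y.
apply: le_trans (dsoftpos_lip _ _ tau0) _; rewrite ler_pdivrMr //.
near: y; have : y @[y --> x] --> x by exact: cvg_id.
by move/cvgrPdist_le; apply; exact: mulr_gt0.
Unshelve. all: by end_near.
Qed.

End TruncatedPrimitive.

(** * The calibration argument *)

Section Calibration.
Context {R : realType}.
Local Notation plane := (measurableTypeR R * measurableTypeR R)%type.
Local Notation mu := (@leb2 R).
Local Notation B1 := (@B1 R).
Variables (u psi psi1 psi2 Q : R * R -> R) (L L' C : R).
Hypotheses (lu : lip L u) (lpsi : lip L' psi).
Hypotheses (mpsi1 : measurable_fun setT (psi1 : plane -> R))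
  (mpsi2 : measurable_fun setT (psi2 : plane -> R))
  (mQ : measurable_fun setT (Q : plane -> R)).
Hypotheses (bpsi1 : forall x, `|psi1 x| <= C) (bpsi2 : forall x, `|psi2 x| <= C)
  (bQ : forall x, `|Q x| <= C).
Hypotheses (u_ge0 : forall x, 0 <= u x) (psiQ : forall x, psi1 x ^+ 2 + psi2 x ^+ 2 <= Q x)
  (Q_pos : forall x, 0 < u x -> Q x = psi1 x ^+ 2 + psi2 x ^+ 2).

Let u1 x := if 0 < u x then - psi2 x else 0.
Let u2 x := if 0 < u x then psi1 x else 0.

Hypotheses (dpsi1 : ae_derive (1, 0) psi psi1) (dpsi2 : ae_derive (0, 1) psi psi2)
  (du1 : ae_derive (1, 0) u u1) (du2 : ae_derive (0, 1) u u2).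

Let C0 : 0 <= C. Proof. exact: le_trans (normr_ge0 _) (bQ (0, 0)). Qed.

Lemma measurable_fun_pos_if (D : set plane) (v f g : plane -> R) : measurable D ->
  measurable_fun D v -> measurable_fun D f -> measurable_fun D g ->
  measurable_fun D (fun x => if 0 < v x then f x else g x).
Proof.
move=> mD mv mf mg; apply: measurable_fun_if => //.
- by apply: measurable_fun_ltr => //; exact: measurable_cst.
- by apply: measurable_funS mf => //; exact: subIsetl.
- by apply: measurable_funS mg => //; exact: subIsetl.
Qed.

Let mu_ : measurable_fun setT (u : plane -> R). Proof. exact: lip_measurable lu. Qed.

Let mu1 : measurable_fun setT (u1 : plane -> R).
Proof. by apply: measurable_fun_pos_if => //; exact: measurable_funN. Qed.

Let mu2 : measurable_fun setT (u2 : plane -> R).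
Proof. exact: measurable_fun_pos_if. Qed.

Let bu1 x : `|u1 x| <= C.
Proof. by rewrite /u1; case: ifP => _; rewrite ?normr0 // normrN. Qed.

Let bu2 x : `|u2 x| <= C.
Proof. by rewrite /u2; case: ifP => _; rewrite ?normr0. Qed.

Let u_weak_grad : is_weak_grad u (fun x => (u1 x, u2 x)).
Proof. exact: (lip_weak_grad lu mu1 mu2 bu1 bu2 du1 du2). Qed.

Lemma calibrated_H1 : H1 u.
Proof. by split; [exact: lip_L2 lu|exists (fun x => (u1 x, u2 x))]. Qed.

(* The divergence-free field [(- psi2, psi1)] is tested with
   [softpos tau (u - phi) - softpos tau u]. *)
Lemma calibration_flux tau phi : 0 < tau -> test_fun phi ->
  \int[mu]_(x in B1) (dsoftpos tau (u x - phi x) *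
     (psi1 x * (u2 x - pderiv2 phi x) - psi2 x * (u1 x - pderiv1 phi x))) =
  \int[mu]_(x in B1) (if 0 < u x then dsoftpos tau (u x) * Q x else 0).
Proof.
move=> tau0 tp; have [Lp lp] := test_fun_lip tp.
have [mp mp1 mp2] := test_fun_measurable tp; have [Cp HCp] := test_fun_bounded tp.
have mB := @measurable_B1 R.
pose w x := u x - phi x.
have mw : measurable_fun setT (w : plane -> R) by exact: measurable_funB.
have mds (f : plane -> R) : measurable_fun setT f -> measurable_fun setT (fun x => dsoftpos tau (f x)).
  move=> mf; apply: (measurableT_comp (f := dsoftpos tau)) => //.
  by apply: continuous_measurable_fun; exact: dsoftpos_continuous.
have bds t : `|dsoftpos tau t| <= 1.
  by have /andP[d0 d1] := dsoftpos_itv t tau0; rewrite ger0_norm.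
pose z x := softpos tau (w x) - softpos tau (u x).
pose z1 x := dsoftpos tau (w x) * (u1 x - pderiv1 phi x) - dsoftpos tau (u x) * u1 x.
pose z2 x := dsoftpos tau (w x) * (u2 x - pderiv2 phi x) - dsoftpos tau (u x) * u2 x.
have lz : lip (L + Lp + L) z.
  move=> x y; rewrite /z.
  rewrite (_ : _ - _ - _ = (softpos tau (w x) - softpos tau (w y)) - (softpos tau (u x) - softpos tau (u y))); last by ring.
  rewrite (le_trans (ler_normB _ _)) // mulrDl lerD //; last first.
    by rewrite (le_trans (softpos_lip _ _ tau0)).
  rewrite (le_trans (softpos_lip _ _ tau0)) // /w.
  rewrite (_ : _ - _ - _ = (u x - u y) - (phi x - phi y)); last by ring.
  by rewrite (le_trans (ler_normB _ _)) // mulrDl lerD.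
have z0 x : ~ box 1 x -> z x = 0.
  by move=> bx; rewrite /z /w (test_fun_box tp bx) subr0 subrr.
have mz1 : measurable_fun setT (z1 : plane -> R).
  apply: measurable_funB; apply: measurable_funM => //; try exact: mds.
  exact: measurable_funB.
have mz2 : measurable_fun setT (z2 : plane -> R).
  apply: measurable_funB; apply: measurable_funM => //; try exact: mds.
  exact: measurable_funB.
have dz1 : ae_derive (1, 0) z z1.
  apply: filterS du1 => x ux; have [px _] := test_fun_is_derive x tp.
  apply/is_derive_fst; move/is_derive_fst in ux; move/is_derive_fst in px.
  have ex : (x.1, x.2) = x by case: (x).
  apply: (is_derive_eq (is_derive_sub
    (is_derive_comp (g := fun t => u (t, x.2) - phi (t, x.2)) (is_derive_softpos _ tau0) (is_derive_sub ux px))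
    (is_derive_comp (g := fun t => u (t, x.2)) (is_derive_softpos _ tau0) ux))).
  by rewrite ex.
have dz2 : ae_derive (0, 1) z z2.
  apply: filterS du2 => x ux; have [_ px] := test_fun_is_derive x tp.
  apply/is_derive_snd; move/is_derive_snd in ux; move/is_derive_snd in px.
  have ex : (x.1, x.2) = x by case: (x).
  apply: (is_derive_eq (is_derive_sub
    (is_derive_comp (g := fun t => u (x.1, t) - phi (x.1, t)) (is_derive_softpos _ tau0) (is_derive_sub ux px))
    (is_derive_comp (g := fun t => u (x.1, t)) (is_derive_softpos _ tau0) ux))).
  by rewrite ex.
have n0 : `|0 : R| <= 1 by rewrite normr0.
have n1 : `|1 : R| <= 1 by rewrite normr1.
have key : \int[mu]_x (psi1 x * z2 x) = \int[mu]_x (psi2 x * z1 x).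
  exact: (@null_lagrangian _ (1, 0) (0, 1) _ _ _ _ _ _ _ _ 1 n1 n0 n0 n1 ler01 lpsi lz z0
    mpsi1 mpsi2 mz1 mz2 dpsi1 dpsi2 dz1 dz2).
have zB x : ~ B1 x -> z1 x = 0 /\ z2 x = 0.
  move=> Bx; have [p1 p2] := test_fun_deriv0 tp Bx; have p0 := test_fun0 tp Bx.
  by rewrite /z1 /z2 /w p0 p1 p2 !subr0 !subrr.
rewrite -!Rintegral_B1 in key; [|by move=> x /zB[-> _]; rewrite mulr0|by move=> x /zB[_ ->]; rewrite mulr0].
have bz1 x : `|z1 x| <= C + Cp + C.
  rewrite /z1 (le_trans (ler_normB _ _)) // lerD //; last first.
    by rewrite normrM -[leRHS]mul1r ler_pM.
  rewrite normrM -[leRHS]mul1r ler_pM // (le_trans (ler_normB _ _)) // lerD //.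
  by have [] := HCp x.
have bz2 x : `|z2 x| <= C + Cp + C.
  rewrite /z2 (le_trans (ler_normB _ _)) // lerD //; last first.
    by rewrite normrM -[leRHS]mul1r ler_pM.
  rewrite normrM -[leRHS]mul1r ler_pM // (le_trans (ler_normB _ _)) // lerD //.
  by have [] := HCp x.
have i1 : mu.-integrable B1 (fun x => (psi1 x * z2 x)%:E).
  apply: L2M.
    by apply: (@L2_bounded _ _ C) => //; exact: measurable_funTS.
  by apply: (@L2_bounded _ _ (C + Cp + C)) => //; exact: measurable_funTS.
have i2 : mu.-integrable B1 (fun x => (psi2 x * z1 x)%:E).
  apply: L2M.
    by apply: (@L2_bounded _ _ C) => //; exact: measurable_funTS.
  by apply: (@L2_bounded _ _ (C + Cp + C)) => //; exact: measurable_funTS.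
have i3 : mu.-integrable B1 (fun x => (if 0 < u x then dsoftpos tau (u x) * Q x else 0)%:E).
  apply: (@integrable_B1_bounded _ _ C).
    apply: measurable_fun_pos_if => //; apply: measurable_funTS => //.
    by apply: measurable_funM => //; exact: mds.
  move=> x _; case: ifP => _; rewrite ?normr0 // normrM -[leRHS]mul1r ler_pM //.
have key2 := RintegralB mB i1 i2.
rewrite key subrr in key2.
have i12 := integrableB_EFin mB i1 i2.
have := RintegralD mB i12 i3.
rewrite key2 add0r => <-; apply: eq_Rintegral => x _.
(* Where [u > 0], the terms in [dsoftpos tau (u x)] combine to [psi1^2 + psi2^2 = Q]; elsewhere they
   vanish. *)
rewrite /z1 /z2 /w; case: ifPn => [ux|]; last first.
  rewrite -leNgt => ux; rewrite (dsoftpos_le0 tau0 ux) !mul0r !subr0; ring.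
by rewrite /u1 /u2 ux Q_pos //; ring.
Qed.

Let mB := @measurable_B1 R.

Lemma JQ_integrand v x : grad_sq v x + Q x * \1_[set y | 0 < v y] x =
  grad_sq v x + (if 0 < v x then Q x else 0).
Proof.
rewrite indicE; case: (boolP (0 < v x)) => vx; first by rewrite mem_set // mulr1.
by rewrite memNset ?mulr0 // => /=; apply/negP.
Qed.

Lemma integrable_grad_sq v : H1 v -> mu.-integrable B1 (fun x => (grad_sq v x)%:E).
Proof.
move=> /weak_gradP[[_ g1] [_ g2] _]; exact: integrableD_EFin.
Qed.

Lemma integrable_Q_pos (f : R * R -> R) : measurable_fun (B1 : set plane) (f : plane -> R) ->
  mu.-integrable B1 (fun x => (if 0 < f x then Q x else 0)%:E).
Proof.
move=> mf; apply: (@integrable_B1_bounded _ _ C).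
  by apply: measurable_fun_pos_if => //; exact: measurable_funTS.
by move=> x _; case: ifP => _; rewrite ?normr0.
Qed.

Lemma JQ_Rintegral v : H1 v ->
  JQ Q v = (\int[mu]_(x in B1) (grad_sq v x + (if 0 < v x then Q x else 0)))%:E.
Proof.
move=> Hv; rewrite /JQ /Rintegral fineK.
  by apply: eq_integral => x _; rewrite JQ_integrand.
apply: integrable_fin_num => //; apply: integrableD_EFin => //.
  exact: integrable_grad_sq.
by apply: integrable_Q_pos; case: Hv => -[].
Qed.

(** On the positivity set the squared gradient of [u] is again [Q], hence the factor 2. *)
Lemma calibrated_JQ : JQ Q u = (2 * \int[mu]_(x in B1) (if 0 < u x then Q x else 0))%:E.
Proof.
rewrite (JQ_Rintegral calibrated_H1); congr _%:E.
have mub : measurable_fun (B1 : set plane) (u : plane -> R) by exact: measurable_funTS.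
rewrite -RintegralZl //; last exact: integrable_Q_pos.
rewrite /Rintegral; congr fine.
have i1 := integrableD_EFin mB (integrable_grad_sq calibrated_H1) (integrable_Q_pos mub).
apply: ae_eq_integral => //.
- exact: measurable_int i1.
- exact: measurable_int (integrableZ_EFin mB 2 (integrable_Q_pos mub)).
have := weak_grad_unique (weak_gradP calibrated_H1) u_weak_grad.
apply: filterS => x H Bx; congr _%:E; rewrite /grad_sq (H Bx) /= /u1 /u2.
by case: ifP => ux; [rewrite Q_pos //; ring|ring].
Qed.

(** The two sides differ by [1/s] times a sum of two squares. The weight [s = 1] gives the sharp
    calibration inequality; the weights [t] and [1/t] control the errors. *)
Lemma weighted_cauchy (k q1 q2 y1 y2 s : R) : 0 < s ->
  2 * (k * (q1 * y2 - q2 * y1)) <=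
  s * (y1 ^+ 2 + y2 ^+ 2) + s^-1 * (k ^+ 2 * (q1 ^+ 2 + q2 ^+ 2)).
Proof.
move=> s0; rewrite -subr_ge0.
rewrite (_ : _ - _ = s^-1 * ((s * y2 - k * q1) ^+ 2 + (s * y1 + k * q2) ^+ 2)).
  by rewrite mulr_ge0 ?invr_ge0 ?addr_ge0 ?sqr_ge0 // ltW.
by field; rewrite gt_eqF.
Qed.

(** Here [G] is the gradient of [v] and [D] that of [w - v], where [w = u - phi]. With [a], [b] the
    values of [dsoftpos tau] at [w], [v], the flux splits into parts with coefficients [b] on [G],
    [a - b] on [G] and [a] on [D]. Only the first must be bounded sharply, and it can be since [b]
    lies in [0, 1] and vanishes for [v <= 0]. The second is small because [dsoftpos] is Lipschitz,
    the third because [D] is small. *)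
Lemma calibration_pointwise tau t q1 q2 U w v G1 G2 D1 D2 : 0 < tau -> 0 < t ->
  q1 ^+ 2 + q2 ^+ 2 <= U -> U <= C ->
  2 * (dsoftpos tau w * (q1 * (G2 + D2) - q2 * (G1 + D1))) <=
  G1 ^+ 2 + G2 ^+ 2 + (if 0 < v then U else 0) +
  (t * (G1 ^+ 2 + G2 ^+ 2) + t * C + t^-1 * (D1 ^+ 2 + D2 ^+ 2) +
   t^-1 * (C / tau ^+ 2 * (w - v) ^+ 2)).
Proof.
move=> tau0 t0 qU UC.
have q0 : 0 <= q1 ^+ 2 + q2 ^+ 2 by rewrite addr_ge0 ?sqr_ge0.
have /andP[a0 a1] := dsoftpos_itv w tau0; have /andP[b0 b1] := dsoftpos_itv v tau0.
have ab := dsoftpos_lip w v tau0.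
set a := dsoftpos tau w in a0 a1 ab *; set b := dsoftpos tau v in b0 b1 ab.
have sq1 k : 0 <= k -> k <= 1 -> k ^+ 2 * (q1 ^+ 2 + q2 ^+ 2) <= q1 ^+ 2 + q2 ^+ 2.
  by move=> k0 k1; rewrite ler_piMl // expr_le1.
have ab2 : (a - b) ^+ 2 * (q1 ^+ 2 + q2 ^+ 2) <= C / tau ^+ 2 * (w - v) ^+ 2.
  rewrite (_ : C / _ * _ = (`|w - v| / tau) ^+ 2 * C); last first.
    by rewrite expr_div_n real_normK ?num_real //; ring.
  apply: ler_pM; rewrite ?sqr_ge0 // ?(le_trans qU) // -real_normK ?num_real //.
  by rewrite lerXn2r // nnegrE // (le_trans _ ab).
have i1 : 2 * (b * (q1 * G2 - q2 * G1)) <= G1 ^+ 2 + G2 ^+ 2 + (if 0 < v then U else 0).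
  case: ltP => v0.
    have := weighted_cauchy b q1 q2 G1 G2 ltr01; have := sq1 _ b0 b1; rewrite invr1 !mul1r; lra.
  by rewrite /b dsoftpos_le0 // mul0r mulr0 addr0 addr_ge0 ?sqr_ge0.
have i2 : 2 * ((a - b) * (q1 * G2 - q2 * G1)) <=
    t * (G1 ^+ 2 + G2 ^+ 2) + t^-1 * (C / tau ^+ 2 * (w - v) ^+ 2).
  apply: le_trans (weighted_cauchy _ _ _ _ _ t0) _.
  by rewrite lerD2l ler_pM2l ?invr_gt0.
have i3 : 2 * (a * (q1 * D2 - q2 * D1)) <= t^-1 * (D1 ^+ 2 + D2 ^+ 2) + t * C.
  have ti : 0 < t^-1 by rewrite invr_gt0.
  apply: le_trans (weighted_cauchy _ _ _ _ _ ti) _.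
  rewrite lerD2l invrK ler_pM2l //; have := sq1 _ a0 a1; lra.
have -> : 2 * (a * (q1 * (G2 + D2) - q2 * (G1 + D1))) = 2 * (b * (q1 * G2 - q2 * G1)) +
  2 * ((a - b) * (q1 * G2 - q2 * G1)) + 2 * (a * (q1 * D2 - q2 * D1)) by ring.
move: (if 0 < v then U else 0) i1 => W i1; lra.
Qed.

(** At fixed [tau], the test function is chosen so close to [u - v] that the errors add up to at
    most [t * M], with [t] arbitrary. *)
Lemma calibration_competitor tau v : 0 < tau -> H1 v -> H10 (u \- v) ->
  2 * \int[mu]_(x in B1) (if 0 < u x then dsoftpos tau (u x) * Q x else 0) <=
  \int[mu]_(x in B1) (grad_sq v x + (if 0 < v x then Q x else 0)).
Proof.
move=> tau0 Hv [_ H0].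
set J := \int[mu]_(x in B1) (grad_sq v x + _).
pose G := weak_grad v; have HG : is_weak_grad v G := weak_gradP Hv.
have Lv : L2B1 v by case: Hv.
have iG := integrable_grad_sq Hv.
have iV : mu.-integrable B1 (fun x => (if 0 < v x then Q x else 0)%:E).
  by apply: integrable_Q_pos; case: Lv.
have iC : mu.-integrable B1 (EFin \o (fun=> C) : plane -> \bar R).
  apply: (@integrable_B1_bounded _ _ C); first exact: measurable_cst.
  by move=> x _; rewrite ger0_norm.
(* The errors of weight [1/t] multiply a squared H^1 distance smaller than [t^2], so every error is
   at most [t] times one of these terms. *)
pose M := \int[mu]_(x in B1) grad_sq v x + \int[mu]_(x in B1) C + (1 + C / tau ^+ 2).
have main t : 0 < t ->
  2 * \int[mu]_(x in B1) (if 0 < u x then dsoftpos tau (u x) * Q x else 0) <= J + t * M.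
  move=> t0; have t20 : 0 < t ^+ 2 by rewrite exprn_gt0.
  have [phi tp Hphi] := H0 _ t20.
  rewrite -(calibration_flux tau0 tp).
  pose d x := u x - v x - phi x.
  have [Lp Lp1 Lp2] := test_fun_L2 tp.
  have Lu := lip_L2 lu.
  have HD0 := is_weak_gradB (L2B Lu Lv) Lp (is_weak_gradB Lu Lv u_weak_grad HG) (test_fun_weak_grad tp).
  rewrite /= -/d in HD0.
  have Hd : H1 d by split; [exact: L2B (L2B Lu Lv) Lp|eexists; exact: HD0].
  pose D := weak_grad d; have HD : is_weak_grad d D := weak_gradP Hd.
  have AE := weak_grad_unique HD0 HD.
  have Ld : L2B1 d by case: Hd.
  have id2 : mu.-integrable B1 (fun x => (d x ^+ 2)%:E) by case: Ld.
  have iD := integrable_grad_sq Hd.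
  pose E1 x := u1 x - (G x).1 - pderiv1 phi x.
  pose E2 x := u2 x - (G x).2 - pderiv2 phi x.
  have iE : mu.-integrable B1 (fun x => (E1 x ^+ 2 + E2 x ^+ 2)%:E).
    by apply: integrableD_EFin => //; [case: HD0 => -[]|case: HD0 => _ []].
  have ED : \int[mu]_(x in B1) grad_sq d x = \int[mu]_(x in B1) (E1 x ^+ 2 + E2 x ^+ 2).
    rewrite /Rintegral; congr fine; apply: ae_eq_integral => //.
    - exact: measurable_int iD.
    - exact: measurable_int iE.
    by apply: filterS AE => x H Bx; rewrite /grad_sq -/D -(H Bx).
  have N : \int[mu]_(x in B1) (d x ^+ 2) + \int[mu]_(x in B1) (E1 x ^+ 2 + E2 x ^+ 2) <= t ^+ 2.
    rewrite -ED -RintegralD // -lee_fin /Rintegral fineK; first exact: ltW.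
    by apply: integrable_fin_num => //; exact: integrableD_EFin.
  have N1 : 0 <= \int[mu]_(x in B1) (d x ^+ 2) by apply: Rintegral_ge0 => x _; exact: sqr_ge0.
  have N2 : 0 <= \int[mu]_(x in B1) (E1 x ^+ 2 + E2 x ^+ 2).
    by apply: Rintegral_ge0 => x _; rewrite addr_ge0 ?sqr_ge0.
  have [Cp HCp] := test_fun_bounded tp; have [mp mp1 mp2] := test_fun_measurable tp.
  pose F x := dsoftpos tau (u x - phi x) *
     (psi1 x * (u2 x - pderiv2 phi x) - psi2 x * (u1 x - pderiv1 phi x)).
  have iF : mu.-integrable B1 (fun x => (F x)%:E).
    apply: (@integrable_B1_bounded _ _ (C * (C + Cp) + C * (C + Cp))).
      apply: measurable_funTS; apply: measurable_funM.
        apply: (measurableT_comp (f := dsoftpos tau)).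
          by apply: continuous_measurable_fun; exact: dsoftpos_continuous.
        exact: measurable_funB.
      by apply: measurable_funB; apply: measurable_funM => //; exact: measurable_funB.
    move=> x _; have [_ p1 p2] := HCp x.
    rewrite normrM -[leRHS]mul1r ler_pM //.
      by have /andP[d0 d1] := dsoftpos_itv (u x - phi x) tau0; rewrite ger0_norm.
    rewrite (le_trans (ler_normB _ _)) // lerD // normrM ler_pM //.
      by rewrite (le_trans (ler_normB _ _)) // lerD.
    by rewrite (le_trans (ler_normB _ _)) // lerD.
  rewrite -RintegralZl //.
  have tn0 : t != 0 by rewrite gt_eqF.
  have i1 := integrableZ_EFin mB t iG.
  have i2 := integrableZ_EFin mB t iC.
  have i3 := integrableZ_EFin mB t^-1 iE.
  have i4' := integrableZ_EFin mB (C / tau ^+ 2) id2.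
  have i4 := integrableZ_EFin mB t^-1 i4'.
  have i12 := integrableD_EFin mB i1 i2.
  have i123 := integrableD_EFin mB i12 i3.
  have i1234 := integrableD_EFin mB i123 i4.
  have iJ := integrableD_EFin mB iG iV.
  apply: le_trans (le_Rintegral mB (integrableZ_EFin mB 2 iF) (integrableD_EFin mB iJ i1234) _) _.
    move=> x Bx; rewrite /F.
    have := @calibration_pointwise tau t (psi1 x) (psi2 x) (Q x) (u x - phi x) (v x)
      (G x).1 (G x).2 (E1 x) (E2 x) tau0 t0 (psiQ x) (le_trans (ler_norm _) (bQ x)).
    rewrite (_ : (G x).2 + E2 x = u2 x - pderiv2 phi x); last by rewrite /E2; ring.
    rewrite (_ : (G x).1 + E1 x = u1 x - pderiv1 phi x); last by rewrite /E1; ring.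
    by rewrite (_ : u x - phi x - v x = d x) //; rewrite /d; ring.
  rewrite (RintegralD mB iJ i1234) (RintegralD mB i123 i4) (RintegralD mB i12 i3) (RintegralD mB i1 i2).
  rewrite -/J lerD2l.
  rewrite (RintegralZl _ mB iG) (RintegralZl _ mB iC) (RintegralZl _ mB iE) (RintegralZl _ mB i4') (RintegralZl _ mB id2).
  have K0 : 0 <= C / tau ^+ 2 by rewrite divr_ge0 // exprn_ge0 // ltW.
  rewrite /M !mulrDr mulr1 -!addrA !lerD2l; apply: lerD.
    rewrite ler_pdivrMl // -expr2; lra.
  rewrite ler_pdivrMl // mulrA -expr2 [leRHS]mulrC ler_wpM2l //; lra.
have M0 : 0 <= M.
  rewrite !addr_ge0 ?ler01 //.
  - by apply: Rintegral_ge0 => x _; rewrite addr_ge0 ?sqr_ge0.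
  - exact: Rintegral_ge0.
  - by rewrite divr_ge0 // exprn_ge0 // ltW.
rewrite -subr_ge0 leNgt; apply/negP => neg.
(* For this [t], the product [t * (M + 1)] is exactly the excess over [J], whereas [main] bounds the
   excess by [t * M]. *)
have t0 : 0 < (2 * \int[mu]_(x in B1) (if 0 < u x then dsoftpos tau (u x) * Q x else 0) - J) / (M + 1).
  by apply: divr_gt0; [rewrite subr_gt0 -subr_lt0|exact: ltr_wpDl].
have := main _ t0; set I := 2 * _ in neg t0 *.
rewrite -subr_ge0 leNgt => /negP; apply.
rewrite (_ : _ - _ = (J - I) / (M + 1)); last by field; rewrite gt_eqF // ltr_wpDl.
by rewrite pmulr_llt0 // invr_gt0 ltr_wpDl.
Qed.

Theorem calibrated_minimizer : minimizer Q u.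
Proof.
split; [exact: calibrated_H1|by move=> x _|move=> v Hv Hv0].
rewrite calibrated_JQ (JQ_Rintegral Hv) lee_fin.
set J := \int[mu]_(x in B1) (grad_sq v x + _).
have mub : measurable_fun (B1 : set plane) (u : plane -> R) by exact: measurable_funTS.
(* The scale [tau = 1/(n+1)] may tend to 0 only now that no test function is left in the
   inequality. *)
pose f n x := if 0 < u x then dsoftpos (n.+1%:R^-1) (u x) * Q x else 0.
have n0 n : 0 < n.+1%:R^-1 :> R by rewrite invr_gt0.
have cv : (fun n => \int[mu]_(x in B1) f n x) @ \oo --> \int[mu]_(x in B1) (if 0 < u x then Q x else 0).
  have [] := @dominated_convergence _ plane R mu B1 mB (fun n x => (f n x)%:E)
    (fun x => (if 0 < u x then Q x else 0)%:E) (fun=> C%:E).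
  - move=> n; apply/measurable_EFinP; apply: measurable_fun_pos_if => //.
    apply: measurable_funM; last exact: measurable_funTS.
    apply: (measurableT_comp (f := dsoftpos _)) => //.
    by apply: continuous_measurable_fun; exact: dsoftpos_continuous.
  - exact: measurable_int (integrable_Q_pos mub).
  - apply: aeW => x _; apply: cvg_EFin; first exact: nearW.
    rewrite /f; case: ifP => ux; last exact: cvg_cst.
    apply: cvg_near_cst; near=> n; rewrite /= dsoftpos_ge ?mul1r // ltW //.
    near: n; exact: (near_infty_natSinv_lt (PosNum ux)).
  - apply: (@integrable_B1_bounded _ (fun=> C) C); first exact: measurable_cst.
    by move=> x _; rewrite ger0_norm.
  - apply: aeW => x n _; rewrite /f /= lee_fin; case: ifP => _; rewrite ?normr0 // normrM -[leRHS]mul1r ler_pM //.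
    by have /andP[d0 d1] := dsoftpos_itv (u x) (n0 n); rewrite ger0_norm.
  move=> fi _ H; rewrite /Rintegral; apply: fine_cvg; rewrite fineK //.
  by apply: integrable_fin_num.
have cv2 : (fun n => 2 * \int[mu]_(x in B1) f n x) @ \oo -->
    2 * \int[mu]_(x in B1) (if 0 < u x then Q x else 0).
  by apply: cvgM; [exact: cvg_cst|exact: cv].
apply: (cvgr_to_le cv2); apply: nearW => n.
exact: calibration_competitor.
Unshelve. all: by end_near.
Qed.

End Calibration.

(** * Spiral coordinates *)

Section Circle.
Context {R : realType}.
Implicit Types (s t p : R) (k : int).

Definition red s : R := s - 2 * pi * (Num.floor (s / (2 * pi)))%:~R.

Let pi2_gt0 : 0 < 2 * pi :> R. Proof. by rewrite mulr_gt0 ?pi_gt0. Qed.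

Lemma red_itv s : 0 <= red s < 2 * pi.
Proof.
have /andP[h1 h2] := floor_itv (s / (2 * pi)).
rewrite ler_pdivlMr // in h1; rewrite ltr_pdivrMr // intrD -[1%:~R]/(1 : R) in h2.
by rewrite /red; move: (_%:~R) h1 h2 => z h1 h2; apply/andP; split; lra.
Qed.

Lemma red_exists s : exists k, s = red s + 2 * pi * k%:~R.
Proof. by exists (Num.floor (s / (2 * pi))); rewrite /red subrK. Qed.

Lemma red_unique s k t : s = t + 2 * pi * k%:~R -> 0 <= t < 2 * pi -> red s = t.
Proof.
move=> -> /andP[t0 t1]; rewrite /red.
rewrite (_ : Num.floor _ = k); first by rewrite addrK.
apply: floor_def; rewrite ler_pdivlMr // ltr_pdivrMr // intrD; move: (k%:~R) => z; apply/andP; split; lra.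
Qed.

Lemma red_periodic s k : red (s + 2 * pi * k%:~R) = red s.
Proof.
have [j sj] := red_exists s; apply: (@red_unique _ (j + k)); last exact: red_itv.
by rewrite {1}sj intrD; ring.
Qed.

Lemma red_id t : 0 <= t < 2 * pi -> red t = t.
Proof. by move=> t01; apply: (@red_unique _ 0) => //; rewrite mulr0 addr0. Qed.

Lemma cos_eq1 t : 0 <= t < 2 * pi -> cos t = 1 -> t = 0.
Proof.
move=> /andP[t0 t1] ct.
have [->//|tn0] := eqVneq t 0.
have : 0 < sin (t / 2).
  have tp : 0 < t by rewrite lt_neqAle eq_sym tn0.
  by apply: sin_gt0_pi; apply/andP; split; lra.
have E : t / 2 *+ 2 = t by rewrite mulr2n; lra.
have := cos_mulr2n (t / 2); rewrite E ct cos2sin2 mulr2n => H.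
move=> s0; have : sin (t / 2) ^+ 2 = 0 by lra.
by move/eqP; rewrite sqrf_eq0 gt_eqF.
Qed.

Lemma cos_red s : cos (red s) = cos s.
Proof.
rewrite /red; move: (Num.floor _) => k.
have H n (x : R) : cos (x + 2 * pi * n%:R) = cos x.
  by rewrite -(periodicn (@cosD2pi R) n x); congr cos; rewrite -[_ *+ n]mulr_natr -mulr_natr; ring.
case: k => n; first by rewrite -(H n) subrK.
by rewrite NegzE mulrNz mulrN opprK H.
Qed.

Lemma sin_red s : sin (red s) = sin s.
Proof.
rewrite /red; move: (Num.floor _) => k.
have H n (x : R) : sin (x + 2 * pi * n%:R) = sin x.
  by rewrite -(periodicn (@sinD2pi R) n x); congr sin; rewrite -[_ *+ n]mulr_natr -mulr_natr; ring.
case: k => n; first by rewrite -(H n) subrK.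
by rewrite NegzE mulrNz mulrN opprK H.
Qed.

Lemma polar_unique s t : cos s = cos t -> sin s = sin t -> exists k, s = t + 2 * pi * k%:~R.
Proof.
move=> c1 s1; have cst : cos (s - t) = 1 by rewrite cosB c1 s1 -!expr2 cos2Dsin2.
have r0 : red (s - t) = 0 by apply: cos_eq1; [exact: red_itv|rewrite cos_red].
have [k] := red_exists (s - t); rewrite r0 add0r => E.
by exists k; rewrite -E addrC subrK.
Qed.

End Circle.

(** * Polar coordinates and functions homogeneous along spirals *)

Section Homogeneous.
Context {R : realType}.
Implicit Types (s t p del L M : R) (x y : R * R) (P : R -> R) (k : int).

Let pi2_gt0 : 0 < 2 * pi :> R. Proof. by rewrite mulr_gt0 ?pi_gt0. Qed.

(** The equal end values make one crossing of [2 * pi] harmless; when [t] is more than a full turn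
    ahead of [s], the oscillation of [p], at most [L * (2 * pi)], is already small enough. *)
Lemma periodic_lip (p : R -> R) L : p 0 = p (2 * pi) ->
  (forall s t, 0 <= s -> s <= t -> t <= 2 * pi -> `|p t - p s| <= L * (t - s)) ->
  forall s t, `|p (red t) - p (red s)| <= L * `|t - s|.
Proof.
move=> p02 pL.
have L0 : 0 <= L.
  have := pL 0 (2 * pi) (lexx _) (ltW pi2_gt0) (lexx _).
  by rewrite subr0 => /(le_trans (normr_ge0 _)); rewrite pmulr_lge0.
have base s t : 0 <= s < 2 * pi -> s <= t -> `|p (red t) - p s| <= L * (t - s).
  move=> /andP[s0 s1] st.
  have [t2|t2] := ltP t (2 * pi).
    rewrite red_id; first by apply: pL => //; exact: ltW.
    by rewrite t2 (le_trans s0 st).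
  have [t4|t4] := ltP t (4 * pi).
    rewrite (@red_unique _ t 1 (t - 2 * pi)) ?mulr1 ?subrK //; last first.
      by rewrite subr_ge0 t2 /=; lra.
    rewrite (_ : _ - _ = (p (t - 2 * pi) - p 0) + (p (2 * pi) - p s)); last by rewrite p02; ring.
    apply: le_trans (ler_normD _ _) _.
    have h1 : `|p (t - 2 * pi) - p 0| <= L * (t - 2 * pi - 0) by apply: pL; lra.
    have h2 : `|p (2 * pi) - p s| <= L * (2 * pi - s) by apply: pL; lra.
    by apply: le_trans (lerD h1 h2) _; rewrite -mulrDr ler_wpM2l //; lra.
  have /andP[r0 r1] := red_itv t.
  apply: (@le_trans _ _ (L * (2 * pi))); last by rewrite ler_wpM2l //; lra.
  have [rs|rs] := leP s (red t).
    apply: le_trans (pL _ _ s0 rs (ltW r1)) _; rewrite ler_wpM2l //; lra.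
  rewrite distrC; apply: le_trans (pL _ _ r0 (ltW rs) (ltW s1)) _; rewrite ler_wpM2l //; lra.
have half s t : s <= t -> `|p (red t) - p (red s)| <= L * (t - s).
  move=> st; have [k sk] := red_exists s.
  have st' : red s <= t - 2 * pi * k%:~R by lra.
  have := base (red s) (t - 2 * pi * k%:~R) (red_itv s) st'.
  rewrite (_ : red (t - _) = red t); last by rewrite -(red_periodic (t - _) k) subrK.
  by rewrite (_ : t - _ - red s = t - s) //; lra.
move=> s t; have [st|/ltW ts] := leP s t.
  by rewrite [X in L * X]ger0_norm ?subr_ge0 // half.
by rewrite distrC [X in L * X]distrC [X in L * X]ger0_norm ?subr_ge0 // half.
Qed.

Definition rad x : R := Num.sqrt (x.1 ^+ 2 + x.2 ^+ 2).

Lemma rad_ge0 x : 0 <= rad x. Proof. exact: sqrtr_ge0. Qed.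

Lemma rad_sqr x : rad x ^+ 2 = x.1 ^+ 2 + x.2 ^+ 2.
Proof. by rewrite sqr_sqrtr // addr_ge0 ?sqr_ge0. Qed.

(** The jump by [2 * pi] across the negative half-axis disappears under [red]; the value at the
    origin is immaterial because the radius vanishes there. *)
Definition arg x : R :=
  if 0 <= x.2 then acos (x.1 / rad x) else - acos (x.1 / rad x).

Lemma polar x : x = (rad x * cos (arg x), rad x * sin (arg x)).
Proof.
have rs := rad_sqr x; have r0 := rad_ge0 x.
have [rx0|rx0] := eqVneq (rad x) 0.
  move: rs; rewrite rx0 expr0n /= => /esym/eqP; rewrite paddr_eq0 ?sqr_ge0 //.
  rewrite !sqrf_eq0 => /andP[/eqP e1 /eqP e2].
  by rewrite !mul0r [x]surjective_pairing e1 e2.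
have rp : 0 < rad x by rewrite lt_neqAle eq_sym rx0.
have c1 : -1 <= x.1 / rad x <= 1.
  rewrite -ler_norml normrM normfV (gtr0_norm rp) ler_pdivrMr // mul1r.
  by rewrite -ler_sqr ?nnegrE // real_normK ?num_real // rs lerDl sqr_ge0.
have ca : cos (arg x) = x.1 / rad x.
  by rewrite /arg; case: ifP => _; rewrite ?cosN acosK // in_itv.
have sa : sin (acos (x.1 / rad x)) = `|x.2| / rad x.
  rewrite sin_acos // (_ : 1 - _ = (`|x.2| / rad x) ^+ 2).
    by rewrite sqrtr_sqr ger0_norm // divr_ge0.
  rewrite !expr_div_n real_normK ?num_real // rs; field.
  by rewrite -rs sqrf_eq0.
have sx : sin (arg x) = x.2 / rad x.
  rewrite /arg; case: leP => h; first by rewrite sa ger0_norm.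
  by rewrite sinN sa ltr0_norm // mulNr opprK.
by rewrite ca sx !(mulrC (rad x)) !divfK // -surjective_pairing.
Qed.

(** The profile [P] is evaluated at the spiral angle. At the origin the factor [rad x] makes the
    value 0, whatever the logarithm is there. *)
Definition hom del P x : R := rad x * P (arg x - del * ln (rad x)).

Lemma homE del (p : R -> R) x t : 0 < rad x -> x = (rad x * cos t, rad x * sin t) ->
  hom del (p \o red) x = rad x * p (red (t - del * ln (rad x))).
Proof.
move=> rp xt; rewrite /hom /=; congr (_ * p _).
have [c s] : cos (arg x) = cos t /\ sin (arg x) = sin t.
  have rn0 : rad x != 0 by rewrite gt_eqF.
  have /pair_equal_spec[e1 e2] : (rad x * cos (arg x), rad x * sin (arg x)) = (rad x * cos t, rad x * sin t).
    by rewrite -polar -xt.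
  by split; apply: (mulfI rn0).
have [k ->] := polar_unique c s.
by rewrite addrAC red_periodic.
Qed.

(** On [0, 1] the slope of the sine is at least [cos 1]; between 1 and [pi / 2], monotonicity and
    [pi / 2 < 2] cost the factor 2. *)
Lemma sin_ge_linear t : 0 <= t <= pi / 2 -> cos 1 / 2 * t <= sin t.
Proof.
move=> /andP[t0 t1]; have c1 := @cos1_gt0 R.
have p2 := @pihalf_lt2 R; have p1 := @pihalf_ge1 R.
have lin (u : R) : 0 <= u <= 1 -> cos 1 * u <= sin u.
  move=> /andP[u0 u1].
  have [c + E] : exists2 c, c \in `[0, u] & sin u - sin 0 = cos c * (u - 0).
    apply: MVT_segment => //.
    by apply: continuous_subspaceT => x; exact: continuous_sin.
  rewrite in_itv /= => /andP[c0 cu]; move: E; rewrite sin0 !subr0 => ->.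
  rewrite ler_wpM2r //; have [->//|cn1] := eqVneq c 1.
  apply: ltW; rewrite ltr_cos.
  - by rewrite lt_neqAle cn1 (le_trans cu u1).
  - by rewrite in_itv /=; apply/andP; split; lra.
  - by rewrite in_itv /=; apply/andP; split; lra.
have [t2|t2] := leP t 1.
  have := lin t; rewrite t0 t2 => /(_ isT); apply: le_trans.
  by rewrite ler_wpM2r //; lra.
have := lin 1; rewrite ler01 lexx => /(_ isT) l1.
apply: (@le_trans _ _ (cos 1 * 1)); first by rewrite -mulrA ler_wpM2l //; lra.
apply: le_trans l1 _; apply: ltW; rewrite ltr_sin //.
  by rewrite in_itv /=; apply/andP; split; lra.
by rewrite in_itv /=; apply/andP; split; lra.
Qed.

(** Chord against arc on the unit circle: [2 * (1 - cos t)] is the squared chord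
    [(2 * sin (t / 2))^2]. *)
Lemma one_sub_cos_ge t : `|t| <= pi -> (cos 1 / 2) ^+ 2 * t ^+ 2 <= 2 * (1 - cos t).
Proof.
move=> tpi.
have E : t / 2 *+ 2 = t by rewrite mulr2n; lra.
have := cos_mulr2n (t / 2); rewrite E cos2sin2 mulr2n => H.
have -> : 2 * (1 - cos t) = (2 * sin (t / 2)) ^+ 2 by rewrite H; ring.
rewrite -exprMn -[leLHS]real_normK ?num_real // -[leRHS]real_normK ?num_real //.
rewrite lerXn2r ?nnegrE // !normrM (gtr0_norm (cos1_gt0 _)) normfV (@gtr0_norm _ 2) //.
have -> : `|sin (t / 2)| = sin (`|t| / 2).
  have n0 : 0 <= sin (`|t| / 2).
    by apply: sin_ge0_pi; apply/andP; have := normr_ge0 t; split; lra.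
  rewrite -[RHS]ger0_norm //; have [t0|t0] := leP 0 t; first by rewrite [`|t|]ger0_norm.
  by rewrite [`|t|]ltr0_norm // mulNr sinN normrN.
have n0 := normr_ge0 t.
have h : 0 <= `|t| / 2 <= pi / 2 by apply/andP; split; lra.
by have := sin_ge_linear h; lra.
Qed.

End Homogeneous.

Section HomogeneousLip.
Context {R : realType}.
Implicit Types (s t p del L M : R) (x y : R * R) (P : R -> R) (k : int).

(** By the law of cosines the left-hand side is the squared Euclidean distance, arranged as a sum of
    nonnegative radial and angular parts. *)
Lemma polar_dist x y :
  (rad x - rad y) ^+ 2 + 2 * rad x * rad y * (1 - cos (arg x - arg y)) <=
  (`|x.1 - y.1| + `|x.2 - y.2|) ^+ 2.
Proof.
have ex := polar x; have ey := polar y.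
apply: (@le_trans _ _ ((x.1 - y.1) ^+ 2 + (x.2 - y.2) ^+ 2)).
  rewrite [x in x.1 - _]ex [x in x.2 - _]ex [y in _ - y.1]ey [y in _ - y.2]ey /= cosB.
  have cx := cos2Dsin2 (arg x); have cy := cos2Dsin2 (arg y).
  move: (cos (arg x)) (sin (arg x)) (cos (arg y)) (sin (arg y)) cx cy => a b c d ab cd.
  rewrite le_eqVlt; apply/orP; left; apply/eqP.
  transitivity (rad x ^+ 2 * (a ^+ 2 + b ^+ 2) + rad y ^+ 2 * (c ^+ 2 + d ^+ 2)
    - 2 * rad x * rad y * (a * c + b * d)); last by ring.
  by rewrite ab cd; ring.
by rewrite [leRHS]sqrrD !real_normK ?num_real // lerD2r lerDl mulrn_wge0 // mulr_ge0.
Qed.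

Lemma rad_lip x y : `|rad x - rad y| <= `|x.1 - y.1| + `|x.2 - y.2|.
Proof.
rewrite -ler_sqr ?nnegrE ?addr_ge0 // real_normK ?num_real //.
apply: le_trans (polar_dist x y); rewrite lerDl.
by rewrite !mulr_ge0 ?rad_ge0 // subr_ge0 cos_le1.
Qed.

(** The difference of the radii multiplies a bounded profile. The difference of the spiral angles is
    multiplied by the smaller radius, which turns an angle into a length and, by [ln (1 + z) <= z],
    a difference of logarithms into a difference of radii. *)
Lemma hom_lip del (p : R -> R) L M : p 0 = p (2 * pi) ->
  (forall s t, 0 <= s -> s <= t -> t <= 2 * pi -> `|p t - p s| <= L * (t - s)) ->
  (forall t, 0 <= t < 2 * pi -> `|p t| <= M) ->
  exists K, lip K (hom del (p \o red)).
Proof.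
move=> p02 pL pM.
have pi2_gt0 : 0 < 2 * pi :> R by rewrite mulr_gt0 ?pi_gt0.
have L0 : 0 <= L.
  have := pL 0 (2 * pi) (lexx _) (ltW pi2_gt0) (lexx _).
  by rewrite subr0 => /(le_trans (normr_ge0 _)); rewrite pmulr_lge0.
have PL := periodic_lip p02 pL.
have PM s : `|(p \o red) s| <= M by apply: pM; exact: red_itv.
have M0 : 0 <= M by apply: le_trans (PM 0).
pose c : R := cos 1 / 2; have c0 : 0 < c by rewrite divr_gt0 // cos1_gt0.
pose K := M + L * (c^-1 + `|del|).
have K0 : 0 <= L * (c^-1 + `|del|) by rewrite mulr_ge0 // addr_ge0 // invr_ge0 ltW.
suff H x y : rad y <= rad x -> `|hom del (p \o red) x - hom del (p \o red) y| <=
    K * (`|x.1 - y.1| + `|x.2 - y.2|).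
  exists K => x y; have [/ltW|] := ltP (rad y) (rad x); first exact: H.
  by move=> /H; rewrite distrC [`|y.1 - _|]distrC [`|y.2 - _|]distrC.
move=> ryx; have rx0 := rad_ge0 x; have ry0 := rad_ge0 y.
have rl := rad_lip x y; have pd := polar_dist x y.
set D := `|x.1 - y.1| + _ in rl pd *.
have D0 : 0 <= D by rewrite addr_ge0.
rewrite /hom; set S := arg x - _; set T := arg y - _.
rewrite (_ : _ - _ = (rad x - rad y) * (p \o red) S + rad y * ((p \o red) S - (p \o red) T)); last by ring.
rewrite (le_trans (ler_normD _ _)) // /K [leRHS]mulrDl lerD //.
  by rewrite normrM mulrC ler_pM.
rewrite normrM (ger0_norm ry0).
have [->|ryn0] := eqVneq (rad y) 0; first by rewrite mul0r mulr_ge0.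
have ryp : 0 < rad y by rewrite lt_neqAle eq_sym ryn0.
have rxp : 0 < rad x by exact: lt_le_trans ryx.
(* the angular difference, reduced to [-pi, pi] *)
have [k [dl dpi dc]] : exists k, exists2 dl, arg x - arg y = dl + 2 * pi * k%:~R &
    `|dl| <= pi /\ cos (arg x - arg y) = cos dl.
  have [k0 E] := red_exists (arg x - arg y); have /andP[h0 h1] := red_itv (arg x - arg y).
  have [h|h] := leP (red (arg x - arg y)) pi.
    exists k0, (red (arg x - arg y)) => //; split; first by rewrite ger0_norm.
    by rewrite cos_red.
  exists (k0 + 1), (red (arg x - arg y) - 2 * pi).
    by rewrite [LHS]E intrD -[1%:~R]/(1 : R); ring.
  split; first by rewrite ler0_norm; lra.
  rewrite -cos_red -[RHS]cos_red -[in RHS](red_periodic _ 1) -[1%:~R]/(1 : R) mulr1 subrK.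
  by rewrite [red (red _)]red_id // h0 h1.
have ST : `|(p \o red) S - (p \o red) T| <= L * (`|dl| + `|del| * (ln (rad x) - ln (rad y))).
  have lnxy : 0 <= ln (rad x) - ln (rad y) by rewrite subr_ge0 ler_ln.
  have -> : (p \o red) T = (p \o red) (T + 2 * pi * k%:~R) by rewrite /= red_periodic.
  apply: le_trans (PL _ _) _; rewrite ler_wpM2l //.
  rewrite (_ : S - _ = dl - del * (ln (rad x) - ln (rad y))); last first.
    by rewrite /S /T; move: dpi => /(congr1 (fun z => z + arg y)); rewrite subrK => ->; ring.
  by rewrite (le_trans (ler_normB _ _)) // normrM (ger0_norm lnxy).
have ang : rad y * `|dl| <= D / c.
  have h0 : 0 <= rad y * `|dl| * c by apply: mulr_ge0; [exact: mulr_ge0|exact: ltW].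
  rewrite ler_pdivlMr // -ler_sqr ?nnegrE //.
  apply: le_trans pd.
  apply: (@le_trans _ _ (2 * rad x * rad y * (1 - cos (arg x - arg y)))); last first.
    by rewrite lerDr sqr_ge0.
  have [dlpi ->] := dc.
  have := one_sub_cos_ge dlpi; rewrite -/c => h.
  apply: (@le_trans _ _ (rad y * rad y * (2 * (1 - cos dl)))).
    rewrite (_ : (_ * _ * c) ^+ 2 = rad y * rad y * (c ^+ 2 * `|dl| ^+ 2)); last by ring.
    by rewrite real_normK ?num_real //; apply: ler_wpM2l; [exact: mulr_ge0|exact: h].
  rewrite (_ : 2 * _ * _ * _ = rad x * rad y * (2 * (1 - cos dl))); last by ring.
  apply: ler_wpM2r; first by rewrite mulr_ge0 // subr_ge0 cos_le1.
  exact: ler_wpM2r.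
have lnb : rad y * (ln (rad x) - ln (rad y)) <= D.
  have -> : ln (rad x) - ln (rad y) = ln (1 + (rad x / rad y - 1)).
    by rewrite addrCA subrr addr0 ln_div.
  apply: le_trans (_ : rad y * (rad x / rad y - 1) <= _).
    by rewrite ler_wpM2l // le_ln1Dx // ltrBrDl subrr divr_gt0.
  rewrite mulrBr mulr1 mulrCA divff // mulr1.
  by apply: le_trans rl; exact: ler_norm.
apply: (@le_trans _ _ (rad y * (L * (`|dl| + `|del| * (ln (rad x) - ln (rad y)))))).
  by apply: ler_wpM2l; [exact: ry0|exact: ST].
rewrite (_ : rad y * _ = L * (rad y * `|dl| + `|del| * (rad y * (ln (rad x) - ln (rad y))))); last by ring.
rewrite -mulrA; apply: ler_wpM2l => //; rewrite mulrDl; apply: lerD; first by rewrite [leRHS]mulrC.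
by apply: ler_wpM2l.
Qed.

End HomogeneousLip.

(** * Partial derivatives in spiral coordinates *)

Section HomogeneousDeriv.
Context {R : realType}.
Implicit Types (s t p del L M d : R) (x y : R * R) (P : R -> R) (k : int).

Lemma is_derive_red (p : R -> R) s d : 0 < red s -> is_derive (red s) 1 p d ->
  is_derive s 1 (p \o red) d.
Proof.
move=> s0 pd; have [k sk] := red_exists s; have /andP[_ s1] := red_itv s.
have D1 : is_derive s 1 (fun t : R => t - 2 * pi * k%:~R) (1 - 0).
  exact: is_derive_sub (is_derive_id s 1) (is_derive_cst (2 * pi * k%:~R) s 1).
have sE : s - 2 * pi * k%:~R = red s by lra.
have D2 : is_derive s 1 (fun t : R => p (t - 2 * pi * k%:~R)) (d * (1 - 0)).
  by apply: (is_derive_comp (f := p) (g := fun t : R => t - 2 * pi * k%:~R)) => //; rewrite sE.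
rewrite -[d](_ : d * (1 - 0) = d); last by rewrite subr0 mulr1.
apply: (near_eq_is_derive _ D2); near=> t => /=; congr p; apply/esym.
apply: (@red_unique _ _ k); first by rewrite subrK.
apply/andP; split.
  have : s - red s < t by near: t; apply: lt_nbhsr; lra.
  lra.
have : t < s + (2 * pi - red s) by near: t; apply: lt_nbhsl; lra.
lra.
Unshelve. all: by end_near.
Qed.

(** A branch of the angle that is differentiable off the vertical axis, including the negative
    half-axis where [arg] jumps; the two agree modulo [2 * pi]. *)
Definition theta x : R := atan (x.2 / x.1) + (if 0 < x.1 then 0 else pi).

Lemma rad_gt0 x : x.1 != 0 -> 0 < rad x.
Proof.
move=> x0; rewrite sqrtr_gt0 ltr_wpDr ?sqr_ge0 // lt_neqAle sqr_ge0 andbT eq_sym.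
by rewrite sqrf_eq0.
Qed.

Lemma theta_polar x : x.1 != 0 -> x = (rad x * cos (theta x), rad x * sin (theta x)).
Proof.
move=> x0; have r0 := rad_gt0 x0.
have rx : Num.sqrt (1 + (x.2 / x.1) ^+ 2) = rad x / `|x.1|.
  rewrite (_ : 1 + _ = (rad x / `|x.1|) ^+ 2).
    by rewrite sqrtr_sqr ger0_norm // divr_ge0 // rad_ge0.
  by rewrite !expr_div_n real_normK ?num_real // rad_sqr; field.
have ca : cos (atan (x.2 / x.1)) = `|x.1| / rad x by rewrite cos_atan rx invf_div.
have cn0 : cos (atan (x.2 / x.1)) != 0 by rewrite ca gt_eqF // divr_gt0 // normr_gt0.
have sa : sin (atan (x.2 / x.1)) = x.2 / x.1 * (`|x.1| / rad x).
  by rewrite -ca; move: (atanK (x.2 / x.1)) => /(congr1 (fun w => w * cos (atan (x.2 / x.1)))); rewrite {1}/tan divfK.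
rewrite /theta; case: ifP => h.
  rewrite addr0 sa ca (gtr0_norm h) [LHS]surjective_pairing; congr (_, _); field; rewrite ?x0 ?gt_eqF //.
have xn : x.1 < 0 by rewrite lt_neqAle x0 leNgt h.
rewrite cosDpi sinDpi sa ca (ltr0_norm xn) [LHS]surjective_pairing.
by congr (_, _); field; rewrite ?x0 ?gt_eqF.
Qed.

Lemma homE_theta del (p : R -> R) x : x.1 != 0 ->
  hom del (p \o red) x = rad x * (p \o red) (theta x - del * ln (rad x)).
Proof. by move=> x0; rewrite (homE _ _ (rad_gt0 x0) (theta_polar x0)). Qed.

Lemma red_theta del x : x.1 != 0 ->
  red (arg x - del * ln (rad x)) = red (theta x - del * ln (rad x)).
Proof.
move=> x0; have r0 := rad_gt0 x0.
have rn0 : rad x != 0 by rewrite gt_eqF.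
have /pair_equal_spec[e1 e2] : (rad x * cos (arg x), rad x * sin (arg x)) =
    (rad x * cos (theta x), rad x * sin (theta x)).
  by rewrite -polar -theta_polar.
have [k ->] := polar_unique (mulfI rn0 e1) (mulfI rn0 e2).
by rewrite addrAC red_periodic.
Qed.

Lemma is_derive_norm2 s (X Y : R -> R) a b :
  X s != 0 -> is_derive s 1 X a -> is_derive s 1 Y b ->
  is_derive s 1 (fun t => Num.sqrt (X t ^+ 2 + Y t ^+ 2))
    ((a * X s + b * Y s) / Num.sqrt (X s ^+ 2 + Y s ^+ 2)).
Proof.
move=> X0 dX dY.
have q0 : 0 < X s ^+ 2 + Y s ^+ 2.
  by rewrite ltr_wpDr ?sqr_ge0 // lt_neqAle sqr_ge0 andbT eq_sym sqrf_eq0.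
have dq : is_derive s 1 (fun t => X t ^+ 2 + Y t ^+ 2) (2 * (a * X s + b * Y s)).
  have -> : (fun t => X t ^+ 2 + Y t ^+ 2) = (fun t => X t * X t + Y t * Y t).
    by apply/funext => t; rewrite !expr2.
  by apply: (is_derive_eq (is_derive_add (is_derive_mul dX dX) (is_derive_mul dY dY))); ring.
have H := is_derive_comp (f := Num.sqrt) (g := fun t => X t ^+ 2 + Y t ^+ 2) (is_derive1_sqrt q0) dq.
by apply: (is_derive_eq H); field; rewrite gt_eqF // sqrtr_gt0.
Qed.

Lemma is_derive_spiral_angle del kap s (X Y : R -> R) a b :
  X s != 0 -> is_derive s 1 X a -> is_derive s 1 Y b ->
  is_derive s 1 (fun t => atan (Y t / X t) + kap - del * ln (Num.sqrt (X t ^+ 2 + Y t ^+ 2)))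
   ((b * X s - a * Y s - del * (a * X s + b * Y s)) / (X s ^+ 2 + Y s ^+ 2)).
Proof.
move=> X0 dX dY; have dr := is_derive_norm2 X0 dX dY.
have q0 : 0 < X s ^+ 2 + Y s ^+ 2.
  by rewrite ltr_wpDr ?sqr_ge0 // lt_neqAle sqr_ge0 andbT eq_sym sqrf_eq0.
set r := Num.sqrt (X s ^+ 2 + _) in dr.
have r0 : 0 < r by rewrite sqrtr_gt0.
have rr : r ^+ 2 = X s ^+ 2 + Y s ^+ 2 by rewrite sqr_sqrtr // ltW.
have dl : is_derive s 1 (fun t => ln (Num.sqrt (X t ^+ 2 + Y t ^+ 2))) ((a * X s + b * Y s) / r ^+ 2).
  apply: (is_derive_eq (is_derive_comp (f := @ln R) (g := fun t => Num.sqrt (X t ^+ 2 + Y t ^+ 2)) (is_derive1_ln r0) dr)).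
  by field; rewrite gt_eqF.
have dV : is_derive s 1 (fun t => Y t / X t) ((b * X s - a * Y s) / X s ^+ 2).
  by apply: (is_derive_eq (is_derive_mul dY (is_derive_inv X0 dX))); field.
have da : is_derive s 1 (fun t => atan (Y t / X t)) ((b * X s - a * Y s) / r ^+ 2).
  apply: (is_derive_eq (is_derive_comp (f := @atan R) (is_derive1_atan _) dV)).
  have -> : 1 + (Y s / X s) ^+ 2 = r ^+ 2 / X s ^+ 2 by rewrite rr; field.
  by field; rewrite X0 gt_eqF.
apply: (is_derive_eq (is_derive_sub (is_derive_add da (is_derive_cst kap s 1)) (is_derive_scale del dl))).
by rewrite -rr; field; rewrite gt_eqF.
Qed.

Lemma is_derive_polar del P s (X Y : R -> R) a b d :
  let r := Num.sqrt (X s ^+ 2 + Y s ^+ 2) in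
  X s != 0 -> is_derive s 1 X a -> is_derive s 1 Y b ->
  forall kap, is_derive (atan (Y s / X s) + kap - del * ln r) 1 P d ->
  is_derive s 1 (fun t => Num.sqrt (X t ^+ 2 + Y t ^+ 2) *
     P (atan (Y t / X t) + kap - del * ln (Num.sqrt (X t ^+ 2 + Y t ^+ 2))))
   ((a * X s + b * Y s) / r * (P (atan (Y s / X s) + kap - del * ln r) - del * d)
    + (b * X s - a * Y s) / r * d).
Proof.
move=> r X0 dX dY kap dP.
have q0 : 0 < X s ^+ 2 + Y s ^+ 2.
  by rewrite ltr_wpDr ?sqr_ge0 // lt_neqAle sqr_ge0 andbT eq_sym sqrf_eq0.
have r0 : 0 < r by rewrite sqrtr_gt0.
have rr : r ^+ 2 = X s ^+ 2 + Y s ^+ 2 by rewrite sqr_sqrtr // ltW.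
have dPS := is_derive_comp (f := P)
  (g := fun t => atan (Y t / X t) + kap - del * ln (Num.sqrt (X t ^+ 2 + Y t ^+ 2))) dP
  (is_derive_spiral_angle del kap X0 dX dY).
apply: (is_derive_eq (is_derive_mul (is_derive_norm2 X0 dX dY) dPS)).
by rewrite -/r -rr; field; rewrite gt_eqF.
Qed.

(** In the polar frame the gradient of [r * p(s)] has radial component [p - del * p'] and angular
    component [p']. *)
Lemma is_derive_hom del (p : R -> R) x d : x.1 != 0 ->
  0 < red (arg x - del * ln (rad x)) -> is_derive (red (arg x - del * ln (rad x))) 1 p d ->
  let P := p (red (arg x - del * ln (rad x))) in
  is_derive x (1, 0) (hom del (p \o red)) (x.1 / rad x * (P - del * d) - x.2 / rad x * d) /\
  is_derive x (0, 1) (hom del (p \o red)) (x.2 / rad x * (P - del * d) + x.1 / rad x * d).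
Proof.
move=> x0; rewrite red_theta // => r0 pd P.
have DP := is_derive_red r0 pd.
pose kap : R := if 0 < x.1 then 0 else pi.
have HX : is_derive x.1 1 (fun t : R => t) 1 := is_derive_id x.1 1.
have HY : is_derive x.2 1 (fun t : R => t) 1 := is_derive_id x.2 1.
have sgn : \forall t \near x.1, t != 0 /\ (0 < t) = (0 < x.1).
  have [h|h|h] := ltgtP x.1 0; last by rewrite h eqxx in x0.
    near=> t; have t0 : t < 0 by near: t; exact: lt_nbhsl.
    by rewrite lt_eqF // ltNge (ltW t0).
  near=> t; have t0 : 0 < t by near: t; exact: lt_nbhsr.
  by rewrite gt_eqF.
split.
- apply/is_derive_fst.
  have H := @is_derive_polar del (p \o red) x.1 (fun t => t) (fun=> x.2) 1 0 d x0 HX (is_derive_cst x.2 x.1 1) kap DP.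
  have H' := is_derive_eq H (_ : _ = x.1 / rad x * (P - del * d) - x.2 / rad x * d).
  apply: near_eq_is_derive (H' _).
    near=> t; have [t0 ts] : t != 0 /\ (0 < t) = (0 < x.1) by near: t; exact: sgn.
    by rewrite (@homE_theta _ _ (t, x.2)) // /theta /= ts.
  by rewrite /P /= -[Num.sqrt _]/(rad x) -/kap -/(theta x); ring.
- apply/is_derive_snd.
  have H := @is_derive_polar del (p \o red) x.2 (fun=> x.1) (fun t => t) 0 1 d x0 (is_derive_cst x.1 x.2 1) HY kap DP.
  have H' := is_derive_eq H (_ : _ = x.2 / rad x * (P - del * d) + x.1 / rad x * d).
  apply: near_eq_is_derive (H' _).
    by near=> t; rewrite (@homE_theta _ _ (x.1, t)).
  by rewrite /P /= -[Num.sqrt _]/(rad x) -/kap -/(theta x); ring.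
Unshelve. all: by end_near.
Qed.

End HomogeneousDeriv.

(** * The boundary spirals have measure zero *)

Section SpiralNull.
Context {R : realType}.
Local Notation plane := (measurableTypeR R * measurableTypeR R)%type.
Local Notation mu := (@leb2 R).
Implicit Types (s t del c : R) (x y : R * R) (k : int).

(** There is at most one element on each side of [m]. *)
Lemma separated_countable (A : set R) (m : R) :
  (forall s t, A s -> A t -> s < t -> s < m < t) -> countable A.
Proof.
move=> H; pose B := [set xget m (A `&` [set t | t <= m])] `|` [set xget m (A `&` [set t | m < t])].
have AB : A `<=` B.
  move=> t At; have [tm|tm] := leP t m; [left|right].
    have [Ax xm] : (A `&` [set t | t <= m]) (xget m (A `&` [set t | t <= m])).
      by apply: xgetPex; exists t.
    have [h|h|h] := ltgtP t (xget m (A `&` [set t | t <= m])); last by [].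
    + by have := H _ _ At Ax h; rewrite ltNge [_ < _]ltNge xm andbF.
    + by have := H _ _ Ax At h; rewrite [m < t]ltNge tm andbF.
  have [Ax xm] : (A `&` [set t | m < t]) (xget m (A `&` [set t | m < t])).
    by apply: xgetPex; exists t.
  have [h|h|h] := ltgtP t (xget m (A `&` [set t | m < t])); last by [].
  + by have := H _ _ At Ax h; rewrite ltNge (ltW tm).
  + by have := H _ _ Ax At h; rewrite ltNge (ltW xm).
apply: finite_set_countable; apply: sub_finite_set AB _.
by rewrite finite_setU; split; exact: finite_set1.
Qed.

(** Along a vertical line the spiral angle has derivative [(x1 - del * t) / (x1^2 + t^2)], which
    vanishes only at [t = x1 / del]. By Rolle this point separates any two solutions. *)
Lemma spiral_section_countable del c (x1 : R) : del != 0 -> x1 != 0 ->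
  countable [set t : R | theta (x1, t) - del * ln (rad (x1, t)) = c].
Proof.
move=> del0 x10; apply: (@separated_countable _ (x1 / del)) => s t /= As At st.
pose kap : R := if 0 < x1 then 0 else pi.
pose f t := atan (t / x1) + kap - del * ln (Num.sqrt (x1 ^+ 2 + t ^+ 2)).
have df (u : R) : is_derive u 1 f ((x1 - del * u) / (x1 ^+ 2 + u ^+ 2)).
  apply: (is_derive_eq (@is_derive_spiral_angle R del kap u (fun=> x1) (fun t => t) 0 1 x10
    (is_derive_cst x1 u 1) (is_derive_id u 1))).
  by congr (_ / _); ring.
have cf : {within `[s, t], continuous f}.
  by apply: derivable_within_continuous => w wst; have [] := df w.
have [v + E] := MVT st (fun u _ => df u) cf.
move: E; rewrite (_ : f t = c) // (_ : f s = c) // subrr => /esym/eqP.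
have q0 : x1 ^+ 2 + v ^+ 2 != 0.
  by rewrite gt_eqF // ltr_wpDr ?sqr_ge0 // lt_neqAle sqr_ge0 andbT eq_sym sqrf_eq0.
rewrite !mulf_eq0 invr_eq0 (negPf q0) orbF subr_eq0 (gt_eqF (_ : 0 < t - s)) ?subr_gt0 // orbF => /eqP ->.
by rewrite in_itv /= mulrC mulKf.
Qed.

(** The profile is periodic and vanishes exactly at the angles congruent to [c], so off the origin
    the spiral is the zero set of a Lipschitz function; this gives its measurability. *)
Lemma lip_spiral_defect del c : exists K, lip K (hom del ((fun t => cos (t - c) - 1) \o red) : R * R -> R).
Proof.
apply: (@hom_lip _ _ _ 1 2).
- have -> : 2 * pi - c = - c + pi *+ 2 by rewrite mulr2n; ring.
  by rewrite sub0r cosD2pi.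
- move=> s t s0 st t2.
  have D (u : R) : is_derive u 1 (fun t => cos (t - c) - 1) (- sin (u - c)).
    have D1 : is_derive u 1 (fun t : R => t - c) (1 - 0).
      exact: is_derive_sub (is_derive_id u 1) (is_derive_cst c u 1).
    have D2 := is_derive_comp (f := @cos R) (g := fun t => t - c) (is_derive_cos _) D1.
    apply: (is_derive_eq (is_derive_sub (g := fun=> 1) D2 (is_derive_cst (1 : R) u 1))).
    by rewrite !subr0 mulr1.
  apply: (MVT_bound st (fun u _ => D u)) => u _.
  by rewrite normrN; exact: sin_max.
- move=> t _; rewrite (le_trans (ler_normB _ _)) // normr1.
  by have := cos_max (t - c); lra.
Qed.

(* The spiral of reduced angle [c] is contained in the zero set of a Lipschitz
   function, whose vertical sections off the axis are countable. *)
Lemma spiral_negligible del c : del != 0 ->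
  mu.-negligible [set x : plane | x.1 != 0 /\ red (arg x - del * ln (rad x)) = c].
Proof.
move=> del0; set q := fun t : R => cos (t - c) - 1.
have [K lK] := lip_spiral_defect del c; rewrite -/q in lK.
have mh : measurable_fun setT (hom del (q \o red) : plane -> R) by exact: lip_measurable lK.
have m0 : measurable [set x : plane | x.1 != 0].
  have -> : [set x : plane | x.1 != 0] = ~` ([set 0 : measurableTypeR R] `*` setT).
    apply/seteqP; split => x /=; first by move=> /eqP H [] .
    by move=> H; apply/eqP => e; apply: H; split.
  by apply: measurableC; apply: measurableX => //; exact: measurable_set1.
pose Z : set plane := [set x : plane | x.1 != 0] `&` (hom del (q \o red) @^-1` [set 0]).
have mZ : measurable Z.
  apply: measurableI => //; rewrite -[X in measurable X]setTI; by apply: mh; [exact: measurableT|exact: measurable_set1].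
exists Z; split => //; last first.
  move=> x [x0 xc]; split => //=; rewrite /hom /= xc /q subrr cos0 subrr mulr0 //.
rewrite /leb2 /= /product_measure1; apply: integral0_eq => x1 _ /=.
have [->|x10] := eqVneq x1 0.
  rewrite (_ : xsection Z 0 = set0) ?measure0 // -subset0 => t; rewrite xsectionE /= => -[/=].
  by rewrite eqxx.
apply: countable_lebesgue_measure0.
have sub : xsection Z x1 `<=` \bigcup_k [set t : R | theta (x1, t) - del * ln (rad (x1, t)) = c + 2 * pi * k%:~R].
  move=> t; rewrite xsectionE /= => -[/= _].
  rewrite homE_theta // => /eqP; rewrite mulf_eq0 gt_eqF ?rad_gt0 //= /q subr_eq0 => /eqP.
  set S := theta _ - _ => cS.
  have r0 : red (red S - c) = 0 by apply: cos_eq1; [exact: red_itv|rewrite cos_red].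
  have [k E] := red_exists (red S - c); rewrite r0 in E.
  have [k' E'] := red_exists S.
  by exists (k + k') => //=; rewrite -/S E' intrD; lra.
apply: sub_countable (bigcup_countable _ _); first exact: subset_card_le sub.
- exact: countableP.
- by move=> k _; exact: spiral_section_countable.
Qed.

Lemma axis_negligible : mu.-negligible [set x : plane | x.1 = 0].
Proof.
have E : [set x : plane | x.1 = 0] = [set 0 : measurableTypeR R] `*` setT.
  by apply/seteqP; split => x //= [].
have m1 : measurable [set 0 : measurableTypeR R] by exact: measurable_set1.
rewrite E; apply/negligibleP; first by apply: measurableX.
by rewrite [LHS](leb2_setX m1 measurableT) lebesgue_measure_set1 mul0e.
Qed.

Lemma ae_generic del c : del != 0 ->
  {ae mu, forall x : plane, [/\ x.1 != 0, red (arg x - del * ln (rad x)) != 0 &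
     red (arg x - del * ln (rad x)) != c]}.
Proof.
move=> del0.
have N := negligibleU axis_negligible (negligibleU (spiral_negligible 0 del0) (spiral_negligible c del0)).
apply: negligibleS N => x /= H; have [e|e] := eqVneq x.1 0; [by left|right].
have [e0|e0] := eqVneq (red (arg x - del * ln (rad x))) 0; [by left|right].
by split=> //; have [//|ec] := eqVneq (red (arg x - del * ln (rad x))) c; case: H.
Qed.

End SpiralNull.

(** * The spiral minimizer *)

Section SpiralProfile.
Context {R : realType}.
Variable del : R.
Hypotheses (del0 : 0 < del) (del1 : del <= 1 / 100).
Implicit Types (s t : R).

Let pi0 : 0 < @pi R. Proof. exact: pi_gt0. Qed.
Let pi4 : @pi R < 4. Proof. by have h := @pihalf_lt2 R; lra. Qed.
Let pi2 : 2 <= @pi R. Proof. exact: pi_ge2. Qed.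

(* The power [z ^ (ca - i cb)] maps the spiral domain
   [0 < arg z - del * ln |z| < ell] onto the upper half plane. *)
Definition ca : R := (1 + del ^+ 2)^-1.
Definition cb : R := del * ca.
Definition ell : R := pi * (1 + del ^+ 2).
(** The ratio [ell / (2 * pi - ell)] of the openings of the spiral domain and of its complement, by
    which the reflection stretches angles. *)
Definition ctau : R := (1 + del ^+ 2) / (1 - del ^+ 2).

Let d2 : 0 < del ^+ 2. Proof. by rewrite exprn_gt0. Qed.
Let d2' : del ^+ 2 <= del / 100.
Proof.
rewrite expr2; apply: ler_wpM2l; first exact: ltW.
by apply: le_trans del1 _; rewrite mul1r.
Qed.
Local Ltac dlra := move: del0 del1 pi4 pi2 d2 d2' => ? ? ? ? ? ?; lra.

Let d2n0 : 1 + del ^+ 2 != 0. Proof. by rewrite gt_eqF //; dlra. Qed.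
Let d2n1 : 1 - del ^+ 2 != 0. Proof. by rewrite gt_eqF //; dlra. Qed.

Lemma ca_ell : ca * ell = pi.
Proof. by rewrite /ca /ell; field. Qed.

Lemma ca_cb1 : del * cb = 1 - ca. Proof. by rewrite /cb /ca; field. Qed.
Lemma ca_cb2 : del * ca = cb. Proof. by []. Qed.
Lemma ca_cb3 : ca ^+ 2 + cb ^+ 2 = ca. Proof. by rewrite /cb /ca; field. Qed.

Lemma ca_itv : 1 - del / 100 <= ca <= 1.
Proof.
have c0 : 0 < ca by rewrite invr_gt0; dlra.
have c1 : ca <= 1 by rewrite /ca invf_le1; dlra.
have := ca_cb1; rewrite /cb mulrA -expr2 => e.
have : del ^+ 2 * ca <= del ^+ 2 * 1 by rewrite ler_wpM2l // ltW.
by move=> h; apply/andP; split; dlra.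
Qed.

Lemma ctau_itv : 1 <= ctau <= 1 + del / 10.
Proof.
have n : 0 < 1 - del ^+ 2 by dlra.
rewrite /ctau ler_pdivlMr // ler_pdivrMr //; apply/andP; split; first by dlra.
have h : del * del ^+ 2 <= del * (1 / 100).
  by apply: ler_wpM2l; [exact: ltW|dlra].
by dlra.
Qed.

Lemma ell_itv : pi < ell < 2 * pi.
Proof.
have p2 : 0 < pi * del ^+ 2 by rewrite mulr_gt0.
have p3 : pi * del ^+ 2 <= pi * (1 / 2) by apply: ler_wpM2l; [exact: ltW|dlra].
by rewrite /ell mulrDr mulr1; apply/andP; split; dlra.
Qed.

Lemma ctau_ell : ctau * (2 * pi - ell) = ell.
Proof. by rewrite /ctau /ell; field. Qed.

(* the reflection of the complementary sector onto the positivity sector *)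
Definition tent t : R := if t <= ell then t else ctau * (2 * pi - t).

Lemma tent_itv t : 0 <= t <= 2 * pi -> 0 <= tent t <= ell.
Proof.
move=> /andP[t0 t1]; have /andP[c0 c1] := ctau_itv; have /andP[l0 l1] := ell_itv.
rewrite /tent; case: (leP t ell) => h; first by rewrite t0.
rewrite mulr_ge0 ?subr_ge0 //=; last by dlra.
by rewrite -ctau_ell ler_wpM2l //; dlra.
Qed.

Lemma tent_lip s t : s <= t -> `|tent t - tent s| <= 2 * (t - s).
Proof.
move=> st; have /andP[c0 c1] := ctau_itv; have /andP[l0 l1] := ell_itv.
have c2 : ctau <= 2 by dlra.
rewrite /tent; case: (leP t ell) => ht; case: (leP s ell) => hs.
- by rewrite ger0_norm; dlra.
- by dlra.
- have h : 0 <= ctau * (t - ell) <= 2 * (t - ell).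
    by rewrite mulr_ge0 ?subr_ge0 ?ler_wpM2r ?subr_ge0 //; dlra.
  have -> : ctau * (2 * pi - t) - s = (ell - s) - ctau * (t - ell) by have e := ctau_ell; dlra.
  by rewrite ler_norml; move: (ctau * (t - ell)) h => z /andP[z0 z1]; apply/andP; split; dlra.
- have -> : ctau * (2 * pi - t) - ctau * (2 * pi - s) = - (ctau * (t - s)) by ring.
  have h0 : 0 <= ctau * (t - s) by apply: mulr_ge0; dlra.
  by rewrite normrN ger0_norm //; apply: ler_wpM2r; dlra.
Qed.

Lemma expR_le1D2x (x : R) : 0 <= x <= 1 / 2 -> expR x <= 1 + 2 * x.
Proof.
move=> /andP[x0 x1]; have h := expR_ge1Dx (- x).
rewrite -[x]opprK expRN opprK -[leLHS]mul1r ler_pdivrMr ?expR_gt0 //.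
apply: (@le_trans _ _ ((1 + 2 * x) * (1 - x))); last by rewrite ler_wpM2l //; dlra.
have : 0 <= x * (1 - 2 * x) by rewrite mulr_ge0 //; dlra.
dlra.
Qed.

Definition expb s : R := expR (cb * s).

Lemma cb_ell : cb * ell = pi * del.
Proof. by rewrite -ca_cb2 -mulrA ca_ell mulrC. Qed.

Lemma cb_ge0 : 0 <= cb.
Proof. by rewrite mulr_ge0 ?invr_ge0 //; dlra. Qed.

Lemma expb_itv s : 0 <= s <= ell -> 1 <= expb s <= 1 + 8 * del.
Proof.
move=> /andP[s0 s1]; have c0 := cb_ge0.
have h1 : 0 <= cb * s by exact: mulr_ge0.
have h2 : cb * s <= 4 * del.
  apply: (@le_trans _ _ (cb * ell)); first exact: ler_wpM2l.
  by rewrite cb_ell ler_wpM2r // ltW.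
rewrite /expb; apply/andP; split; first by rewrite -expR0 ler_expR.
apply: le_trans (expR_le1D2x _) _; last by dlra.
by rewrite h1 /=; dlra.
Qed.

(** With [fQ], the imaginary and real parts of [exp ((cb + i ca) s)]: on the spiral domain the
    conformal power is [r] times this exponential. *)
Definition fW s : R := expb s * sin (ca * s).
Definition fQ s : R := expb s * cos (ca * s).

Lemma is_derive_expb s : is_derive s 1 expb (cb * expb s).
Proof.
have D : is_derive s 1 (fun t : R => cb * t) (cb * 1) by exact: is_derive_scale (is_derive_id s 1).
by apply: (is_derive_eq (is_derive_comp (f := @expR R) (g := fun t => cb * t) (is_derive_expR _) D)); rewrite mulr1 mulrC.
Qed.

Lemma is_derive_fW s : is_derive s 1 fW (cb * fW s + ca * fQ s).
Proof.
have D : is_derive s 1 (fun t : R => ca * t) (ca * 1) by exact: is_derive_scale (is_derive_id s 1).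
have D2 := is_derive_comp (f := @sin R) (g := fun t => ca * t) (is_derive_sin _) D.
by apply: (is_derive_eq (is_derive_mul (is_derive_expb s) D2)); rewrite /fW /fQ; ring.
Qed.

Lemma is_derive_fQ s : is_derive s 1 fQ (cb * fQ s - ca * fW s).
Proof.
have D : is_derive s 1 (fun t : R => ca * t) (ca * 1) by exact: is_derive_scale (is_derive_id s 1).
have D2 := is_derive_comp (f := @cos R) (g := fun t => ca * t) (is_derive_cos _) D.
by apply: (is_derive_eq (is_derive_mul (is_derive_expb s) D2)); rewrite /fW /fQ; ring.
Qed.

Lemma f_bounded s : 0 <= s <= ell -> `|fW s| <= 2 /\ `|fQ s| <= 2.
Proof.
move=> /expb_itv /andP[e0 e1].
by split; rewrite normrM -[leRHS]mulr1; apply: ler_pM; rewrite ?sin_max ?cos_max // ger0_norm; dlra.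
Qed.

Lemma f_lip s t : 0 <= s -> s <= t -> t <= ell ->
  `|fW t - fW s| <= 4 * (t - s) /\ `|fQ t - fQ s| <= 4 * (t - s).
Proof.
move=> s0 st t1; have c0 := cb_ge0; have /andP[a0 a1] := ca_itv.
have c1 : cb <= 1 by rewrite -ca_cb2 mulr_ile1 //; dlra.
have B (p q z w : R) : `|p| <= 2 -> `|q| <= 2 -> 0 <= z <= 1 -> 0 <= w <= 1 ->
    `|z * p + w * q| <= 4.
  move=> hp hq /andP[z0 z1] /andP[w0 w1]; rewrite (le_trans (ler_normD _ _)) // !normrM.
  rewrite (ger0_norm z0) (ger0_norm w0) (_ : 4 = 1 * 2 + 1 * 2); last by ring.
  by rewrite lerD // ler_pM.
have ic : 0 <= ca <= 1 by dlra.
have ib : 0 <= cb <= 1 by rewrite c0 c1.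
split.
- apply: (MVT_bound st (fun x _ => is_derive_fW x)) => x /andP[x0 x1].
  by have [] := @f_bounded x _; [dlra|move=> h1 h2; apply: B].
- apply: (MVT_bound st (fun x _ => is_derive_fQ x)) => x /andP[x0 x1].
  by have [] := @f_bounded x _; [dlra|move=> h1 h2; rewrite -mulrN; apply: B; rewrite ?normrN].
Qed.

End SpiralProfile.

(** * The conformal power and its reflection *)

Section SpiralFunctions.
Context {R : realType}.
Variable del : R.
Hypotheses (del0 : 0 < del) (del1 : del <= 1 / 100).
Implicit Types (s t : R) (x y : R * R).
Local Notation ca := (ca del).
Local Notation cb := (cb del).
Local Notation ell := (ell del).
Local Notation ctau := (ctau del).
Local Notation tent := (tent del).
Local Notation fW := (fW del).
Local Notation fQ := (fQ del).

Let ell_pi := ell_itv del0 del1.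
Let ca1 := ca_itv del0 del1.
Let del_n0 : del != 0. Proof. by rewrite gt_eqF. Qed.

Definition pW t : R := fW (tent t).
Definition pQ t : R := fQ (tent t).
Definition pU t : R := if t <= ell then pW t else 0.

Let tent_id t : t <= ell -> tent t = t. Proof. by rewrite /tent => ->. Qed.

Lemma fW0 : fW 0 = 0. Proof. by rewrite /fW mulr0 sin0 mulr0. Qed.
Lemma fW_ell : fW ell = 0.
Proof. by rewrite /fW (ca_ell del0 del1) sinpi mulr0. Qed.

Let tent0 : tent 0 = 0.
Proof. by apply: tent_id; move: ell_pi (@pi_ge2 R) => /andP[? ?] ?; lra. Qed.

Let tent2pi : tent (2 * pi) = 0.
Proof.
by rewrite /tent leNgt; move: ell_pi => /andP[_ ->] /=; rewrite subrr mulr0.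
Qed.

Lemma pWQ_lip s t : 0 <= s -> s <= t -> t <= 2 * pi ->
  `|pW t - pW s| <= 8 * (t - s) /\ `|pQ t - pQ s| <= 8 * (t - s).
Proof.
move=> s0 st t2; rewrite /pW /pQ.
have ts : 0 <= t <= 2 * pi by rewrite (le_trans s0 st) t2.
have ss : 0 <= s <= 2 * pi by rewrite s0 (le_trans st t2).
have /andP[a0 a1] := tent_itv del0 del1 ts; have /andP[b0 b1] := tent_itv del0 del1 ss.
have tl := tent_lip del0 del1 st.
have K : 4 * `|tent t - tent s| <= 8 * (t - s).
  by rewrite (_ : 8 * (t - s) = 4 * (2 * (t - s))) ?ler_wpM2l //; ring.
have [h|/ltW h] := leP (tent s) (tent t).
  have [f1 f2] := f_lip del0 del1 b0 h a1.
  by move: K; rewrite ger0_norm ?subr_ge0 // => K; split; [apply: le_trans f1 K|apply: le_trans f2 K].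
have [f1 f2] := f_lip del0 del1 a0 h b1.
by move: K; rewrite distrC ger0_norm ?subr_ge0 // => K; split; rewrite distrC; [apply: le_trans f1 K|apply: le_trans f2 K].
Qed.

Lemma pU_lip s t : 0 <= s -> s <= t -> t <= 2 * pi -> `|pU t - pU s| <= 8 * (t - s).
Proof.
move=> s0 st t2; rewrite /pU; have [te|te] := leP t ell.
  by rewrite (le_trans st te); have [] := pWQ_lip s0 st t2.
have [se|se] := leP s ell; last by rewrite subrr normr0 mulr_ge0 // subr_ge0.
rewrite -fW_ell -[in fW ell](tent_id (lexx ell)) -/(pW ell).
have [h _] := @pWQ_lip s ell s0 se (ltW (lt_le_trans te t2)).
by apply: le_trans h _; rewrite ler_wpM2l // lerD2r ltW.
Qed.

Lemma p_bounded t : 0 <= t < 2 * pi -> [/\ `|pW t| <= 2, `|pQ t| <= 2 & `|pU t| <= 2].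
Proof.
move=> /andP[t0 t1].
have tt : 0 <= t <= 2 * pi by rewrite t0 ltW.
have [h1 h2] := f_bounded del0 del1 (tent_itv del0 del1 tt).
by split => //; rewrite /pU; case: ifP => _ //; rewrite normr0.
Qed.

(* In the spiral domain [spW] and [spQ] are the imaginary and the real part of
   the power of [z]; they are extended by the reflection [tent], [spU] by 0. *)
Definition spW : R * R -> R := hom del (pW \o red).
Definition spQ : R * R -> R := hom del (pQ \o red).
Definition spU : R * R -> R := hom del (pU \o red).

Lemma spW_lip : exists L, lip L spW.
Proof.
apply: (@hom_lip _ _ _ 8 2); first by rewrite /pW tent0 tent2pi.
  by move=> s t h1 h2 h3; have [] := pWQ_lip h1 h2 h3.
by move=> t /p_bounded[].
Qed.

Lemma spQ_lip : exists L, lip L spQ.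
Proof.
apply: (@hom_lip _ _ _ 8 2); first by rewrite /pQ tent0 tent2pi.
  by move=> s t h1 h2 h3; have [] := pWQ_lip h1 h2 h3.
by move=> t /p_bounded[].
Qed.

Lemma spU_lip : exists L, lip L spU.
Proof.
apply: (@hom_lip _ _ _ 8 2).
- rewrite /pU /pW tent0 fW0 leNgt [in RHS]leNgt; move: ell_pi => /andP[_ ->] /=.
  by case: ifP.
- exact: pU_lip.
- by move=> t /p_bounded[].
Qed.

Definition sarg x : R := red (arg x - del * ln (rad x)).

Lemma sarg_itv x : 0 <= sarg x < 2 * pi. Proof. exact: red_itv. Qed.

Lemma pW_gt0 t : 0 < t < ell -> 0 < pW t.
Proof.
move=> /andP[t0 t1]; rewrite /pW tent_id ?ltW // /fW mulr_gt0 ?expR_gt0 //.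
have c0 : 0 < ca by move: ca1 del1 => /andP[? ?] ?; lra.
by apply: sin_gt0_pi; rewrite mulr_gt0 //= -(ca_ell del0 del1) ltr_pM2l.
Qed.

Lemma pU_ge0 t : 0 <= t -> 0 <= pU t.
Proof.
move=> t0; rewrite /pU; case: (leP t ell) => // te.
have [->|tn0] := eqVneq t 0; first by rewrite /pW tent0 fW0.
have [->|tne] := eqVneq t ell; first by rewrite /pW tent_id // fW_ell.
by apply/ltW/pW_gt0; rewrite !lt_neqAle eq_sym tn0 t0 tne te.
Qed.

Lemma pU_gt0 t : 0 <= t -> (0 < pU t) = (0 < t < ell).
Proof.
move=> t0; apply/idP/idP; last first.
  by move=> h; rewrite /pU; move: (h) => /andP[_ /ltW ->]; exact: pW_gt0.
rewrite /pU; case: (leP t ell); last by rewrite ltxx.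
move=> te h; apply/andP; split; rewrite lt_neqAle ?te ?t0 andbT; apply/eqP => E; move: h.
  by rewrite -E /pW tent0 fW0 ltxx.
by rewrite E /pW tent_id // fW_ell ltxx.
Qed.

Lemma spU_ge0 x : 0 <= spU x.
Proof.
rewrite /spU /hom mulr_ge0 ?rad_ge0 //; apply: pU_ge0.
by have /andP[] := sarg_itv x.
Qed.

Lemma spU_gt0 x : (0 < spU x) = (0 < rad x) && (0 < sarg x < ell).
Proof.
have /andP[s0 _] := sarg_itv x.
rewrite -(pU_gt0 s0) /spU /hom -/(sarg x) /=; have := rad_ge0 x; rewrite le_eqVlt => /orP[/eqP <-|r0].
  by rewrite mul0r ltxx.
by rewrite r0 pmulr_rgt0.
Qed.

(* the angular derivative of [spQ], divided by the radius *)
Definition dQ x : R := (if 0 < spU x then 1 else - ctau) * (cb * spQ x - ca * spW x) / rad x.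
Definition spQ1 x : R := x.1 / rad x * (spQ x / rad x - del * dQ x) - x.2 / rad x * dQ x.
Definition spQ2 x : R := x.2 / rad x * (spQ x / rad x - del * dQ x) + x.1 / rad x * dQ x.

Lemma is_derive_pQ t : t != ell ->
  is_derive t 1 pQ ((if t < ell then 1 else - ctau) * (cb * pQ t - ca * pW t)) /\
  is_derive t 1 pU (if t < ell then cb * pW t + ca * pQ t else 0).
Proof.
move=> tne; have [t1|t1|e] := ltgtP t ell; last by rewrite e eqxx in tne.
- have n : \forall s \near t, s <= ell by near=> s; apply: ltW; near: s; exact: lt_nbhsl.
  split.
    apply: (@near_eq_is_derive _ _ _ fQ).
      by near=> s; rewrite /pQ tent_id //; near: s; exact: n.
    apply: (is_derive_eq (is_derive_fQ del t)).
    by rewrite /pQ /pW tent_id ?ltW // mul1r.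
  apply: (@near_eq_is_derive _ _ _ fW).
    near=> s; have sl : s <= ell by near: s; exact: n.
    by rewrite /pU sl /pW tent_id.
  apply: (is_derive_eq (is_derive_fW del t)).
  by rewrite /pQ /pW tent_id ?ltW.
- have n : \forall s \near t, ell < s by exact: lt_nbhsr.
  split.
    have D : is_derive t 1 (fun s => ctau * (2 * pi - s)) (ctau * (0 - 1)).
      exact: is_derive_scale (is_derive_sub (is_derive_cst (2 * pi) t 1) (is_derive_id t 1)).
    apply: (@near_eq_is_derive _ _ _ (fun s => fQ (ctau * (2 * pi - s)))).
      by near=> s; rewrite /pQ /tent leNgt (_ : ell < s) //; near: s; exact: n.
    have D2 := is_derive_comp (f := fQ) (g := fun s => ctau * (2 * pi - s)) (is_derive_fQ del _) D.
    apply: (is_derive_eq D2); rewrite /pQ /pW /tent leNgt t1 /=; ring.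
  apply: (@near_eq_is_derive _ _ _ (cst 0)).
  by near=> s; rewrite /pU leNgt (_ : ell < s) //; near: s; exact: n.
Unshelve. all: by end_near.
Qed.

(** For [p = fW] and [q = fQ] this is a Cauchy-Riemann equation in polar form: the radial derivative
    of the imaginary part is minus the angular derivative of the real part. *)
Lemma cauchy_riemann1 (p q : R) : p - del * (cb * p + ca * q) = - (cb * q - ca * p).
Proof.
rewrite (_ : _ - _ = p - (del * cb) * p - (del * ca) * q); last by ring.
by rewrite (ca_cb1 del0 del1) ca_cb2; ring.
Qed.

(** The other polar equation: the angular derivative of the imaginary part is the radial derivative
    of the real part. *)
Lemma cauchy_riemann2 (p q : R) : cb * p + ca * q = q - del * (cb * q - ca * p).
Proof.
rewrite (_ : q - _ = q - (del * cb) * q + (del * ca) * p); last by ring.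
by rewrite (ca_cb1 del0 del1) ca_cb2; ring.
Qed.

(** The exceptional set consists of the vertical axis, where [theta] breaks down, the spiral of
    angle 0, where [red] jumps, and the spiral of angle [ell], where the profiles have a kink. *)
Lemma ae_derive_sp :
  [/\ ae_derive (1, 0) spQ spQ1, ae_derive (0, 1) spQ spQ2,
      ae_derive (1, 0) spU (fun x => if 0 < spU x then - spQ2 x else 0) &
      ae_derive (0, 1) spU (fun x => if 0 < spU x then spQ1 x else 0)].
Proof.
have main x : x.1 != 0 -> sarg x != 0 -> sarg x != ell ->
  [/\ is_derive x (1, 0) spQ (spQ1 x), is_derive x (0, 1) spQ (spQ2 x),
      is_derive x (1, 0) spU (if 0 < spU x then - spQ2 x else 0) &
      is_derive x (0, 1) spU (if 0 < spU x then spQ1 x else 0)].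
  move=> x0 s0 sl; have r0 := rad_gt0 x0; have rn0 : rad x != 0 by rewrite gt_eqF.
  have /andP[sge _] := sarg_itv x.
  have sgt : 0 < sarg x by rewrite lt_neqAle eq_sym s0.
  have [dQ' dU'] := is_derive_pQ sl.
  have [q1 q2] := is_derive_hom x0 sgt dQ'.
  have [u1 u2] := is_derive_hom x0 sgt dU'.
  have Up : (0 < spU x) = (sarg x < ell) by rewrite spU_gt0 r0 sgt.
  have hQ : spQ x / rad x = pQ (sarg x) by rewrite /spQ /hom /= -/(sarg x) mulrC mulKf.
  have hW : spW x / rad x = pW (sarg x) by rewrite /spW /hom /= -/(sarg x) mulrC mulKf.
  have hD : dQ x = (if sarg x < ell then 1 else - ctau) * (cb * pQ (sarg x) - ca * pW (sarg x)).
    by rewrite /dQ Up -hQ -hW; field.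
  split.
  - by apply: (is_derive_eq q1); rewrite /spQ1 hQ hD.
  - by apply: (is_derive_eq q2); rewrite /spQ2 hQ hD.
  - apply: (is_derive_eq u1); rewrite Up /spQ2 hQ hD -/(sarg x) /pU.
    case: (ltP (sarg x) ell) => h; last by rewrite leNgt lt_neqAle eq_sym sl h /=; ring.
    rewrite (ltW h) -/(pW _) cauchy_riemann1 cauchy_riemann2; ring.
  - apply: (is_derive_eq u2); rewrite Up /spQ1 hQ hD -/(sarg x) /pU.
    case: (ltP (sarg x) ell) => h; last by rewrite leNgt lt_neqAle eq_sym sl h /=; ring.
    rewrite (ltW h) -/(pW _) cauchy_riemann1 cauchy_riemann2; ring.
have G := ae_generic ell del_n0.
split; apply: filterS G => x [x0 s0 sl]; have [h1 h2 h3 h4] := main x x0 s0 sl;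
  [exact: h1|exact: h2|exact: h3|exact: h4].
Qed.

End SpiralFunctions.

(** * Gradient bounds, the weight and minimality *)

Section SpiralMinimizer.
Context {R : realType}.
Local Notation plane := (measurableTypeR R * measurableTypeR R)%type.
Variable del : R.
Hypotheses (del0 : 0 < del) (del1 : del <= 1 / 100).
Implicit Types (s t : R) (x y : R * R).
Local Notation ca := (ca del).
Local Notation cb := (cb del).
Local Notation ctau := (ctau del).
Local Notation tent := (tent del).
Local Notation spW := (spW del).
Local Notation spQ := (spQ del).
Local Notation spU := (spU del).
Local Notation spQ1 := (spQ1 del).
Local Notation spQ2 := (spQ2 del).
Local Notation sarg := (sarg del).

Definition expo x : R := expb del (tent (sarg x)).

Lemma expo_itv x : 1 <= expo x <= 1 + 8 * del.
Proof.
apply: expb_itv => //; apply: tent_itv => //.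
by have /andP[-> /ltW ->] := sarg_itv del x.
Qed.

(** The polar frame is orthonormal, so the squares of the radial component [expo x * (c - del * al)]
    and of the angular one [expo x * al] add up. *)
Lemma grad_norm x : rad x != 0 ->
  let m := if 0 < spU x then 1 else - ctau in
  let c := cos (ca * tent (sarg x)) in let s := sin (ca * tent (sarg x)) in
  let al := m * (cb * c - ca * s) in
  spQ1 x ^+ 2 + spQ2 x ^+ 2 = expo x ^+ 2 * ((c - del * al) ^+ 2 + al ^+ 2).
Proof.
move=> rn0 m c s al.
have hQ : spQ x / rad x = expo x * c by rewrite /spQ /hom /= -/(sarg x) mulrC mulKf.
have hW : spW x / rad x = expo x * s by rewrite /spW /hom /= -/(sarg x) mulrC mulKf.
have hD : dQ del x = expo x * al.
  rewrite (_ : dQ del x = m * (cb * (spQ x / rad x) - ca * (spW x / rad x))); last first.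
    by rewrite /dQ -/m; field.
  by rewrite hQ hW /al; ring.
rewrite /spQ1 /spQ2 hQ hD.
have r2 := rad_sqr x.
transitivity ((x.1 ^+ 2 + x.2 ^+ 2) / rad x ^+ 2 * (expo x ^+ 2 * ((c - del * al) ^+ 2 + al ^+ 2))).
  by field.
by rewrite -r2 divff ?mul1r // expf_neq0.
Qed.

(** The derivative of [z^(a - i b)] has modulus [|a - i b| exp (b s)], and [|a - i b|^2 = a]. *)
Lemma grad_norm_pos x : 0 < spU x -> spQ1 x ^+ 2 + spQ2 x ^+ 2 = ca * expo x ^+ 2.
Proof.
move=> ux; have := ux; rewrite spU_gt0 // => /andP[r0 _].
rewrite grad_norm ?gt_eqF // ux mul1r.
move: (cos _) (sin _) (cos2Dsin2 (ca * tent (sarg x))) => c s cs.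
have -> : c - del * (cb * c - ca * s) = ca * c + cb * s.
  by rewrite -(cauchy_riemann2 del0 del1); ring.
rewrite mulrC; congr (_ * _).
transitivity ((ca ^+ 2 + cb ^+ 2) * (c ^+ 2 + s ^+ 2)); first by ring.
by rewrite cs (ca_cb3 del0 del1) mulr1.
Qed.

(** In the complement the stretching by [ctau] perturbs the gradient by O([del]). The trigonometric
    factor is at most [1 + 9 * del], the squared exponential at most [1 + 17 * del], and
    [del <= 1 / 100] keeps their product below the bound. *)
Lemma grad_norm_le x : spQ1 x ^+ 2 + spQ2 x ^+ 2 <= 1 + 30 * del.
Proof.
(* At the origin both components are 0, by the convention on the inverse of 0. *)
have [r0|rn0] := eqVneq (rad x) 0.
  rewrite /spQ1 /spQ2 r0 invr0 !mulr0 !mul0r subr0 addr0 expr0n /= addr0.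
  by move: del0 => ?; lra.
rewrite grad_norm //; set m := if _ then _ else _.
have mb : `|m| <= 1 + del / 10.
  have /andP[c1 c2] := ctau_itv del0 del1; move: del0 => d0.
  rewrite /m; case: ifP => _; first by rewrite normr1; lra.
  by rewrite normrN ger0_norm //; lra.
have /andP[e1 e2] := expo_itv x.
set c := cos _; set s := sin _.
have cs : c ^+ 2 + s ^+ 2 = 1 by exact: cos2Dsin2.
have c1 : `|c| <= 1 by exact: cos_max.
have s1 : `|s| <= 1 by exact: sin_max.
have /andP[a0 a1] := ca_itv del0 del1; have b0 := cb_ge0 del0 del1.
have b1 : cb <= del by rewrite -ca_cb2 ler_piMr // ltW.
move: del0 del1 => d0 d1.
pose al0 := cb * c - ca * s.
have al1 : `|al0| <= 1 + del.
  have h1 : `|cb * c| <= del * 1 by rewrite normrM (ger0_norm b0) ler_pM.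
  have h2 : `|ca * s| <= 1 * 1 by rewrite normrM (@ger0_norm _ ca) ?ler_pM //; lra.
  by apply: le_trans (ler_normB _ _) _; apply: le_trans (lerD h1 h2) _; lra.
have al2 : al0 ^+ 2 <= s ^+ 2 + 3 * del.
  have h1 : ca ^+ 2 * s ^+ 2 <= s ^+ 2.
    by rewrite ler_piMl ?sqr_ge0 // expr_le1 //; lra.
  have h2 : cb ^+ 2 * c ^+ 2 <= del * 1.
    apply: ler_pM; rewrite ?sqr_ge0 //; last first.
      by rewrite -real_normK ?num_real // expr_le1.
    rewrite expr2 -[leRHS]mulr1; apply: ler_pM => //; lra.
  have h3 : - (2 * (cb * c) * (ca * s)) <= 2 * del.
    apply: le_trans (ler_norm _) _; rewrite normrN -mulrA normrM ger0_norm //.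
    rewrite ler_pM2l // normrM -[leRHS]mulr1; apply: ler_pM => //.
      by rewrite normrM -[leRHS]mulr1; apply: ler_pM => //; rewrite ger0_norm.
    by rewrite normrM -[leRHS]mulr1; apply: ler_pM => //; rewrite ger0_norm; lra.
  rewrite (_ : al0 ^+ 2 = cb ^+ 2 * c ^+ 2 + ca ^+ 2 * s ^+ 2 - 2 * (cb * c) * (ca * s)); last by rewrite /al0; ring.
  lra.
rewrite -/al0.
have ma : `|m * al0| <= 2.
  rewrite normrM; apply: (@le_trans _ _ ((1 + del / 10) * (1 + del))); first exact: ler_pM.
  have : del * del <= del * 1 by apply: ler_wpM2l; lra.
  lra.
have ma2 : (m * al0) ^+ 2 <= (1 + del) * (s ^+ 2 + 3 * del).
  rewrite exprMn; apply: ler_pM; rewrite ?sqr_ge0 //.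
  rewrite -real_normK ?num_real //.
  apply: (@le_trans _ _ ((1 + del / 10) ^+ 2)); first by rewrite lerXn2r // nnegrE //; lra.
  have : del * del <= del * 1 by apply: ler_wpM2l; lra.
  rewrite !expr2; lra.
have cma : - (2 * del * (c * (m * al0))) <= 4 * del.
  apply: le_trans (ler_norm _) _; rewrite normrN normrM ger0_norm; last by lra.
  rewrite (_ : 4 * del = 2 * del * (1 * 2)); last by ring.
  apply: ler_wpM2l; first by lra.
  by rewrite normrM; apply: ler_pM.
move: (m * al0) ma ma2 cma => z ma ma2 cma.
have s2 : s ^+ 2 <= 1 by rewrite -real_normK ?num_real // expr_le1.
have dd : del * del <= del * (1 / 100) by apply: ler_wpM2l; lra.
have tot : (c - del * z) ^+ 2 + z ^+ 2 <= 1 + 9 * del.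
  have dma : (del * z) ^+ 2 <= del * del * 4.
    rewrite exprMn; apply: ler_pM; rewrite ?sqr_ge0 // ?expr2 // -expr2.
    by rewrite -real_normK ?num_real // (_ : 4 = 2 ^+ 2 :> R) ?lerXn2r ?nnegrE //; ring.
  have ds : del * s ^+ 2 <= del * 1 by apply: ler_wpM2l; [lra|exact: s2].
  rewrite (_ : (c - _) ^+ 2 = c ^+ 2 - 2 * del * (c * z) + (del * z) ^+ 2); last by ring.
  move: ma2; rewrite mulrDl mul1r mulrDr => ma2.
  have d3 : del * (3 * del) <= 3 * del * (1 / 100) by lra.
  lra.
have e3 : expo x ^+ 2 <= 1 + 17 * del.
  apply: (@le_trans _ _ ((1 + 8 * del) ^+ 2)); first by rewrite lerXn2r // nnegrE; lra.
  rewrite expr2; lra.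
apply: (@le_trans _ _ ((1 + 17 * del) * (1 + 9 * del))).
  by apply: ler_pM; rewrite ?sqr_ge0 ?addr_ge0 ?sqr_ge0.
lra.
Qed.

Lemma measurable_rad_inv : measurable_fun setT (fun x : plane => (rad x)^-1).
Proof.
have -> : (fun x : plane => (rad x)^-1) = (fun x : plane => rad x `^ (-1)).
  by apply/funext => x; rewrite powR_inv1 // rad_ge0.
apply: (measurableT_comp (f := fun r : R => r `^ (-1))); first exact: measurable_powR.
apply: (@lip_measurable _ 1) => x y; rewrite mul1r; exact: rad_lip.
Qed.

Lemma measurable_sp : [/\ measurable_fun setT (spU : plane -> R),
  measurable_fun setT (spQ1 : plane -> R) & measurable_fun setT (spQ2 : plane -> R)].
Proof.
have [Lu lu] := spU_lip del0 del1; have [Lq lq] := spQ_lip del0 del1.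
have [Lw lw] := spW_lip del0 del1.
have mu_ : measurable_fun setT (spU : plane -> R) := lip_measurable lu.
have mq : measurable_fun setT (spQ : plane -> R) := lip_measurable lq.
have mw : measurable_fun setT (spW : plane -> R) := lip_measurable lw.
have mr := measurable_rad_inv.
have m1 : measurable_fun setT (fun x : plane => x.1 : R) by exact: measurable_fst.
have m2 : measurable_fun setT (fun x : plane => x.2 : R) by exact: measurable_snd.
have md : measurable_fun setT (dQ del : plane -> R).
  apply: measurable_funM => //; apply: measurable_funM.
    by apply: measurable_fun_pos_if => //; exact: measurable_cst.
  by apply: measurable_funB; apply: measurable_funM.
split => //.
- by apply: measurable_funB; apply: measurable_funM => //; try (exact: measurable_funM);
    apply: measurable_funB; apply: measurable_funM.
- by apply: measurable_funD; apply: measurable_funM => //; try (exact: measurable_funM);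
    apply: measurable_funB; apply: measurable_funM.
Qed.

(** On the positivity set this value gives equality in the calibration; elsewhere the constant of
    [grad_norm_le] dominates the squared calibrating field. *)
Definition weight x : R := if 0 < spU x then spQ1 x ^+ 2 + spQ2 x ^+ 2 else 1 + 30 * del.

Lemma measurable_weight : measurable_fun setT (weight : plane -> R).
Proof.
have [m0 m1 m2] := measurable_sp.
apply: measurable_fun_pos_if => //.
by apply: measurable_funD; exact: measurable_funX.
Qed.

Lemma weight_itv x : 1 - 30 * del <= weight x <= 1 + 30 * del.
Proof.
rewrite /weight; move: del0 => d0; case: ifP => ux; last by apply/andP; split; lra.
rewrite grad_norm_le andbT grad_norm_pos //.
have /andP[a0 a1] := ca_itv del0 del1; have /andP[e0 e1] := expo_itv x.
have e2 : 1 <= expo x ^+ 2 by rewrite exprn_ege1.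
have : ca * 1 <= ca * expo x ^+ 2 by apply: ler_wpM2l => //; move: del1 => ?; lra.
lra.
Qed.

Theorem spiral_minimizer : minimizer weight spU.
Proof.
have [Lu lu] := spU_lip del0 del1; have [Lq lq] := spQ_lip del0 del1.
have [m0 m1 m2] := measurable_sp.
have [d1 d2 d3 d4] := ae_derive_sp del0 del1.
move: (del0) (del1) => e0 e1.
have B x : `|spQ1 x| <= 2 /\ `|spQ2 x| <= 2.
  have h := grad_norm_le x; have s1 := sqr_ge0 (spQ1 x); have s2 := sqr_ge0 (spQ2 x).
  have sq (t : R) : t ^+ 2 <= 4 -> `|t| <= 2.
    move=> t4; rewrite -ler_sqr ?nnegrE // real_normK ?num_real // (_ : 2 ^+ 2 = 4) //; ring.
  by split; apply: sq; lra.
apply: (@calibrated_minimizer _ spU spQ spQ1 spQ2 weight Lu Lq 2) => //.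
- exact: measurable_weight.
- by move=> x; have [] := B x.
- by move=> x; have [] := B x.
- move=> x; have /andP[w0 w1] := weight_itv x; rewrite ger0_norm; lra.
- by move=> x; exact: spU_ge0.
- by move=> x; rewrite /weight; case: ifP => // _; exact: grad_norm_le.
- by move=> x ux; rewrite /weight ux.
Qed.

End SpiralMinimizer.

(** * Closeness to the half-plane solution *)

Section SpiralFlat.
Context {R : realType}.
Variable del : R.
Hypotheses (del0 : 0 < del) (del1 : del <= 1 / 100).
Implicit Types (s t : R) (x y : R * R).
Local Notation ca := (ca del).
Local Notation ell := (ell del).
Local Notation spU := (spU del).
Local Notation sarg := (sarg del).

Lemma sin_lip s t : `|sin t - sin s| <= `|t - s|.
Proof.
have main (a b : R) : a <= b -> `|sin b - sin a| <= b - a.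
  move=> ab; rewrite -[leRHS]mul1r.
  apply: (MVT_bound ab (fun u _ => is_derive_sin u)) => u _.
  exact: cos_max.
have [st|/ltW ts] := leP s t; first by rewrite [leRHS]ger0_norm ?subr_ge0 // main.
by rewrite distrC [leRHS]distrC [leRHS]ger0_norm ?subr_ge0 // main.
Qed.

(** The bound comes from [- ln r = ln (1/r) <= 1/r - 1]. *)
Lemma mul_ln_itv (r : R) : 0 < r <= 1 -> `|r * ln r| <= 1.
Proof.
move=> /andP[r0 r1].
have l0 : ln r <= 0 by rewrite ln_le0.
have h : - ln r <= r^-1 - 1.
  have i0 : 0 < r^-1 by rewrite invr_gt0.
  rewrite -lnV ?posrE // -[in leLHS](subrK 1 r^-1) addrC; apply: le_ln1Dx; lra.
rewrite normrM gtr0_norm // ler0_norm //.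
have : r * - ln r <= r * (r^-1 - 1) by rewrite ler_wpM2l // ltW.
rewrite mulrBr divff ?gt_eqF //; lra.
Qed.

(** In the disc the spiral twist costs at most [del * r * |ln r| <= del], replacing [ca * s] by [s]
    costs another [del], and the factor [expb] adds at most [8 * del]. *)
Lemma sp_flat x : B1 x -> x.2 - 2 * del <= spU x <= Num.max (x.2 + 10 * del) 0.
Proof.
rewrite /B1 /= -rad_sqr => xB; have r0 := rad_ge0 x.
have r1 : rad x <= 1.
  by rewrite -(@ler_pXn2r _ 2) ?nnegrE // expr1n ltW.
set r := rad x in r0 r1 *; set s := sarg x.
have /andP[s0 s1] : 0 <= s < 2 * pi := sarg_itv del x.
have pi4 : @pi R < 4 by have h := @pihalf_lt2 R; lra.
have /andP[a0 a1] := ca_itv del0 del1; have /andP[l0 l1] := ell_itv del0 del1.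
move: (del0) (del1) => d0 d1.
have E1 : `|sin (ca * s) - sin s| <= del.
  apply: le_trans (sin_lip _ _) _; rewrite distrC -[X in X - _]mul1r -mulrBl normrM.
  rewrite (ger0_norm s0) ger0_norm ?subr_ge0 //.
  have : (1 - ca) * s <= (del / 100) * 8 by apply: ler_pM; lra.
  lra.
have E2 : `|r * (sin s - sin (arg x))| <= del.
  have [->|rn0] := eqVneq r 0; first by rewrite mul0r normr0 ltW.
  have rp : 0 < r by rewrite lt_neqAle eq_sym rn0.
  rewrite /s /sarg sin_red -/r.
  have h := sin_lip (arg x) (arg x - del * ln r).
  rewrite addrAC subrr sub0r normrN in h.
  rewrite normrM (gtr0_norm rp).
  apply: le_trans (ler_wpM2l r0 h) _.
  have L : `|r * ln r| <= 1 by rewrite mul_ln_itv // rp.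
  rewrite -[X in X * _](gtr0_norm rp) -normrM mulrCA normrM gtr0_norm //.
  by rewrite -[leRHS]mulr1 ler_wpM2l // ltW.
have E3 : `|r * sin (ca * s) - x.2| <= 2 * del.
  rewrite [x in x.2]polar /= -/r.
  rewrite (_ : _ - _ = r * (sin (ca * s) - sin s) + r * (sin s - sin (arg x))); last by ring.
  apply: le_trans (ler_normD _ _) _; rewrite (_ : 2 * del = del + del); last by ring.
  rewrite lerD // normrM (ger0_norm r0) -[leRHS]mul1r ler_pM //.
move: E3; rewrite ler_norml => /andP[F1 F2].
have -> : spU x = r * pU del s by [].
rewrite /pU; case: (leP s ell) => sl.
  have /andP[b0 b1] := expb_itv del0 del1 (introT andP (conj s0 sl)).
  rewrite /pW /tent sl /fW mulrCA.
  have w0 : 0 <= sin (ca * s).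
    apply: sin_ge0_pi; rewrite mulr_ge0 //=; last by lra.
    by rewrite -(ca_ell del0 del1) ler_wpM2l //; lra.
  have A0 : 0 <= r * sin (ca * s) by apply: mulr_ge0.
  have A1 : r * sin (ca * s) <= 1 * 1.
    by apply: ler_pM => //; rewrite (le_trans (ler_norm _)) // sin_max.
  move: (r * sin _) A0 A1 F1 F2 => A A0 A1 F1 F2.
  have G1 : 1 * A <= expb del s * A by apply: ler_wpM2r.
  have G2 : (expb del s - 1) * A <= (8 * del) * 1 by apply: ler_pM; lra.
  apply/andP; split; first lra.
  by rewrite le_max; apply/orP; left; lra.
rewrite mulr0 le_max lexx orbT andbT.
(* Outside the positivity sector the sine is nonpositive, which forces [x.2 <= 2 * del]. *)
have w0 : sin (ca * s) <= 0.
  have P : pi <= ca * s by rewrite -(ca_ell del0 del1) ler_wpM2l //; lra.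
  have Q : ca * s <= 2 * pi.
    by apply: (@le_trans _ _ (1 * s)); [exact: ler_wpM2r|lra].
  rewrite -[ca * s](subrK pi) sinDpi oppr_le0.
  by apply: sin_ge0_pi; apply/andP; split; lra.
have : r * sin (ca * s) <= 0 by rewrite mulr_ge0_le0.
lra.
Qed.

End SpiralFlat.

(** * The singular point *)

Section Tangent.
Context {R : realType}.

(** The relation is linear and homogeneous, so it passes from chords to difference quotients and to
    their limit. *)
Lemma tangent_seq (gamma : R -> R * R) (t0 : R) (h : nat -> R) (c d : R) :
  derivable gamma t0 1 -> h @ \oo --> 0 -> (forall n, h n != 0) ->
  (forall n, c * (gamma (h n + t0) - gamma t0).1 + d * (gamma (h n + t0) - gamma t0).2 = 0) ->
  c * (derive1 gamma t0).1 + d * (derive1 gamma t0).2 = 0.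
Proof.
move=> dg h0 hn0 hE.
have D : (fun k : R => k^-1 *: (gamma (k + t0) - gamma t0)) @ 0^' --> derive1 gamma t0.
  move: dg; rewrite /derivable /derive1.
  by rewrite (_ : (fun k : R => k^-1 *: ((gamma \o shift t0) (k *: 1) - gamma t0)) =
    (fun k : R => k^-1 *: (gamma (k + t0) - gamma t0))) //; apply/funext => k /=; rewrite [k%:A]mulr1.
have hd : h @ \oo --> 0^'.
  move=> A A0; suff : \forall n \near \oo, h n != 0 -> A (h n).
    by apply: filterS => n; exact.
  exact: (h0 _ A0).
have C := cvg_comp _ _ hd D.
have L : (fun n => c * ((h n)^-1 *: (gamma (h n + t0) - gamma t0)).1 +
    d * ((h n)^-1 *: (gamma (h n + t0) - gamma t0)).2) @ \oo -->
    c * (derive1 gamma t0).1 + d * (derive1 gamma t0).2.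
  by apply: cvgD; apply: cvgMl_tmp; apply: (cvg_comp _ _ C); [exact: cvg_fst|exact: cvg_snd].
apply: (cvg_unique _ L) => //.
rewrite (_ : (fun n => _) = cst 0); first exact: cvg_cst.
apply/funext => n /=; rewrite /GRing.scale /=.
by rewrite mulrCA [X in _ + X]mulrCA -mulrDr hE mulr0.
Qed.

(* [v] is the tangent direction at [p]; every line through [p] on which points
   of the curve accumulate at [p] is parallel to it. *)
Lemma curve_tangent (beta : R) (S : set (R * R)) (p : R * R) :
  S p -> C1beta_curve beta S -> exists2 v : R * R, v != 0 &
  forall (q : nat -> R * R) (c d : R), q @ \oo --> p -> (forall n, q n != p) ->
    (\forall n \near \oo, S (q n)) ->
    (forall n, c * (q n - p).1 + d * (q n - p).2 = 0) -> c * v.1 + d * v.2 = 0.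
Proof.
move=> Sp /(_ p Sp)[V [gamma [inv [C [[oV Vp] imE [invK invc] dg _]]]]].
have SVp : (S `&` V) p by [].
have [t0 t0i gt0] : (gamma @` `]-1, 1[%classic) p by rewrite imE.
have [dgt dn0] := dg t0 t0i.
exists (derive1 gamma t0) => // q c d qp qn0 Sq qE.
have SVq : \forall n \near \oo, (S `&` V) (q n).
  by apply: filterI => //; apply: qp; apply: open_nbhs_nbhs.
have [N _ NE] := SVq.
pose q' n := q (n + N)%N.
have SV n : (S `&` V) (q' n) by apply: NE; rewrite /= leq_addl.
have gq n : (inv (q' n) \in `]-1, 1[) /\ gamma (inv (q' n)) = q' n.
  have [s si sE] : (gamma @` `]-1, 1[%classic) (q' n) by rewrite imE.
  by rewrite -sE invK.
have q'p : q' @ \oo --> p.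
  by move=> A /qp; rewrite /nbhs /= => -[M _ MA]; exists M => // n Mn; apply: MA; exact: leq_trans Mn (leq_addr _ _).
have invp : inv p = t0 by rewrite -gt0 invK.
(* Continuity of the inverse is essential: with injectivity alone the parameters could drift to an
   end of the interval while the points return to [p]. *)
have it : (fun n => inv (q' n)) @ \oo --> t0.
  rewrite -invp; move/subspace_continuousP : invc => /(_ p SVp).
  apply: cvg_comp => A pA; suff : \forall n \near \oo, (S `&` V) (q' n) -> A (q' n).
    by apply: filterS => n qA; exact: qA (SV n).
  exact: (q'p _ pA).
apply: (@tangent_seq gamma t0 (fun n => inv (q' n) - t0)) => //.
- by rewrite -(subrr t0); apply: cvgB => //; exact: cvg_cst.
- move=> n; rewrite subr_eq0; apply/eqP => E.
  by have [_ ] := gq n; rewrite E gt0 => /esym/eqP; rewrite (negbTE (qn0 _)).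
- by move=> n; have [_ g] := gq n; rewrite subrK g gt0; exact: qE.
Qed.

End Tangent.

(** * The spirals accumulate at the origin along every ray *)

Section SpiralTip.
Context {R : realType}.
Variable del : R.
Hypotheses (del0 : 0 < del) (del1 : del <= 1 / 100).
Implicit Types (r t a : R) (x y : R * R) (n : nat).
Local Notation ell := (ell del).
Local Notation spU := (spU del).
Local Notation sarg := (sarg del).

Lemma cvg_plane (T : Type) (F : set_system T) (FF : Filter F) (f g : T -> R) (a b : R) :
  f @ F --> a -> g @ F --> b -> (fun z => (f z, g z)) @ F --> (a, b).
Proof. by move=> fa gb; exact: (cvg_pair (G := nbhs a) (H := nbhs b) fa gb). Qed.

Definition cis r t : R * R := (r * cos t, r * sin t).

Lemma rad_cis r t : 0 <= r -> rad (cis r t) = r.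
Proof.
by move=> r0; rewrite /rad /= !exprMn -mulrDr cos2Dsin2 mulr1 sqrtr_sqr ger0_norm.
Qed.

Lemma sarg_cis r t : 0 < r -> sarg (cis r t) = red (t - del * ln r).
Proof.
move=> r0; have rE : rad (cis r t) = r by rewrite rad_cis ?ltW.
have := @homE _ del id (cis r t) t; rewrite rE => /(_ r0 erefl).
by rewrite /hom rE /sarg rE /= => /mulfI; apply; rewrite gt_eqF.
Qed.

Lemma spU_continuous : continuous spU.
Proof. by have [L lu] := spU_lip del0 del1; exact: lip_continuous lu. Qed.

(** At spiral angle 0 the function vanishes, and an arbitrarily small counterclockwise rotation
    enters the positivity sector. *)
Lemma spiral_free_boundary r t : 0 < r -> red (t - del * ln r) = 0 ->
  free_boundary spU (cis r t).
Proof.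
move=> r0 t0; split; last first.
  move/interior_subset => /=.
  by rewrite spU_gt0 // sarg_cis // t0 ltxx andbF.
move=> B nB.
have cc : cis r s @[s --> t] --> cis r t.
  by apply: cvg_plane; apply: cvgMl_tmp; [exact: continuous_cos|exact: continuous_sin].
have nt : \forall s \near t^'+, B (cis r s) by exact: cvg_at_right_filter cc _ nB.
have /andP[l0 l1] := ell_itv del0 del1; have p0 := @pi_gt0 R.
have tl : t < t + ell by lra.
have nS : \forall s \near t^'+, (cis r s \in [set x | 0 < spU x] `&` B).
  near=> s.
  have ts : t < s by near: s; exact: nbhs_right_gt.
  have sl : s < t + ell by near: s; exact: nbhs_right_lt.
  have Bs : B (cis r s) by near: s; exact: nt.
  rewrite inE; split => //=.
  have [k kE] := red_exists (t - del * ln r).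
  rewrite spU_gt0 // rad_cis ?ltW // r0 /= sarg_cis //.
  rewrite (@red_unique _ _ k (s - t)); first by apply/andP; split; lra.
    by move: kE; rewrite t0; lra.
  by apply/andP; split; lra.
have [s sB] := @filter_ex _ _ (at_right_proper_filter t) _ nS.
by rewrite inE in sB; exists (cis r s).
Unshelve. all: by end_near.
Qed.

(* the spiral [t = del * ln r] crosses the ray of angle [a] at these radii *)
Definition spiral_rad a n : R := expR (a / del) * expR (- (2 * pi / del)) ^+ n.

Lemma spiral_rad_gt0 a n : 0 < spiral_rad a n.
Proof. by rewrite mulr_gt0 ?exprn_gt0 ?expR_gt0. Qed.

Lemma spiral_rad_red a n : red (a - del * ln (spiral_rad a n)) = 0.
Proof.
rewrite lnM ?posrE ?exprn_gt0 ?expR_gt0 // lnXn ?expR_gt0 // !expRK.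
apply: (@red_unique _ _ n%:Z); last by rewrite lexx mulr_gt0 ?pi_gt0.
rewrite -[n%:~R]/(n%:R) -mulr_natr.
by field; rewrite gt_eqF.
Qed.

Lemma cvg_spiral a : (fun n => cis (spiral_rad a n) a) @ \oo --> (0, 0).
Proof.
have q1 : `|expR (- (2 * pi / del))| < 1.
  by rewrite gtr0_norm ?expR_gt0 // expR_lt1 oppr_lt0 divr_gt0 // mulr_gt0 ?pi_gt0.
have r0 : spiral_rad a @ \oo --> 0 := cvg_geometric (expR (a / del)) q1.
have c (b : R) : (fun n => spiral_rad a n * b) @ \oo --> 0.
  by rewrite -[X in _ --> X](mul0r b); apply: cvgMr_tmp.
exact: cvg_plane (c _) (c _).
Qed.

Lemma spiral_singular : singular_point spU (0, 0).
Proof.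
have u0 : spU (0, 0) = 0.
  by rewrite /spU /hom /rad /= expr0n /= addr0 sqrtr0 mul0r.
have fb a n : free_boundary spU (cis (spiral_rad a n) a).
  by apply: spiral_free_boundary; [exact: spiral_rad_gt0|exact: spiral_rad_red].
have fb0 : free_boundary spU (0, 0).
  split; last by move/interior_subset => /=; rewrite u0 ltxx.
  (* The closure of the positivity set is closed and contains spiral points tending to the
     origin. *)
  have cl : \forall n \near \oo, closure [set x | 0 < spU x] (cis (spiral_rad 0 n) 0).
    by apply: nearW => n; have [] := fb 0 n.
  exact: closed_cvg (@closed_closure _ _) cl _ (cvg_spiral 0).
split => //; first by rewrite /B1 /= expr0n /= addr0 ltr01.
move=> [U [beta [[oU U0] _ curve]]].
have [v vn0 H] := curve_tangent (conj fb0 U0) curve.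
(* The vector [(- sin a, cos a)] is normal to the ray of angle [a]. Free boundary points on that ray
   tend to 0, so the tangent [v] would be parallel to every ray; the angles 0 and [pi / 2] already
   contradict this. *)
have T a : - sin a * v.1 + cos a * v.2 = 0.
  apply: (H (fun n => cis (spiral_rad a n) a)) => [||| n].
  - exact: cvg_spiral.
  - move=> n; apply/eqP => E; have := spiral_rad_gt0 a n.
    by rewrite -(@rad_cis _ a (ltW (spiral_rad_gt0 a n))) E /rad /= expr0n /= addr0 sqrtr0 ltxx.
  - have nU : nbhs (0, 0) U by exact: open_nbhs_nbhs.
    have [N _ NU] := cvg_spiral a nU.
    by exists N => // n Nn; exact: (conj (fb a n) (NU n Nn)).
  - by rewrite /= !subr0; ring.
have v2 : v.2 = 0 by have := T 0; rewrite sin0 cos0; lra.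
have v1 : v.1 = 0 by have := T (pi / 2); rewrite sin_pihalf cos_pihalf; lra.
by move/eqP: vn0; apply; rewrite [v]surjective_pairing v1 v2.
Qed.

End SpiralTip.

Theorem corollary1p8 (R : realType) (eps : R) (heps : 0 < eps) :
  exists Q : R * R -> R,
    [/\ measurable_fun setT Q,
        forall x, 1 - eps <= Q x <= 1 + eps &
        exists u : R * R -> R,
          [/\ minimizer Q u,
              (* the continuous representative of the minimizer *)
              {within @B1 R, continuous u},
              forall x, B1 x ->
                Num.max (x.2 - eps) 0 <= u x <= Num.max (x.2 + eps) 0 &
              singular_point u (0, 0)]].
Proof.
(* The estimates require [del <= 1 / 100], and [100 * del <= eps] covers both the error [30 * del]
   of the weight and the error [10 * del] of the function. *)
pose del := Num.min eps 1 / 100.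
have m0 : 0 < Num.min eps 1 by rewrite lt_min heps ltr01.
have m1 : Num.min eps 1 <= eps by rewrite ge_min lexx.
have m2 : Num.min eps 1 <= 1 by rewrite ge_min lexx orbT.
have [d0 d1 d2] : [/\ 0 < del, del <= 1 / 100 & 100 * del <= eps].
  by rewrite /del; move: (Num.min eps 1) m0 m1 m2 => m m0 m1 m2; split; lra.
clearbody del; exists (weight del); split.
- exact: measurable_weight.
- by move=> x; have /andP[w0 w1] := weight_itv d0 d1 x; apply/andP; split; lra.
exists (spU del); split.
- exact: spiral_minimizer.
- by apply: continuous_subspaceT; exact: spU_continuous.
- move=> x xB; have /andP[f0 f1] := sp_flat d0 d1 xB.
  rewrite ge_max spU_ge0 // andbT; apply/andP; split; first lra.
  by apply: le_trans f1 _; rewrite ge_max !le_max lexx orbT andbT; apply/orP; left; lra.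
- exact: spiral_singular.
Qed.
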